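(* Let $n\ge 4$, let $\lambda\in D(n)$, and let $\mu$ be a partition of $n$ such that $[\mu](\lambda)\neq 0$. (1) Let $\lambda\in D^-(n)$. Set $m_\pm=\big\langle \langle\lambda\rangle_\pm,\ [\mu]\cdot\langle\lambda\rangle_+\big\rangle$ (inner product of characters of $\tilde S_n$). Then $m_+-m_-=[\mu](\lambda)$. In particular, $0<|[\mu](\lambda)|\le \max(m_+,m_-)\le \big\langle [\mu],\ \langle\lambda\rangle_\pm\cdot\widehat{\langle\lambda\rangle}\big\rangle$ (for either sign in the last expression). (2) Let $\lambda\in D^+(n)$. Set $m_\pm=\big\langle \langle\langle\lambda\rangle\rangle_\pm,\ [\mu]\downarrow_{\tilde A_n}\cdot\langle\langle\lambda\rangle\rangle_+\big\rangle$ (inner product of characters of $\tilde A_n$). Then $m_+-m_-=[\mu](\lambda)$ and $m_++m_-=2m_-+[\mu](\lambda)=\big\langle[\mu]\langle\lambda\rangle,\langle\lambda\rangle\big\rangle$ (the last inner product being one of characters of $\tilde S_n$). In particular, $0<|[\mu](\lambda)|\le\max(m_+,m_-)\le\big\langle[\mu]\langle\lambda\rangle,\langle\lambda\rangle\big\rangle$ and $\big\langle[\mu]\langle\lambda\rangle,\langle\lambda\rangle\big\rangle\equiv[\mu](\lambda) \pmod 2$.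
   Context: All characters are complex characters; the outer $\langle\cdot,\cdot\rangle$ with two arguments denotes the usual inner product of characters. $P(n)$ is the set of partitions of $n$; $l(\lambda)$ is the number of positive parts of $\lambda$; $O(n)$ is the set of partitions of $n$ into odd parts; $D(n)$ is the set of partitions of $n$ into distinct parts; $D^+(n)$ (resp. $D^-(n)$) is the set of $\lambda\in D(n)$ with $n-l(\lambda)$ even (resp. odd). $[\mu]$ denotes the irreducible character of the symmetric group $S_n$ labelled by $\mu\in P(n)$, and $[\mu](\lambda)$ its value on elements of cycle type $\lambda$. $\tilde S_n$ denotes one of the two double covers of $S_n$: it is generated by a central element $z$ of order 2 and $t_1,\dots,t_{n-1}$ (with $t_i$ mapping to the transposition $(i\ i{+}1)$), with relations either $t_i^2=z$, $(t_it_{i+1})^3=z$, $t_it_j=zt_jt_i$ for $|i-j|>1$; or $t_i^2=1$, $(t_it_{i+1})^3=1$, $t_it_j=zt_jt_i$ for $|i-j|>1$. Characters of $S_n$ are identified with their inflations to $\tilde S_n$; $\mathrm{sgn}$ is the inflated sign character. Spin characters of $\tilde S_n$ are those whose kernel does not contain $z$. By Schur's classification, the irreducible spin characters are: one character $\langle\lambda\rangle=\mathrm{sgn}\cdot\langle\lambda\rangle$ for each $\lambda\in D^+(n)$, and a pair of distinct associate characters $\langle\lambda\rangle_+$, $\langle\lambda\rangle_-=\mathrm{sgn}\cdot\langle\lambda\rangle_+$ for each $\lambda\in D^-(n)$. The labelling is determined as follows: for a suitable choice of one class $C^+_\alpha$ of $\tilde S_n$ among the two classes projecting to cycle type $\alpha$,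 for each $\alpha\in O(n)$ (with $C^+_{(1^n)}=\{1\}$ and such that the spin characters labelled by $(n)$ have value $2^{\lfloor (l(\alpha)-1)/2\rfloor}$ on $C^+_\alpha$), the value $\varphi^\lambda_\alpha$ of the spin character(s) labelled $\lambda$ on $C_\alpha^+$ is given by $Q_\lambda=\sum_{\alpha\in O(n)}2^{(l(\lambda)+l(\alpha)+\varepsilon(\lambda))/2}z_\alpha^{-1}\varphi^\lambda_\alpha\, p_\alpha$, where $Q_\lambda$ is Schur's Q-function, $p_\alpha$ the power sum, $z_\alpha$ the centralizer order of an element of type $\alpha$ in $S_n$, and $\varepsilon(\lambda)=0$ or $1$ according to $\lambda\in D^+(n)$ or $D^-(n)$. $\widehat{\langle\lambda\rangle}=\langle\lambda\rangle$ if $\lambda\in D^+(n)$ and $\widehat{\langle\lambda\rangle}=\langle\lambda\rangle_++\langle\lambda\rangle_-$ if $\lambda\in D^-(n)$. $\tilde A_n$ is the preimage of the alternating group $A_n$ in $\tilde S_n$, and $\downarrow_{\tilde A_n}$ denotes restriction. For $\lambda\in D^+(n)$, the restriction $\langle\lambda\rangle\downarrow_{\tilde A_n}=\langle\langle\lambda\rangle\rangle_++\langle\langle\lambda\rangle\rangle_-$ is the sum of two distinct ($\tilde S_n$-conjugate) irreducible spin characters $\langle\langle\lambda\rangle\rangle_\pm$ of $\tilde A_n$. Products are pointwise products of characters. *)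

(* Defs.v *)
From HB Require Import structures.
From mathcomp Require Import all_boot all_order all_algebra all_fingroup.
From mathcomp Require Import all_solvable all_field all_character.
From mathcomp Require Import mpoly.
Set Implicit Arguments.
Unset Strict Implicit.
Unset Printing Implicit Defensive.
Import Order.TTheory GRing.Theory Num.Theory.
Local Open Scope ring_scope.

(** Partitions *)

Definition is_part (n : nat) (mu : seq nat) : bool :=
  [&& sorted geq mu, all (leq 1) mu & sumn mu == n].

Definition in_O (n : nat) (al : seq nat) : bool := is_part n al && all odd al.

Definition in_D (n : nat) (la : seq nat) : bool := is_part n la && uniq la.

Definition in_Dplus (n : nat) (la : seq nat) : bool :=
  in_D n la && ~~ odd (n - size la).

Definition in_Dminus (n : nat) (la : seq nat) : bool :=
  in_D n la && odd (n - size la).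

Definition conj_part (mu : seq nat) : seq nat :=
  [seq count (leq k) mu | k <- iota 1 (head 0%N mu)].

(* Obtained from the [n]-tuples with entries at most [n] by deleting zeros;
   see [mem_parts]. *)
Definition parts (n : nat) : seq (seq nat) :=
  undup [seq mu <- [seq [seq x <- [seq val i | i <- tval t] | (0 < x)%N]
                   | t : n.-tuple 'I_n.+1]
        | is_part n mu].

Lemma uniq_parts n : uniq (parts n).
Proof. exact: undup_uniq. Qed.

Lemma mem_parts n mu : (mu \in parts n) = is_part n mu.
Proof.
rewrite mem_undup mem_filter; case: (boolP (is_part n mu)) => //= pmu.
case/and3P: pmu => _ pos_mu /eqP sum_mu.
have sz_mu : (size mu <= n)%N.
  rewrite -sum_mu; elim: mu pos_mu {sum_mu} => //= x mu IH /andP[x1 /IH le].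
  by rewrite -add1n leq_add.
have lt_mu x : x \in mu -> (x < n.+1)%N.
  by rewrite ltnS -sum_mu sumnE => x_mu; rewrite (big_rem x) //= leq_addr.
pose s := [seq inord x : 'I_n.+1 | x <- mu ++ nseq (n - size mu) 0%N].
have sz_s : size s == n by rewrite size_map size_cat size_nseq subnKC.
apply/imageP; exists (Tuple sz_s) => //=.
have -> : [seq val i | i <- s] = mu ++ nseq (n - size mu) 0%N.
  rewrite -map_comp -[RHS]map_id; apply/eq_in_map => x /=.
  rewrite mem_cat mem_nseq => x_in; rewrite inordK //.
  by case/orP: x_in => [/lt_mu|/andP[_ /eqP->]].
rewrite filter_cat (all_filterP pos_mu).
suff /eqP -> : [seq x <- nseq (n - size mu) 0%N | (0 < x)%N] == [::].
  by rewrite cats0.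
by rewrite -size_eq0 size_filter count_nseq.
Qed.

(** Characters of symmetric groups *)

Definition cycle_type (n : nat) (w : 'S_n) : seq nat :=
  sort geq [seq #|X| | X : {set 'I_n} <- enum (porbits w)].

Fact sgn_char_subproof (n : nat) :
  is_class_fun <<[set: 'S_n]>>%g [ffun w : 'S_n => (-1) ^+ odd_perm w : algC].
Proof.
apply: intro_class_fun => [x y _ _ | x]; last by rewrite mem_gen ?inE.
by rewrite odd_permJ.
Qed.

Definition sgn_char (n : nat) : 'CF([set: 'S_n]) := Cfun 0 (sgn_char_subproof n).

(* The row stabilizer of the tableau of shape [mu] filled consecutively
   row by row. *)
Definition young (n : nat) (mu : seq nat) : {set 'S_n} :=
  [set w : 'S_n | [forall i, reshape_index mu (w i) == reshape_index mu i]].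

Fact young_group_set (n : nat) (mu : seq nat) : group_set (young n mu).
Proof.
apply/group_setP; split=> [|x y].
  by rewrite inE; apply/forallP => i; rewrite perm1.
rewrite !inE => /forallP hx /forallP hy; apply/forallP => i.
by rewrite permM (eqP (hy _)) (eqP (hx _)).
Qed.
Canonical young_group n mu := Group (young_group_set n mu).

(* James and Kerber's definition of [mu]: the unique common irreducible
   constituent of the trivial character induced from the Young subgroup of mu
   and of the sign character induced from the Young subgroup of the conjugate
   partition.  The value 0 is never taken when [is_part n mu]. *)
Definition sym_char (n : nat) (mu : seq nat) : 'CF([set: 'S_n]) :=
  if [pick i : Iirr [set: 'S_n] |
        (i \in irr_constt ('Ind[[set: 'S_n]] (1 : 'CF(young n mu))))
        && (i \in irr_constt ('Ind[[set: 'S_n]]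
                   ('Res[young n (conj_part mu)] (sgn_char n))))]
  is Some i then 'chi_i else 0.

(** Schur's Q-functions, in [N] variables *)

Section QFunctions.
Variable N : nat.

Definition psum_part (al : seq nat) : {mpoly algC[N]} :=
  \prod_(k <- al) \sum_(i < N) 'X_i ^+ k.

Definition complete_sym (k : nat) : {mpoly algC[N]} :=
  \sum_(m : 'X_{1..N < k.+1} | mdeg m == k) 'X_[m].

(* The coefficient of t^r in \prod_i (1 + x_i t) / (1 - x_i t). *)
Definition schur_q (r : nat) : {mpoly algC[N]} :=
  \sum_(a < r.+1) mesym N algC a * complete_sym (r - a).

(* Meant for a > b >= 0. *)
Definition schur_Q2 (a b : nat) : {mpoly algC[N]} :=
  schur_q a * schur_q b
  + 2%:R * \sum_(1 <= i < b.+1) (-1) ^+ i * (schur_q (a + i) * schur_q (b - i)).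

(* The Pfaffian of the skew-symmetric matrix whose (i, j) entry, i < j, is
   [schur_Q2 s`_i s`_j], expanded along its first row; [size s] must be
   twice [k]. *)
Fixpoint Q_pfaffian (k : nat) (s : seq nat) : {mpoly algC[N]} :=
  match k, s with
  | k'.+1, a :: s' =>
      \sum_(j < size s') (-1) ^+ j *
        (schur_Q2 a (nth 0%N s' j) * Q_pfaffian k' (take j s' ++ drop j.+1 s'))
  | _, _ => 1
  end.

(* Schur's original definition, for a partition [la] into distinct parts; a
   part 0 is appended when the length of [la] is odd. *)
Definition schur_Q (la : seq nat) : {mpoly algC[N]} :=
  let s := if odd (size la) then rcons la 0%N else la in
  Q_pfaffian (size s)./2 s.

End QFunctions.

(** Double covers of symmetric groups *)

Section DoubleCover.
Variables (n : nat) (gT : finGroupType) (G : {group gT}).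
Variables (z : gT) (t : nat -> gT) (pi : {morphism G >-> 'S_n}).

(* The generators [t i] are indexed from 0 to n - 2, and [t i] lies above the
   transposition of the points i and i + 1 of ['I_n].  The element [u] below
   is z for one of the two covers and 1 for the other. *)
Record double_cover : Prop := DoubleCover {
  cover_central : z \in 'Z(G)%g;
  cover_order   : #[z]%g = 2%N;
  cover_ker     : ('ker pi = <[z]>)%g;
  cover_im      : (pi @* G = [set: 'S_n])%g;
  cover_mem     : forall i, (i.+1 < n)%N -> t i \in G;
  cover_tperm   : forall i j : 'I_n, j = i.+1 :> nat -> pi (t i) = tperm i j;
  cover_gen     : (G :=: << z |: [set t i | i : 'I_n.-1] >>)%g;
  cover_rel     : exists2 u, u = z \/ u = 1%g &
    [/\ forall i, (i.+1 < n)%N -> (t i ^+ 2)%g = u,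
        forall i, (i.+2 < n)%N -> ((t i * t i.+1) ^+ 3)%g = u
      & forall i j, (i.+1 < n)%N -> (j.+1 < n)%N ->
          (i.+1 < j)%N || (j.+1 < i)%N -> (t i * t j = z * t j * t i)%g]
}.

(* The restriction is the identity up to the type of its result when
   [pi] is onto. *)
Definition inflate (phi : 'CF([set: 'S_n])) : 'CF(G) :=
  cfMorph ('Res[pi @* G] phi).

Definition associate (chi : 'CF(G)) : 'CF(G) := inflate (sgn_char n) * chi.

Definition spin_irr (chi : 'CF(G)) : bool :=
  (chi \in irr G) && (z \notin cfker chi).

Definition alt_cover : {group gT} := (pi @*^-1 'Alt_('I_n))%G.

(* [c al] is a representative of the class C^+_al.  [S la] is <la> for la in
   D^+(n), and <la>_+ for la in D^-(n), the character <la>_- then being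
   [associate (S la)]. *)
Record spin_labelling (c : seq nat -> gT) (S : seq nat -> 'CF(G)) : Prop :=
 SpinLabelling {
  label_class : forall al, in_O n al -> c al \in G /\ cycle_type (pi (c al)) = al;
  label_class1 : c (nseq n 1%N) = 1%g;
  label_basic : forall al, in_O n al ->
    S [:: n] (c al) = 2 ^+ (size al).-1./2;
  label_spin : forall la, in_D n la -> spin_irr (S la);
  label_plus : forall la, in_Dplus n la -> associate (S la) = S la;
  label_minus : forall la, in_Dminus n la -> associate (S la) <> S la;
  label_inj : forall la nu, in_D n la -> in_D n nu ->
    S la = S nu \/ S la = associate (S nu) -> la = nu;
  label_all : forall chi, spin_irr chi ->
    exists2 la, in_D n la & chi = S la \/ chi = associate (S la);
  label_Q : forall la, in_D n la -> forall N,
    schur_Q N la =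
      \sum_(al <- parts n | all odd al)
        (2 ^+ (size la + size al + odd (n - size la))./2
         * (#|'C[pi (c al)]%g|%:R)^-1 * S la (c al)) *: psum_part N al
}.

Definition spin_hat (S : seq nat -> 'CF(G)) (la : seq nat) : 'CF(G) :=
  if odd (n - size la) then S la + associate (S la) else S la.

End DoubleCover.

(* Main.v *)
Require Import Defs.
From mathcomp Require Import all_boot all_order all_algebra all_fingroup.
From mathcomp Require Import all_solvable all_field all_character.
From mathcomp Require Import mpoly ring zify.
Set Implicit Arguments.
Unset Strict Implicit.
Unset Printing Implicit Defensive.
Import Order.TTheory GRing.Theory Num.Theory.
Local Open Scope ring_scope.

(** Let A and B be the two associate characters (of the double cover if la is in D^-,
    of the double cover of the alternating group if la is in D^+), and D = A - B.
    For a class C of S_n, let s(C) be the part of <D, A> coming from the elements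
    above C.  Everything follows from s(C_la) = 1 together with the vanishing of D
    off C_la, since [mu] is constant on C_la.

    D vanishes on cycle types with a repeated part.  Hence, for each prime p, the
    p-section of C_la contributes to <D, A> only through C_la itself.  Sums over
    p-sections become algebraic integers when multiplied by the p'-part of the group
    order, and sums over rational classes are rational, so s(C_la) is an integer.
    As 2 s(C) is the part of <D, D> = 2 coming from C, each s(C) is nonnegative and
    the s(C) add up to 1: it remains to see that s(C_la) is not 0.

    A + B vanishes outside the cycle types with odd parts only, and the 2-section of
    C_la contains exactly one such type be, obtained by splitting each part 2^k m,
    m odd, into 2^k parts m.  If s(C_la) = 0, the contribution of be to <A + B, A>
    would be even at 2.  But it is read off the coefficient of p_be in Q_la, and
    modulo 2 the Pfaffian Q_la is the product of the q_(la_i), whose pairing with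
    p_be is the coefficient of x^la in p_be.  By the Frobenius congruence
    p_m^(2^k) = p_(2^k m), p_be is congruent to p_la, where this coefficient is 1. *)

(** * Orbits and cycle types of permutations *)

(** Schur's explicit values of D on C_la are never computed: only the partial inner product of D and
    A over that class is used, and integrality determines it.

    Both cases are instances of one argument, for a group K mapping to S_n and two irreducible
    characters A, B whose products A A*, B B* and A B*, B A* have the same sums above every class of
    S_n. For associate characters this symmetry comes from the sign; for the alternating cover it
    comes from conjugation by an odd element.

    The congruence modulo 2 cannot be read on coefficients, since the q_r have fractional
    coefficients in the power sums. It is read on the pairing with odd power sums, which is integral
    on products of the q_r: half of b times the derivative in p_b sends q_r to q_(r - b). Such
    derivatives require the power sums to be indeterminates, so the identity defining the labelling,
    known in every number N of variables, is lifted to formal power sums.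

    Powers of 2 matter twice: in the normalization of spin values by Q_la, and in z_be, whose 2-adic
    valuation is large because be has many equal parts. The two effects are compared in
    [value_norm]. *)

Section Perms.
Variable T : finType.
Implicit Types (w v h : {perm T}) (x y : T).
Local Open Scope group_scope.

Lemma expg_fix_dvdn w x k : ((w ^+ k) x == x) = (#|porbit w x| %| k)%N.
Proof.
have d0 : (0 < #|porbit w x|)%N by rewrite lt0n card_porbit_neq0.
rewrite permX {1}(divn_eq k #|porbit w x|) addnC iterD.
have -> : iter (k %/ #|porbit w x| * #|porbit w x|) w x = x.
  by elim: (_ %/ _)%N => //= q IH; rewrite mulSn iterD IH iter_porbit.
rewrite /dvdn; have := uniq_traject_porbit w x.
case Dr: (k %% #|porbit w x|)%N => [|r] /=; first by rewrite !eqxx.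
move=> U.
have lt : (r.+1 < #|porbit w x|)%N by rewrite -Dr ltn_pmod // lt0n card_porbit_neq0.
apply/negbTE/eqP => E; have := nth_uniq x (s := traject w x #|porbit w x|).
move/(_ 0%N r.+1); rewrite size_traject lt (leq_ltn_trans _ lt) // => /(_ isT isT U).
by rewrite !nth_traject ?(leq_ltn_trans _ lt) //= E eqxx.
Qed.

(** An orbit length is determined by its multiples, namely the exponents whose powers fix the
    point. *)
Lemma card_porbitX w j x :
  #|porbit (w ^+ j) x| = (#|porbit w x| %/ gcdn #|porbit w x| j)%N.
Proof.
set d := #|porbit w x|; have d0 : (0 < d)%N by rewrite lt0n card_porbit_neq0.
have g0 : (0 < gcdn d j)%N by rewrite gcdn_gt0 d0.
have E k : (#|porbit (w ^+ j) x| %| k)%N = (d %/ gcdn d j %| k)%N.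
  rewrite -expg_fix_dvdn -expgM expg_fix_dvdn -/d.
  rewrite -[RHS](dvdn_pmul2r g0) divnK ?dvdn_gcdl // [(k * _)%N]mulnC muln_gcdl.
  by rewrite dvdn_gcd (dvdn_mulr k (dvdnn d)).
by apply/eqP; rewrite eqn_dvd E dvdnn -E dvdnn.
Qed.

Lemma card_porbit_constt w (pi : nat_pred) x : #|porbit w.`_pi x| = (#|porbit w x|`_pi)%N.
Proof.
rewrite /constt card_porbitX; set d := #|porbit w x|.
have d0 : (0 < d)%N by rewrite lt0n card_porbit_neq0.
have dw : (d %| #[w])%N by rewrite -expg_fix_dvdn expg_order perm1.
(* [j] is 1 modulo the pi-part of the order of [w] and 0 modulo its pi'-part, so its gcd with [d] is
   the pi'-part of [d]. *)
set j := chinese _ _ _ _.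
have -> : gcdn d j = (d`_pi^')%N.
  have j1 : coprime (d`_pi) j.
    apply: (@coprime_dvdl _ (#[w]`_pi)); first by rewrite partn_dvd.
    by rewrite -coprime_modr chinese_modl ?coprime_partC // coprime_modr coprimen1.
  have j2 : (d`_pi^' %| j)%N.
    apply: (@dvdn_trans (#[w]`_pi^')%N); first by rewrite partn_dvd.
    by rewrite /dvdn chinese_modr ?coprime_partC // mod0n.
  by rewrite gcdnC -{1}(partnC pi d0) Gauss_gcdr 1?coprime_sym //; apply/gcdn_idPr.
by rewrite -{1}(partnC pi d0) mulnK ?part_gt0.
Qed.

Lemma card_porbitJ w h x : #|porbit (w ^ h) (h x)| = #|porbit w x|.
Proof.
have E k : (#|porbit (w ^ h) (h x)| %| k)%N = (#|porbit w x| %| k)%N.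
  by rewrite -!expg_fix_dvdn -conjXg permJ (inj_eq perm_inj).
by apply/eqP; rewrite eqn_dvd E dvdnn -E dvdnn.
Qed.

Lemma card_porbit_mem w x y : y \in porbit w x -> #|porbit w y| = #|porbit w x|.
Proof. by rewrite -eq_porbit_mem => /eqP->. Qed.

End Perms.

Section PermConjugacy.
Variable T : finType.
Implicit Types (w v h : {perm T}) (x y : T).
Local Open Scope group_scope.

Lemma eq_expg_porbit w v x y k l :
  #|porbit w x| = #|porbit v y| -> (w ^+ k) x = (w ^+ l) x -> (v ^+ k) y = (v ^+ l) y.
Proof.
move=> eq_per; wlog kl : k l / (k <= l)%N => [H|].
  by case/orP: (leq_total k l) => [/H//|/H{}H /esym/H/esym].
rewrite -(subnK kl) !expgD !permM => /esym/perm_inj/eqP.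
by rewrite expg_fix_dvdn eq_per -expg_fix_dvdn => /eqP->.
Qed.

(** Orbits of equal size are matched by their rank in an enumeration ([Phi]), base points [b x] and
    [b' x] are chosen in matched orbits, and the conjugator sends [(w ^+ k) (b x)] to
    [(v ^+ k) (b' x)]. Equality of the orbit sizes makes this independent of [k]. *)
Lemma perm_conj_porbits w v :
  (forall k, #|[set O in porbits w | #|O| == k]| = #|[set O in porbits v | #|O| == k]|) ->
  exists h, v = w ^ h.
Proof.
move=> eq_count.
pose P (u : {perm T}) (k : nat) := [set O in porbits u | #|O| == k].
have eq_size k : size (enum (P v k)) = size (enum (P w k)) by rewrite -!cardE /P eq_count.
pose Phi (O : {set T}) := nth set0 (enum (P v #|O|)) (index O (enum (P w #|O|))).
have PhiP O : O \in porbits w -> Phi O \in P v #|O|.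
  move=> Ow; rewrite -mem_enum /Phi mem_nth // eq_size index_mem mem_enum.
  by rewrite inE Ow /=.
have Phi_inj : {in porbits w &, injective Phi}.
  move=> O O' Ow Ow' eqP'; have := PhiP _ Ow; have := PhiP _ Ow'.
  rewrite -eqP' !inE => /andP[_ /eqP k1] /andP[_ /eqP k2].
  have eqk : #|O| = #|O'| by rewrite -k1 -k2.
  move: eqP'; rewrite /Phi eqk => /eqP.
  rewrite nth_uniq ?enum_uniq ?eq_size ?index_mem ?mem_enum ?inE ?Ow ?Ow' ?eqk ?eqxx //.
  have mem_eP X : X \in porbits w -> #|X| = #|O'| -> X \in enum (P w #|O'|).
    by move=> Xw kX; rewrite mem_enum inE Xw kX /=.
  by move/eqP => E; rewrite -(nth_index set0 (mem_eP O Ow eqk)) E nth_index ?mem_eP.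
pose b x := odflt x [pick y in porbit w x].
pose b' x := odflt x [pick y in Phi (porbit w x)].
have porb x : porbit w x \in porbits w by apply: imset_f.
have bP x : b x \in porbit w x.
  by rewrite /b; case: pickP => //= /(_ x); rewrite porbit_id.
have b'P x : b' x \in Phi (porbit w x).
  rewrite /b'; case: pickP => //= N0; have := PhiP _ (porb x).
  by rewrite inE => /andP[/imsetP[z _ Dz] _]; have := N0 z; rewrite Dz porbit_id.
have b'orb x : porbit v (b' x) = Phi (porbit w x).
  have := PhiP _ (porb x); rewrite inE => /andP[/imsetP[z _ Dz] _].
  by have := b'P x; rewrite Dz -eq_porbit_mem => /eqP.
have per x : #|porbit w (b x)| = #|porbit v (b' x)|.
  rewrite b'orb (card_porbit_mem (bP x)).
  by have := PhiP _ (porb x); rewrite inE => /andP[_ /eqP].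
have bq x y : porbit w x = porbit w y -> b x = b y /\ b' x = b' y.
  move=> eq_xy; rewrite /b /b' eq_xy; split; last first.
    by case: pickP => //= N0; have := N0 (b' y); rewrite b'P.
  by case: pickP => //= /(_ y); rewrite porbit_id.
have expo x : exists k, (w ^+ k) (b x) == x.
  have /porbitP[k Dx] : x \in porbit w (b x) by rewrite porbit_sym.
  by exists k; rewrite -Dx.
have [e eP] : exists e : T -> nat, forall x, (w ^+ e x) (b x) = x.
  by exists (fun x => xchoose (expo x)) => x; apply/eqP/(xchooseP (expo x)).
pose h0 x := (v ^+ e x) (b' x).
have h0E x k : x = (w ^+ k) (b x) -> h0 x = (v ^+ k) (b' x).
  move=> Dx; apply: (eq_expg_porbit (per x)).
  by rewrite -Dx eP.
have h0orb x : porbit v (h0 x) = Phi (porbit w x) by rewrite porbit_perm b'orb.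
have h0_inj : injective h0.
  move=> x y eq_h; have eq_orb : porbit w x = porbit w y.
    by apply: Phi_inj => //; rewrite -!h0orb eq_h.
  have [eb eb'] := bq _ _ eq_orb.
  rewrite -(eP x) -(eP y) eb; apply: (eq_expg_porbit (esym (per y))).
  by move: eq_h; rewrite /h0 eb'.
exists (perm h0_inj); apply/permP => y.
have [x ->] : exists x, y = perm h0_inj x.
  by exists ((perm h0_inj)^-1 y); rewrite permKV.
rewrite permJ !permE.
have [eb eb'] : b (w x) = b x /\ b' (w x) = b' x.
  by apply: bq; have := porbit_perm w 1 x; rewrite expg1.
rewrite (h0E (w x) (e x).+1).
  by rewrite eb' expgSr permM.
by rewrite eb expgSr permM eP.
Qed.

Lemma restr_porbitE w x y :
  restr_perm (porbit w x) w y = if y \in porbit w x then w y else y.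
Proof.
case: ifP => [yO | /negbT yO]; last by rewrite (out_perm (restr_perm_on _ _)).
rewrite restr_permE //; apply/astabsP => z /=; rewrite apermE -!eq_porbit_mem.
by have := porbit_perm w 1 z; rewrite expg1 => ->.
Qed.

Lemma odd_restr_porbit w x : odd_perm (restr_perm (porbit w x) w) = ~~ odd #|porbit w x|.
Proof.
set O := porbit w x; set c := restr_perm O w.
have cE k : (c ^+ k) x = (w ^+ k) x.
  elim: k => [|k IH]; first by rewrite !expg0.
  by rewrite !expgSr !permM IH restr_porbitE mem_porbit.
have porbO : porbit c x = O.
  apply/setP => y; apply/porbitP/porbitP => -[k ->]; exists k; rewrite ?cE //.
have porb1 y : y \notin O -> porbit c y = [set y].
  move=> yO; apply/setP => z; rewrite inE; apply/porbitP/eqP => [[k ->]|->].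
    by rewrite permX_fix // restr_porbitE (negbTE yO).
  by exists 0%N; rewrite expg0 perm1.
have porbs : porbits c = O |: (set1 @: (~: O)).
  apply/setP => A; apply/imsetP/setU1P.
    case=> y _ ->; have [yO|yO] := boolP (y \in O); [left | right].
      by apply/eqP; rewrite -porbO eq_porbit_mem porbO.
    by rewrite porb1 //; apply: imset_f; rewrite inE.
  case=> [->|/imsetP[y yO ->]]; first by exists x.
  by exists y; rewrite ?porb1 //; rewrite inE in yO.
rewrite /odd_perm porbs cardsU1 card_imset; last exact: set1_inj.
have -> : O \notin [set [set x0] | x0 in ~: O].
  apply/imsetP => -[y yO E]; have : y \in O by rewrite E set11.
  by move=> yO'; rewrite inE yO' in yO.
rewrite oddD /= -addTb addbC -addbA -(cardsC O) oddD -/O.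
by case: (odd _); case: (odd _).
Qed.

Lemma tperm_prod_act (a b : nat -> T) k (t := \prod_(0 <= j < k) tperm (a j) (b j)) :
  {in gtn k &, injective a} -> {in gtn k &, injective b} ->
  {in gtn k &, forall i j, a i != b j} ->
  [/\ forall i, (i < k)%N -> t (a i) = b i /\ t (b i) = a i,
      forall x, (forall i, (i < k)%N -> x != a i /\ x != b i) -> t x = x
    & odd_perm t = odd k].
Proof.
rewrite {}/t; elim: k => [|k IH] a_inj b_inj ab.
  by split=> // [x _|]; rewrite big_geq ?perm1 ?odd_perm1.
have lek i : (i < k)%N -> (i < k.+1)%N by exact: ltnW.
have [|||act fix_out par] := IH.
- by move=> i j Hi Hj; apply: a_inj; exact: lek.
- by move=> i j Hi Hj; apply: b_inj; exact: lek.
- by move=> i j Hi Hj; apply: ab; exact: lek.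
rewrite big_nat_recr //=; set t := \prod_(_ <= _ < k) _ in act fix_out par *.
have ne i : (i < k)%N -> [/\ a i != a k, b i != b k, a i != b k & b i != a k].
  move=> ik; have ik1 : i \in gtn k.+1 by rewrite inE ltnW.
  have kk1 : k \in gtn k.+1 by rewrite inE.
  split; last 2 first.
  - exact: ab.
  - by rewrite eq_sym; apply: ab.
  - by apply: contraTneq ik => /a_inj-> //; rewrite ltnn.
  - by apply: contraTneq ik => /b_inj-> //; rewrite ltnn.
have [tak tbk] : t (a k) = a k /\ t (b k) = b k.
  by split; apply: fix_out => i /ne[n1 n2 n3 n4]; split; rewrite eq_sym.
split=> [i|x Hx|].
- rewrite ltnS leq_eqVlt => /predU1P[->|ik].
    by rewrite !permM tak tbk tpermL tpermR.
  have [t1 t2] := act i ik; have [n1 n2 n3 n4] := ne i ik.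
  by rewrite !permM t1 t2 !tpermD // eq_sym.
- have [x1 x2] := Hx k (ltnSn k).
  by rewrite permM fix_out ?tpermD // 1?eq_sym // => i /lek; exact: Hx.
- by rewrite odd_permM par odd_tperm ab ?inE //= addbT.
Qed.

(** The involution exchanges [(w ^+ j) x] and [(w ^+ j) y] for every [j]. It is a product of as many
    transpositions as the common orbit length, which gives its parity. *)
Lemma porbit_swap w x y :
    y \notin porbit w x -> #|porbit w x| = #|porbit w y| ->
  exists s, [/\ s ^+ 2 = 1, w ^ s = w, perm_on (porbit w x :|: porbit w y) s,
     restr_perm (porbit w x) w ^ s = restr_perm (porbit w y) w
   & odd_perm s = odd #|porbit w x|].
Proof.
move=> yx eqk; set k := #|porbit w x| in eqk *.
have k0 : (0 < k)%N by rewrite lt0n card_porbit_neq0.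
pose a j := (w ^+ j) x; pose b j := (w ^+ j) y.
have it_inj z (lt_z : #|porbit w z| = k) : {in gtn k &, injective (fun j => (w ^+ j) z)}.
  move=> i j; rewrite !inE => ik jk /eqP E.
  have := nth_uniq z (s := traject w z k) (i := i) (j := j).
  rewrite size_traject !nth_traject // -!permX E -lt_z uniq_traject_porbit lt_z.
  by move=> /(_ ik jk isT)/esym/eqP.
have ab i j : a i != b j.
  apply: contraNneq yx => E; rewrite -eq_porbit_mem eq_sym.
  by rewrite -(porbit_perm w i x) -(porbit_perm w j y) -/(a i) E.
have [act fix_out par] := tperm_prod_act (it_inj x erefl) (it_inj y (esym eqk)) (fun i j _ _ => ab i j).
set s := \prod_(_ <= _ < _) _ in act fix_out par.
have actX j : s (a j) = b j /\ s (b j) = a j.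
  have [E1 E2] : a j = a (j %% k)%N /\ b j = b (j %% k)%N.
    have red z : #|porbit w z| = k -> (w ^+ j) z = (w ^+ (j %% k)) z.
      move=> kz; rewrite {1}(divn_eq j k) expgD permM; congr (_ _); apply/eqP.
      by rewrite expg_fix_dvdn kz dvdn_mull.
    by rewrite /a /b !red.
  by rewrite E1 E2; apply: act; rewrite ltn_mod.
have out z : z \notin porbit w x -> z \notin porbit w y -> s z = z.
  move=> zx zy; apply: fix_out => i _; split; [apply: contraNneq zx | apply: contraNneq zy] => ->; exact: mem_porbit.
have aS j : w (a j) = a j.+1 by rewrite /a expgSr permM.
have bS j : w (b j) = b j.+1 by rewrite /b expgSr permM.
have sw z : s (w z) = w (s z).
  have [/porbitP[j ->]|zx] := boolP (z \in porbit w x).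
    by rewrite -/(a j) aS !(proj1 (actX _)) bS.
  have [/porbitP[j ->]|zy] := boolP (z \in porbit w y).
    by rewrite -/(b j) bS !(proj2 (actX _)) aS.
  have wz : porbit w (w z) = porbit w z by have := porbit_perm w 1 z; rewrite expg1.
  by rewrite !out // -eq_porbit_mem wz eq_porbit_mem.
have sx z : (s z \in porbit w y) = (z \in porbit w x).
  have [/porbitP[j ->]|zx] := boolP (z \in porbit w x).
    by rewrite (proj1 (actX _)) mem_porbit.
  have [/porbitP[j ->]|zy] := boolP (z \in porbit w y); last by rewrite out // (negbTE zy).
  rewrite (proj2 (actX _)) -eq_porbit_mem porbit_perm eq_porbit_mem porbit_sym (negbTE yx) //.
exists s; split=> //.
- apply/permP => z; rewrite expgS expg1 permM perm1.
  have [/porbitP[j ->]|zx] := boolP (z \in porbit w x).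
    by rewrite (proj1 (actX _)) (proj2 (actX _)).
  have [/porbitP[j ->]|zy] := boolP (z \in porbit w y); last by rewrite !out.
  by rewrite (proj2 (actX _)) (proj1 (actX _)).
- apply/permP => z; have -> : z = s (s^-1 z) by rewrite permKV.
  by rewrite permJ sw.
- apply/subsetP => z; rewrite !inE; apply: contraR; rewrite negb_or => /andP[zx zy].
  by rewrite out.
- apply/permP => z; have -> : z = s (s^-1 z) by rewrite permKV.
  by rewrite permJ !restr_porbitE sx; case: ifP.
Qed.

End PermConjugacy.

Section CycleType.
Variable n : nat.
Implicit Types w v h : 'S_n.
Local Open Scope group_scope.
Local Open Scope nat_scope.

Lemma perm_cycle_type w :
  perm_eq (cycle_type w) [seq #|X| | X : {set 'I_n} <- enum (porbits w)].
Proof. by rewrite perm_sort. Qed.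

Lemma geq_total : total geq. Proof. by move=> x y; rewrite /geq /= leq_total. Qed.
Lemma geq_trans : transitive geq.
Proof. by move=> x y z yx xz; exact: leq_trans xz yx. Qed.
Lemma geq_anti : antisymmetric geq.
Proof. by move=> x y; rewrite /geq /= => /andP[? ?]; apply/eqP; rewrite eqn_leq; apply/andP. Qed.

Lemma sorted_cycle_type w : sorted geq (cycle_type w).
Proof. exact: sort_sorted geq_total _. Qed.

Lemma size_cycle_type w : size (cycle_type w) = #|porbits w|.
Proof. by rewrite size_sort size_map -cardE. Qed.

Lemma card_porbit_pred w (P : pred nat) :
  #|[set x | P #|porbit w x|]| = \sum_(l <- cycle_type w | P l) l.
Proof.
rewrite (perm_big _ (perm_cycle_type w)) big_map big_enum_cond /=.
rewrite -sum1_card (partition_big (porbit w) (mem (porbits w))) /=; last first.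
  by move=> x _; apply: imset_f.
rewrite [RHS]big_mkcondr /=; apply: eq_bigr => O /imsetP[x0 _ DO].
case: ifP => PO; last first.
  rewrite big_pred0 // => x; rewrite inE; apply/negbTE; apply: contraFN PO.
  by case/andP => Px /eqP <-.
rewrite -sum1_card; apply: eq_bigl => x; rewrite inE DO eq_porbit_mem.
rewrite andbC; case: (boolP (x \in porbit w x0)) => //= x0x.
by rewrite (card_porbit_mem x0x) -DO PO.
Qed.

Lemma sumn_cycle_type w : sumn (cycle_type w) = n.
Proof.
rewrite sumnE -(card_porbit_pred w xpredT) -[RHS]card_ord -cardsT.
by apply: eq_card => x; rewrite !inE.
Qed.

Lemma cycle_type_gt0 w : all (leq 1) (cycle_type w).
Proof.
rewrite (perm_all _ (perm_cycle_type w)); apply/allP => l /mapP[O].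
by rewrite mem_enum => /imsetP[x _ DO] ->; rewrite DO lt0n card_porbit_neq0.
Qed.

Lemma odd_perm_cycle_type w : odd_perm w = odd (n - size (cycle_type w)).
Proof.
rewrite /odd_perm size_cycle_type card_ord oddB // -size_cycle_type -{2}(sumn_cycle_type w).
have := cycle_type_gt0 w; elim: (cycle_type w) => //= x s IH /andP[x0 /IH].
by rewrite -addn1 addnC; apply: leq_add.
Qed.

Lemma count_cycle_type w k :
  k * count_mem k (cycle_type w) = #|[set x | #|porbit w x| == k]|.
Proof.
rewrite (card_porbit_pred w (fun l => l == k)) (eq_bigr (fun=> k)) => [|i /eqP //].
by rewrite big_const_seq iter_addn_0.
Qed.

Lemma perm_eq_count (s t : seq nat) : all (leq 1) s -> all (leq 1) t ->
  (forall k, k * count_mem k s = k * count_mem k t) -> perm_eq s t.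
Proof.
move=> s0 t0 E; apply/allP => k _ /=; case: k => [|k].
  rewrite !(count_memPn _) //; apply/negP; first by move/(allP t0).
  by move/(allP s0).
by rewrite -(eqn_pmul2l (ltn0Sn k)); apply/eqP.
Qed.

Lemma eq_cycle_type w v :
  (forall k, #|[set x | #|porbit w x| == k]| = #|[set x | #|porbit v x| == k]|) ->
  cycle_type w = cycle_type v.
Proof.
move=> E; apply: (sorted_eq geq_trans geq_anti); rewrite ?sorted_cycle_type //.
apply: perm_eq_count; rewrite ?cycle_type_gt0 // => k.
by rewrite !count_cycle_type.
Qed.

Lemma cycle_typeJ w h : cycle_type (w ^ h)%g = cycle_type w.
Proof.
apply: eq_cycle_type => k; rewrite -(card_imset (mem [set x | #|porbit w x| == k]) (@perm_inj _ h)).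
apply: eq_card => x; rewrite inE; apply/idP/imsetP => [xk|[y yk ->]].
  exists (h^-1%g x); last by rewrite permKV.
  by move: xk; rewrite inE -{1}(permKV h x) card_porbitJ.
by rewrite card_porbitJ; rewrite inE in yk.
Qed.

Lemma cycle_type_conj w v : cycle_type w = cycle_type v -> exists h, v = (w ^ h)%g.
Proof.
move=> E; apply: perm_conj_porbits => k.
have C (u : 'S_n) : #|[set O in porbits u | #|O| == k]| = count_mem k (cycle_type u).
  rewrite (seq.permP (perm_cycle_type u)) count_map -size_filter cardE; apply/perm_size.
  apply: uniq_perm => [||O]; first exact: enum_uniq.
    exact/filter_uniq/enum_uniq.
  by rewrite [LHS]mem_enum [RHS]mem_filter [in RHS]mem_enum inE andbC.
by rewrite !C E.
Qed.

Lemma cycle_typeX w j : coprime #[w]%g j -> cycle_type (w ^+ j)%g = cycle_type w.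
Proof.
move=> co; apply: eq_cycle_type => k; apply: eq_card => x; rewrite !inE card_porbitX.
have dw : #|porbit w x| %| #[w]%g by rewrite -expg_fix_dvdn expg_order perm1.
by rewrite (eqP (coprime_dvdl dw co)) divn1.
Qed.

Lemma digits_inj p (a b : nat -> nat) N :
  1 < p -> (forall k, a k <= 1) -> (forall k, b k <= 1) ->
  \sum_(k < N) p ^ k * a k = \sum_(k < N) p ^ k * b k -> forall k, k < N -> a k = b k.
Proof.
move=> p1; elim: N a b => // N IH a b a1 b1.
have red c : \sum_(k < N) p ^ (bump 0 k) * c (bump 0 k) = p * \sum_(k < N) p ^ k * c k.+1.
  by rewrite big_distrr /=; apply: eq_bigr => k _; rewrite mulnA -expnS.
rewrite !big_ord_recl /= !red expn0 !mul1n => E.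
have [E0 E1] : a 0 = b 0 /\ \sum_(k < N) p ^ k * a k.+1 = \sum_(k < N) p ^ k * b k.+1.
  have la0 : a 0 < p by exact: leq_ltn_trans (a1 0) p1.
  have lb0 : b 0 < p by exact: leq_ltn_trans (b1 0) p1.
  have ab0 : a 0 = b 0.
    by have := congr1 (modn^~ p) E; rewrite !(addnC _ (p * _)) ![p * _]mulnC !modnMDl !modn_small.
  split=> //; move/eqP: E; rewrite ab0 eqn_add2l eqn_pmul2l ?(ltnW p1) //.
  by move/eqP.
case=> [|k] // kN; apply: (IH (a \o S) (b \o S)) => // j; [exact: a1 | exact: b1].
Qed.

Lemma card_porbit_part w p m : prime p -> 0 < m -> ~~ (p %| m) ->
  #|[set x | #|porbit w x|`_p^' == m]| =
  m * \sum_(k < n.+1) p ^ k * count_mem (p ^ k * m) (cycle_type w).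
Proof.
move=> p_pr m0 pm; rewrite (card_porbit_pred w (fun l => l`_p^' == m)).
have len l : l \in cycle_type w -> 0 < l <= n.
  move=> lw; rewrite (allP (cycle_type_gt0 w)) //= -{1}(sumn_cycle_type w) sumnE.
  by rewrite (big_rem l) //= leq_addr.
have partE k : (p ^ k * m)`_p^' = m.
  have pk : (p ^ k)`_p^' = 1 by rewrite part_p'nat // pnatNK pnatX pnat_id.
  rewrite partnM // ?expn_gt0 ?prime_gt0 // pk.
  by rewrite mul1n part_pnat_id // p'natE.
rewrite big_mkcond big_distrr /=.
transitivity (\sum_(k < n.+1) \sum_(l <- cycle_type w) (l == p ^ k * m) * (m * p ^ k)); last first.
  apply: eq_bigr => k _; rewrite -big_distrl /= mulnC -mulnA; congr (_ * (_ * _)).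
  by rewrite -big_mkcond /= sum1_count; apply: eq_count => l; rewrite eq_sym.
rewrite exchange_big /=; apply: eq_big_seq => l /len/andP[l0 ln].
have Dl : l = p ^ logn p l * l`_p^' by rewrite -p_part partnC.
have lt : logn p l < n.+1 by rewrite ltnS (leq_trans _ ln) // ltnW // ltn_logl.
case: eqP => [lm|lm]; last first.
  rewrite big1 // => k _; case: eqP => [E|]; last by rewrite mul0n.
  by case: lm; rewrite E partE.
rewrite lm in Dl.
rewrite (bigD1 (Ordinal lt)) //= -Dl eqxx mul1n mulnC -Dl.
rewrite big1 ?addn0 // => k kl; rewrite {1}Dl eqn_pmul2r // eqn_exp2l ?prime_gt1 //.
by rewrite eq_sym (negbTE (kl : k != Ordinal lt :> nat)).
Qed.

(** Taking the p'-part cuts a cycle of length p^k m, with m prime to p, into p^k cycles of length m.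
    The multiplicity of m is then a sum of distinct powers p^k, and uniqueness of base p expansions
    with digits 0 and 1 recovers which lengths p^k m occur. *)
Lemma uniq_cycle_type_part w v p : prime p -> uniq (cycle_type w) -> uniq (cycle_type v) ->
  cycle_type (w.`_p^')%g = cycle_type (v.`_p^')%g -> cycle_type w = cycle_type v.
Proof.
move=> p_pr uw uv E; apply: (sorted_eq geq_trans geq_anti); rewrite ?sorted_cycle_type //.
apply: perm_eq_count; rewrite ?cycle_type_gt0 // => l; congr (_ * _).
have [->|l0] := posnP l.
  by rewrite !(count_memPn _) //; apply/negP => /(allP (cycle_type_gt0 _)).
have pm : ~~ (p %| l`_p^').
  by rewrite -p'natE // part_pnat.
have card_part (u : 'S_n) : #|[set x | #|porbit u x|`_p^' == l`_p^']| =
    l`_p^' * count_mem l`_p^' (cycle_type (u.`_p^')%g).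
  rewrite count_cycle_type; apply: eq_card => x.
  by rewrite !inE card_porbit_constt.
have := card_part w; rewrite E -card_part !card_porbit_part // => /eqP.
rewrite eqn_pmul2l // => /eqP D.
have [nl|ln] := ltnP n l.
  have no (u : 'S_n) : count_mem l (cycle_type u) = 0.
    apply/count_memPn; apply: contraL nl => lu.
    by rewrite -leqNgt -(sumn_cycle_type u) sumnE (big_rem l) //= leq_addr.
  by rewrite !no.
pose dig (u : 'S_n) k := count_mem (p ^ k * l`_p^') (cycle_type u).
have dig1 (u : 'S_n) : uniq (cycle_type u) -> forall k, dig u k <= 1.
  by move=> uu k; rewrite /dig count_uniq_mem ?leq_b1.
have := digits_inj (prime_gt1 p_pr) (dig1 _ uw) (dig1 _ uv) D (k := logn p l).
rewrite /dig -p_part partnC //; apply.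
by rewrite ltnS (leq_trans _ ln) // ltnW // ltn_logl.
Qed.

Lemma all_odd_constt w : all odd (cycle_type w) -> (w.`_2^')%g = w.
Proof.
move=> ow; rewrite -[RHS](consttC 2); suff -> : (w.`_2)%g = 1%g by rewrite mul1g.
apply/permP => x; rewrite perm1; apply/eqP; rewrite -[_.`_2]expg1 expg_fix_dvdn.
rewrite card_porbit_constt part_p'nat //.
have : #|porbit w x| \in cycle_type w.
  by rewrite (perm_mem (perm_cycle_type w)); apply/map_f; rewrite mem_enum imset_f.
by move/(allP ow); rewrite p'natE // dvdn2 negbK.
Qed.

Lemma cycle_type_part2 w :
  perm_eq (cycle_type (w.`_2^')%g) (flatten [seq nseq a`_2 a`_2^' | a <- cycle_type w]).
Proof.
apply: perm_eq_count; first exact: cycle_type_gt0.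
  apply/allP => _ /flattenP[_ /mapP[a _ ->]] /nseqP[-> _]; exact: part_gt0.
move=> k; rewrite count_cycle_type.
transitivity #|[set x | #|porbit w x|`_2^' == k]|.
  by apply: eq_card => x; rewrite !inE card_porbit_constt.
rewrite (card_porbit_pred w (fun l => l`_2^' == k)).
rewrite count_flatten -map_comp sumnE big_map big_distrr /= big_mkcond.
apply: eq_big_seq => a /(allP (cycle_type_gt0 w)) a0; rewrite count_nseq /=.
by case: eqP => [<-|]; rewrite ?mul0n ?muln0 // mul1n mulnC partnC.
Qed.

End CycleType.

(** * Conjugation in double covers *)

Lemma perm4_trans (T : finType) (s t : 4.-tuple T) :
  uniq s -> uniq t -> exists h : {perm T}, [seq h x | x <- s] = t.
Proof.
move=> us ut; have le4 : (4 <= #|T|)%N by rewrite -(size_tuple s) -(card_uniqP us) max_card.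
have tr := ntransitive_weak le4 (Sym_trans T).
have dt (u : 4.-tuple T) : uniq u -> u \in dtuple_on 4 [set: T].
  by move=> uu; rewrite inE uu; apply/subsetP => x; rewrite inE.
have [h _ /(congr1 val) /= E] := atransP2 tr (dt s us) (dt t ut).
by exists h; rewrite E.
Qed.

Section DoubleCoverConjugacy.
Variables (n : nat) (gT : finGroupType) (G : {group gT}).
Variables (z : gT) (t : nat -> gT) (pi : {morphism G >-> 'S_n}).
Hypotheses (n4 : (4 <= n)%N) (dc : double_cover z t pi).
Local Open Scope group_scope.

Lemma coverz_in : z \in G.
Proof. exact: (subsetP (center_sub G)) (cover_central dc). Qed.

Lemma coverz_cent x : x \in G -> commute z x.
Proof. by move=> xG; have [_ /centP/(_ x xG)] := setIP (cover_central dc). Qed.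

Lemma coverzJ x : x \in G -> z ^ x = z.
Proof. by move=> xG; apply/conjg_fixP/commgP/coverz_cent. Qed.

Lemma coverz2 : z ^+ 2 = 1.
Proof. by rewrite -(cover_order dc) expg_order. Qed.

Lemma coverz_neq1 : z != 1.
Proof. by rewrite -order_eq1 (cover_order dc). Qed.

Lemma cover_pi_z : pi z = 1.
Proof. by apply: mker; rewrite (cover_ker dc) cycle_id. Qed.

Lemma cover_pi_zM x : x \in G -> pi (z * x) = pi x.
Proof. by move=> xG; rewrite morphM ?coverz_in // cover_pi_z mul1g. Qed.

Lemma cover_lift w : exists2 g, g \in G & pi g = w.
Proof.
have /morphimP[g gG _ ->] : w \in pi @* G by rewrite (cover_im dc) inE.
by exists g.
Qed.

Lemma cover_cycle_z x : x \in <[z]> -> x = 1 \/ x = z.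
Proof.
by rewrite (cycle2g (cover_order dc)) !inE => /orP[/eqP|/eqP]; [left | right].
Qed.

Lemma cover_eq_pi g h : g \in G -> h \in G -> pi g = pi h -> g = h \/ g = z * h.
Proof.
move=> gG hG E.
have /cover_cycle_z[] : g * h^-1 \in <[z]>.
- rewrite -(cover_ker dc); apply/kerP; first by rewrite groupM ?groupV.
  by rewrite morphM ?groupV // morphV // E mulgV.
- by move/eqP; rewrite -eq_mulgV1 => /eqP; left.
- by move=> <-; right; rewrite mulgKV.
Qed.

(** As [z] is central, such a relation does not depend on the choice of lifts, so one choice
    suffices. *)
Lemma cover_conj_lift a b a' b' e : a \in G -> b \in G -> a' \in G -> b' \in G ->
  pi a = pi a' -> pi b = pi b' -> a' ^ b' = z ^+ e * a' -> a ^ b = z ^+ e * a.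
Proof.
move=> aG bG a'G b'G Ea Eb E.
have cz x : x \in G -> x ^ z = x.
  by move=> xG; apply/conjg_fixP/commgP/esym/coverz_cent.
have -> : a ^ b = a ^ b'.
  have [->//|->] := cover_eq_pi bG b'G Eb.
  by rewrite conjgM cz.
have [->//|->] := cover_eq_pi aG a'G Ea.
by rewrite conjMg coverzJ // E !mulgA -expgS -expgSr.
Qed.

(** By 4-fold transitivity, two disjoint transpositions are simultaneously conjugate to the images
    of [t 0] and [t 2], which anticommute by the defining relations. *)
Lemma cover_tperm_disjoint (i j k l : 'I_n) a b :
    uniq [:: i; j; k; l] -> a \in G -> b \in G ->
  pi a = tperm i j -> pi b = tperm k l -> a ^ b = z * a.
Proof.
move=> u aG bG Ea Eb.
have lt m : (m < 4)%N -> (m < n)%N by move=> m4; apply: leq_trans n4.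
pose o m (m4 : (m < 4)%N) : 'I_n := Ordinal (lt m m4).
pose p : 4.-tuple 'I_n := [tuple o 0%N isT; o 1%N isT; o 2%N isT; o 3%N isT].
have [h /= [h0 h1 h2 h3]] := perm4_trans (s := p) (t := [tuple i; j; k; l]) isT u.
have [H HG EH] := cover_lift h.
have lt1 m : (m < 3)%N -> (m.+1 < n)%N by move=> m3; apply: leq_trans n4.
have t0G : t 0%N \in G by apply: (cover_mem dc); apply: lt1.
have t2G : t 2 \in G by apply: (cover_mem dc); apply: lt1.
have [u0 _ [_ _ ac]] := cover_rel dc.
have t02 : t 0%N ^ t 2 = z * t 0%N.
  by rewrite conjgE ac ?lt1 // (coverz_cent t2G) -mulgA mulKg.
rewrite -[z]expg1; apply: (@cover_conj_lift _ _ (t 0%N ^ H) (t 2 ^ H)); rewrite ?groupJ //.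
- by rewrite morphJ // EH (cover_tperm dc (i := o 0%N isT) (j := o 1%N isT)) // tpermJ h0 h1.
- by rewrite morphJ // EH (cover_tperm dc (i := o 2 isT) (j := o 3 isT)) // tpermJ h2 h3.
rewrite -conjJg t02 conjMg expg1; by rewrite coverzJ.
Qed.

Lemma perm_tperm_support (T : finType) (p : {perm T}) : p != 1 ->
  exists i j, [/\ i != j, p i != i, p j != j &
     [set x | (p * tperm i j) x != x] \proper [set x | p x != x]].
Proof.
move=> p1; have [i pi_i] : exists i, p i != i.
  apply/existsP; apply: contraR p1; rewrite negb_exists => /forallP fx.
  by apply/eqP/permP => x; rewrite perm1; apply/eqP; rewrite -[_ == _]negbK.
exists i, (p i); split=> //; first by rewrite eq_sym.
  by rewrite (inj_eq perm_inj).
apply/properP; split; last first.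
  by exists i; rewrite inE // permM tpermR eqxx.
apply/subsetP => x; rewrite !inE; apply: contraNneq => px.
rewrite permM px; apply/eqP/tpermD; first by apply: contraNneq pi_i => ->; rewrite px.
by apply: contraNneq pi_i => E; rewrite -(inj_eq (@perm_inj _ p)) E px.
Qed.

(** Induction on the support of [pi a]: multiplying by a transposition of two moved points shrinks
    the support, and each such factor anticommutes with [b]. *)
Lemma cover_tperm_comm (k l : 'I_n) a b : k != l -> a \in G -> b \in G ->
    pi a k = k -> pi a l = l -> pi b = tperm k l ->
  a ^ b = z ^+ odd_perm (pi a) * a.
Proof.
move=> kl aG bG ak al Eb.
have [m] := ubnP #|[set x | pi a x != x]|; elim: m a aG ak al => // m IH a aG ak al lem.
have [pa1|pa1] := eqVneq (pi a) 1.
  apply: (@cover_conj_lift a b 1 b) => //; rewrite ?morph1 // pa1 odd_perm1.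
  by rewrite conj1g mulg1.
have [i [j [ij pii pjj /proper_card lt]]] := perm_tperm_support pa1.
have [c cG Ec] := cover_lift (tperm i j).
have Eac : pi (a * c) = pi a * tperm i j by rewrite morphM // Ec.
have [ki kj li lj] : [/\ i != k, j != k, i != l & j != l].
  by split; [apply: contraNneq pii | apply: contraNneq pjj | apply: contraNneq pii
    | apply: contraNneq pjj] => ->; apply/eqP.
have act x : pi a x = x -> i != x -> j != x -> pi (a * c) x = x.
  by move=> ax ix jx; rewrite Eac permM ax tpermD.
have := IH (a * c); rewrite groupM // => /(_ isT (act k ak ki kj) (act l al li lj)).
rewrite Eac => /(_ (leq_trans lt lem)) /=; rewrite odd_permM odd_tperm ij addbT.
rewrite conjMg (@cover_tperm_disjoint i j k l c b) //; last first.
  by rewrite /= !inE !negb_or ij ki kj li lj kl.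
move=> E; apply: (mulIg (z * c)); rewrite {}E !mulgA -[_ * a * z]mulgA -(coverz_cent aG) !mulgA.
by case: (odd_perm _); rewrite /= ?expg1 ?expg0 ?mul1g // -expg2 coverz2 mul1g.
Qed.

(** The same descent on the support of [pi b]. Lifts of permutations with disjoint supports commute
    with the sign rule of a superalgebra, [z] playing the role of -1. *)
Lemma cover_supercomm a b : a \in G -> b \in G ->
    (forall x, pi a x = x \/ pi b x = x) ->
  a ^ b = z ^+ (odd_perm (pi a) && odd_perm (pi b)) * a.
Proof.
move=> aG bG; have [m] := ubnP #|[set x | pi b x != x]|; elim: m b bG => // m IH b bG lem dis.
have [pb1|pb1] := eqVneq (pi b) 1.
  by apply: (@cover_conj_lift a b a 1) => //; rewrite ?morph1 // pb1 odd_perm1 andbF conjg1 mul1g.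
have [i [j [ij pii pjj /proper_card lt]]] := perm_tperm_support pb1.
have [c cG Ec] := cover_lift (tperm i j).
have Ebc : pi (b * c) = pi b * tperm i j by rewrite morphM // Ec.
have [ai aj] : pi a i = i /\ pi a j = j.
  by split; [case: (dis i) pii | case: (dis j) pjj] => // ->; rewrite eqxx.
have := IH (b * c); rewrite groupM // Ebc => /(_ isT (leq_trans lt lem)) E.
have {E} : a ^ (b * c) = z ^+ (odd_perm (pi a) && ~~ odd_perm (pi b)) * a.
  rewrite E ?odd_permM ?odd_tperm ?ij ?addbT // => x.
  have [ax|ax] := eqVneq (pi a x) x; first by left.
  right; rewrite permM; have [/eqP|->] := dis x; first by rewrite (negbTE ax).
  by rewrite tpermD //; apply: contraNneq ax => <-; apply/eqP.
have ac := cover_tperm_comm ij aG cG ai aj Ec.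
rewrite conjgM => E; apply: (conjg_inj c); rewrite E conjMg ac.
rewrite conjXg coverzJ // mulgA -expgD; congr (_ * _).
by case: (odd_perm _); case: (odd_perm _); rewrite //= coverz2.
Qed.

(* Both alternatives force the values of spin characters to cancel. *)
Lemma cover_repeated_part x : x \in G -> ~~ uniq (cycle_type (pi x)) ->
  exists2 g, g \in G & (~~ odd_perm (pi g) /\ x ^ g = z * x) \/
    (odd_perm (pi g) /\ x ^ g = z ^+ odd_perm (pi x) * x).
Proof.
move=> xG nu; set w := pi x.
have [a [b [ab eqk]]] : exists a b, b \notin porbit w a /\ #|porbit w a| = #|porbit w b|.
  have /(uniqPn 0%N)[i [j [ij jlt E]]] : ~~ uniq [seq #|X| | X : {set 'I_n} <- enum (porbits w)].
    by rewrite -(perm_uniq (perm_cycle_type w)).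
  rewrite size_map in jlt; have ilt := ltn_trans ij jlt.
  rewrite !(nth_map set0) // in E.
  have mem m : (m < size (enum (porbits w)))%N -> nth set0 (enum (porbits w)) m \in porbits w.
    by move=> lt; rewrite -mem_enum mem_nth.
  have [/imsetP[a _ Ea] /imsetP[b _ Eb]] := (mem i ilt, mem j jlt).
  exists a, b; split; last by rewrite -Ea -Eb.
  by rewrite -eq_porbit_mem -Ea -Eb nth_uniq ?enum_uniq // eq_sym (ltn_eqF ij).
have [s [s2 ws on_s c12 os]] := porbit_swap ab eqk.
set O1 := porbit w a in eqk on_s c12 os; set O2 := porbit w b in eqk on_s c12.
have [g gG Eg] := cover_lift s.
have [C CG EC] := cover_lift (restr_perm O1 w).
exists g => //; rewrite Eg os.
have dO y : y \in O1 -> y \in O2 -> False.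
  rewrite /O1 /O2 -!eq_porbit_mem => /eqP ya /eqP yb; case/negP: ab.
  by rewrite -eq_porbit_mem -ya yb.
have CgG : C ^ g \in G by rewrite groupJ.
have ECg : pi (C ^ g) = restr_perm O2 w by rewrite morphJ // EC Eg.
have gg : (C ^ g) ^ g = C.
  rewrite -conjgM -expg2; have /cover_cycle_z[->|->] : g ^+ 2 \in <[z]>.
  - rewrite -(cover_ker dc); apply/kerP; rewrite ?groupX //.
    by rewrite morphX // Eg.
  - by rewrite conjg1.
  - by apply/conjg_fixP/commgP/esym/coverz_cent.
(* Thus [x] is [C * C ^ g * V], where [C] lifts one of the two equal cycles, [C ^ g] lifts the
   other, and [V] fixes both orbits pointwise. Conjugation by [g] swaps the first two factors. *)
pose V := (C * C ^ g)^-1 * x.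
have UG : C * C ^ g \in G by exact: groupM.
have VG : V \in G by rewrite groupM ?groupV.
have piV : pi V = (restr_perm O1 w * restr_perm O2 w)^-1 * w.
  by rewrite /V morphM ?groupV // morphV // morphM // EC ECg.
have EV y : y \in O1 \/ y \in O2 -> pi V y = y.
  have wO u y0 : (w u \in porbit w y0) = (u \in porbit w y0).
    by rewrite -!eq_porbit_mem; have := porbit_perm w 1 u; rewrite expg1 => ->.
  rewrite piV permM.
  have [u ->] : exists u, y = w u by exists (w^-1 y); rewrite permKV.
  rewrite /O1 /O2 !wO => uO.
  congr (w _); apply: (canLR (permK _)); rewrite permM !restr_porbitE.
  case: uO => uO; first by rewrite uO wO; case: ifP => // /(dO u uO).
  have /negbTE-> : u \notin porbit w a by apply/negP => /dO/(_ uO).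
  by rewrite uO.
have Vg : V ^ g = z ^+ (odd_perm w && odd #|O1|) * V.
  have -> : odd_perm w = odd_perm (pi V).
    by rewrite piV -c12 odd_permM odd_permV odd_permM odd_permJ addbb.
  rewrite -os -Eg; apply: cover_supercomm => // y.
  have [yO|yO] := boolP (y \in O1 :|: O2).
    by left; apply: EV; apply/setUP.
  by right; rewrite Eg (out_perm on_s).
have oC : odd_perm (pi C) = ~~ odd #|O1| by rewrite EC odd_restr_porbit.
have CC : C ^ g * C = z ^+ (~~ odd #|O1|) * (C * C ^ g).
  have := @cover_supercomm C (C ^ g) CG CgG; rewrite morphJ // odd_permJ andbb oC => E.
  have {E} : C ^ (C ^ g) = z ^+ (~~ odd #|O1|) * C.
    apply: E => y; rewrite -morphJ // ECg EC !restr_porbitE.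
    have [y1|_] := boolP (y \in O1); last by left.
    by right; case: ifP => // /(dO y y1).
  move=> E; have := conjgC C (C ^ g); rewrite {}E => ->; case: (odd _) => /=; rewrite ?expg0 ?expg1 ?mul1g //.
  move: (C ^ g) CgG => D DG; by rewrite !mulgA (coverz_cent DG) -[_ * z * z]mulgA -expg2 coverz2 mulg1.
have xE : x = C * C ^ g * V by rewrite /V mulKVg.
clearbody V.
(* The first power of [z] restores the order of [C] and [C ^ g], which anticommute when the cycles
   have even length; the second comes from moving [g] past [V]. For even length [g] is even and only
   the first survives; for odd length [g] is odd and only the second does. *)
have xg : x ^ g = z ^+ (~~ odd #|O1|) * z ^+ (odd_perm w && odd #|O1|) * x.
  have Ug : (C * C ^ g) ^ g = z ^+ (~~ odd #|O1|) * (C * C ^ g) by rewrite conjMg gg.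
  rewrite [in LHS]xE [in RHS]xE conjMg Ug Vg; move: (C * C ^ g) UG => U UG.
  rewrite -!mulgA; congr (_ * _); rewrite !mulgA; congr (_ * _).
  by apply: commuteX; apply/commute_sym/coverz_cent.
move: xg; case: (odd #|O1|) => /=; rewrite ?andbT ?andbF ?expg0 ?mul1g ?mulg1 => ->.
  by right; split.
by left; split.
Qed.

(** A cycle of even length is odd, and so is the complementary permutation since [pi x] is even.
    Their lifts anticommute, and conjugating by the lift of the cycle gives [z * x]. *)
Lemma cover_even_part x : x \in G -> ~~ odd_perm (pi x) -> ~~ all odd (cycle_type (pi x)) ->
  exists2 g, g \in G & odd_perm (pi g) /\ x ^ g = z * x.
Proof.
move=> xG ev; set w := pi x in ev *; case/allPn => k kw even_k.
have [a Ek] : exists a, k = #|porbit w a|.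
  move: kw; rewrite (perm_mem (perm_cycle_type w)) => /mapP[O].
  by rewrite mem_enum => /imsetP[a _ ->] ->; exists a.
set O := porbit w a in Ek.
have [C CG EC] := cover_lift (restr_perm O w).
have oC : odd_perm (pi C) by rewrite EC odd_restr_porbit -Ek.
exists C => //; split=> //.
pose V := C^-1 * x; have VG : V \in G by rewrite groupM ?groupV.
have piV : pi V = (restr_perm O w)^-1 * w by rewrite morphM ?groupV // morphV // EC.
have xE : x = C * V by rewrite mulKVg.
have -> : z * x = C * (z * V) by rewrite {1}xE !mulgA (coverz_cent CG).
rewrite {1}xE conjMg {1}/conjg mulKg; congr (_ * _).
rewrite (cover_supercomm VG CG) ?oC ?andbT.
  by rewrite piV odd_permM odd_permV -EC oC addTb ev.
move=> y; have [yO|yO] := boolP (y \in O); last first.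
  by right; rewrite EC restr_porbitE (negbTE yO).
left; rewrite piV permM.
have wO u : (w u \in O) = (u \in O).
  by rewrite /O -!eq_porbit_mem; have := porbit_perm w 1 u; rewrite expg1 => ->.
have [u Du] : exists u, y = w u by exists (w^-1 y); rewrite permKV.
rewrite Du in yO *; rewrite wO in yO.
by congr (w _); apply: (canLR (permK _)); rewrite restr_porbitE yO.
Qed.

Lemma card_cover : #|G| = (2 * n`!)%N.
Proof.
have -> : #|G| = #|pi @*^-1 [set: 'S_n]|.
  by apply: eq_card => x; rewrite !inE andbT.
rewrite card_morphpre ?(cover_im dc) // (cover_ker dc) -orderE (cover_order dc).
by rewrite cardsT card_Sn.
Qed.

Lemma mem_alt_cover x : (x \in alt_cover pi) = (x \in G) && ~~ odd_perm (pi x).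
Proof. by rewrite /alt_cover /= inE [X in _ && X]inE Alt_even. Qed.

Lemma alt_cover_sub : alt_cover pi \subset G.
Proof. exact: subsetIl. Qed.

Lemma card_alt_cover : #|alt_cover pi| = n`!.
Proof.
rewrite card_morphpre ?(cover_im dc) ?subsetT // (cover_ker dc) -orderE (cover_order dc).
by rewrite card_Alt card_ord // (leq_trans _ n4).
Qed.

Lemma alt_cover_normal : alt_cover pi <| G.
Proof.
rewrite /normal alt_cover_sub; apply/subsetP => x xG; rewrite inE; apply/subsetP => y.
case/imsetP => a; rewrite !mem_alt_cover => /andP[aG ea] ->.
by rewrite groupJ // morphJ // odd_permJ.
Qed.

End DoubleCoverConjugacy.

(** * Integrality of sums over p-sections *)

Lemma Aint_conj (x : algC) : (x^* \in Aint) = (x \in Aint).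
Proof. exact: (Aint_aut Num.conj). Qed.

Section SectionFunction.
Variables (gT : finGroupType) (H : {group gT}) (p : nat) (y : gT).
Hypotheses (p_pr : prime p) (yH : y \in H) (p'y : (p^'.-elt y)%g).
Local Open Scope group_scope.

Let C := 'C_H[y]%G.
Variable P : {group gT}.
Hypothesis sylP : p.-Sylow(C) P.
Let E := (<[y]> <*> P)%G.

Let sPC : P \subset C. Proof. exact: pHall_sub sylP. Qed.
Let pP : p.-group P. Proof. exact: pHall_pgroup sylP. Qed.
Let cPy u : u \in P -> commute u y.
Proof. by move/(subsetP sPC); rewrite inE => /andP[_ /cent1P]. Qed.
Let sPH : P \subset H. Proof. exact: subset_trans sPC (subsetIl _ _). Qed.
Let sEH : E \subset H. Proof. by rewrite join_subG sPH cycle_subG yH. Qed.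
Let nPE : P <| E.
Proof.
rewrite /normal joing_subr join_subG normG andbT cycle_subG.
apply: (subsetP (cent_sub P)); apply/centP => u uP; exact/commute_sym/cPy.
Qed.
Let yE : y \in E. Proof. by rewrite mem_gen // inE cycle_id. Qed.
Let nPy : y \in 'N(P). Proof. exact: (subsetP (normal_norm nPE)). Qed.

(* The multiple by #|E / P| of the indicator function of the coset P y, which the
   second orthogonality relation expands with algebraic integer coefficients. *)
Definition coset_class_fun : 'CF(E) :=
  \sum_j (('chi[E / P]_j (coset P y))^*)%R *: ('chi[E / P]_j %% P)%CF.

Let abEP : abelian (E / P).
Proof.
have -> : E / P = <[y]> / P.
  by rewrite /= joingC quotientYidl // cycle_subG.
by rewrite quotient_abelian ?cycle_abelian.
Qed.

Lemma coset_class_funE g : g \in E ->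
  coset_class_fun g = (#|(E / P)%g|%:R *+ (coset P g == coset P y))%R.
Proof.
move=> gE; rewrite sum_cfunE.
have gEP : coset P g \in E / P by rewrite mem_quotient.
have yEP : coset P y \in E / P by rewrite mem_quotient.
transitivity (\sum_j 'chi[E / P]_j (coset P g) * ('chi_j (coset P y))^*)%R.
  by apply: eq_bigr => j _; rewrite cfunE cfModE // mulrC.
rewrite second_orthogonality_relation //.
have -> : 'C_(E / P)[coset P g] = E / P.
  by apply/setIidPl; rewrite sub_cent1 (subsetP abEP).
congr (_ *+ nat_of_bool _)%R; apply/imsetP/eqP => [[x xE ->]|->].
  by apply/conjg_fixP/commgP/(centsP abEP).
by exists 1; rewrite ?group1 ?conjg1.
Qed.

(** Induction from the p-elementary group generated by [y] and [P], as in Brauer's induction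
    theorem. On [H] the values are natural numbers, 0 off the p-section of [y] and prime to [p] on
    it. *)
Definition section_fun : 'CF(H) := ('Ind[H] coset_class_fun)%R.

Let count g := #|[set x in H | g ^ x \in P :* y]|.

Lemma section_funE g : (section_fun g * #|P|%:R = (count g)%:R)%R.
Proof.
rewrite cfIndE //.
have eqy x : x \in E -> (coset P x == coset P y) = (x \in P :* y).
  move=> xE; have nx := subsetP (normal_norm nPE) x xE.
  by rewrite -(sameP eqP (rcoset_kercosetP nx nPy)).
have sPyE : P :* y \subset E.
  by apply/subsetP => x /rcosetP[u uP ->]; rewrite groupM // mem_gen // inE uP orbT.
rewrite (eq_bigr (fun x => #|(E / P)%g|%:R *+ ((g ^ x)%g \in (P :* y)%g))%R) => [|x xH]; last first.
  have [gx|gx] := boolP (g ^ x \in E); first by rewrite coset_class_funE // eqy.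
  rewrite cfun0 //; have [/(subsetP sPyE)|//] := boolP (g ^ x \in P :* y).
  by rewrite (negbTE gx).
rewrite sumrMnr.
have -> : (\sum_(x in H) ((g ^ x)%g \in (P :* y)%g : nat) = count g)%N.
  rewrite /count -sum1_card big_mkcond /= [RHS]big_mkcond /=; apply: eq_bigr => x _.
  by rewrite inE; case: (x \in H) => //=; case: (_ \in _).
have sPE : P \subset E by exact: normal_sub nPE.
have := Lagrange sPE; rewrite -card_quotient ?normal_norm // => cE.
rewrite -[(_ *+ count g)%R]mulr_natr -mulrA [X in (_ * X)%R]mulrAC -natrM [(_ * #|P|)%N]mulnC cE.
by rewrite mulKf // pnatr_eq0 -lt0n cardG_gt0.
Qed.

Lemma section_fun_out g : g.`_p^' \notin y ^: H -> section_fun g = 0%R.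
Proof.
move=> gy; have : (section_fun g * #|P|%:R = 0)%R.
  rewrite section_funE /count (_ : [set x in H | g ^ x \in P :* y] = set0) ?cards0 //.
  apply/setP => x; rewrite !inE; apply/negP => /andP[xH /rcosetP[u uP gu]].
  case/negP: gy; apply/imsetP; exists x^-1; rewrite ?groupV //.
  apply: (canRL (conjgK x)); rewrite -consttJ gu consttM; last exact: cPy.
  have -> : u.`_p^' = 1 by apply/constt1P; rewrite p_eltNK (mem_p_elt pP).
  by rewrite mul1g constt_p_elt.
by move/eqP; rewrite mulf_eq0 pnatr_eq0 -[_ == 0%N]negbK -lt0n cardG_gt0 orbF => /eqP.
Qed.

(* The p-part u of g acts by translation on the cosets of P in C; the value m counts
   its fixed points, so m is congruent to #|C : P| modulo p. *)
Lemma section_fun_in g : g \in H -> g.`_p^' \in y ^: H ->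
  exists2 m, section_fun g = m%:R%R & coprime m p.
Proof.
move=> gH /imsetP[x0 x0H gy].
rewrite -(cfunJ section_fun g (groupVr x0H)).
have {gy} : (g ^ x0^-1).`_p^' = y by rewrite consttJ gy conjgK.
have {gH} : g ^ x0^-1 \in H by rewrite groupJ ?groupV.
move: (g ^ x0^-1) => {}g gH gy; set u := g.`_p.
have gE : g = u * y by rewrite -gy consttC.
have uC : u \in C.
  by rewrite inE groupX //= -gy; apply/cent1P/commute_sym/commuteX2.
have pu : p.-group <[u]> by exact: p_elt_constt.
pose A := [set x in C | P :* (x * u) == P :* x].
have AE : [set x in H | g ^ x \in P :* y] = A^-1.
  apply/setP => x; rewrite [LHS]inE mem_invg [RHS]inE groupV [x \in C]inE.
  have [xH|//] /= := boolP (x \in H).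
  have P1 : (P :* (x^-1 * u) == P :* x^-1) = (u ^ x \in P).
    by rewrite (sameP eqP rcoset_eqP) mem_rcoset invgK -mulgA.
  apply/idP/andP => [gx | [/cent1P xy]]; rewrite P1; last first.
    have {}xy : y ^ x = y by apply/conjg_fixP/commgP/commute_sym.
    by move=> ux; rewrite gE conjMg xy mem_rcoset mulgK.
  (* Comparing p'-parts shows that an [x] carrying [g] into [P :* y] centralizes [y]. *)
  have xy : y ^ x = y.
    have /rcosetP[v vP gv] := gx; have := congr1 (fun h => h.`_p^') gv.
    rewrite consttJ gy consttM; last exact: cPy.
    have -> : v.`_p^' = 1 by apply/constt1P; rewrite p_eltNK (mem_p_elt pP).
    by rewrite mul1g constt_p_elt.
  split; first by apply/cent1P/commute_sym/commgP/conjg_fixP.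
  by move: gx; rewrite gE conjMg xy mem_rcoset mulgK.
have cA : #|A| = (#|'Fix_(rcosets P C | 'Rs)(<[u]>)| * #|P|)%N.
  rewrite -sum1_card (partition_big (rcoset P) (mem 'Fix_(rcosets P C | 'Rs)(<[u]>))) /=; last first.
    move=> x; rewrite inE => /andP[xC /eqP xu]; rewrite inE; apply/andP; split.
      by rewrite rcosetE; apply/rcosetsP; exists x.
    by rewrite afix_cycle; apply/afix1P; rewrite /= !rcosetE -rcosetM xu.
  rewrite -sum_nat_const; apply: eq_bigr => X; rewrite inE => /andP[/rcosetsP[x1 x1C ->]].
  rewrite afix_cycle => /afix1P; rewrite /= !rcosetE -rcosetM => fx.
  rewrite -(card_rcoset P x1) -sum1_card; apply: eq_bigl => x.
  rewrite rcosetE (sameP eqP rcoset_eqP) andbC; have [|//] := boolP (x \in P :* x1).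
  case/rcosetP => v vP ->; rewrite /= inE groupM ?(subsetP sPC v vP) //=.
  by rewrite -mulgA !(rcosetM _ v) !(rcoset_id vP) fx eqxx.
exists #|'Fix_(rcosets P C | 'Rs)(<[u]>)|.
  have P0 : (#|P|%:R != 0 :> algC)%R by rewrite pnatr_eq0 -lt0n cardG_gt0.
  by apply: (mulIf P0); rewrite section_funE /count AE card_invg cA natrM.
have /(pgroup_fix_mod pu) E1 : [acts <[u]>, on rcosets P C | 'Rs].
  by apply: subset_trans (actsRs_rcosets P C); rewrite cycle_subG.
rewrite coprime_sym prime_coprime // /dvdn -E1 -/(dvdn _ _) -p'natE //.
by case/and3P: sylP.
Qed.

End SectionFunction.

Section Pullback.
Variables (aT rT : finGroupType) (K : {group aT}) (H : {group rT}) (pi : aT -> rT).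
Hypothesis piH : forall g, g \in K -> pi g \in H.
Hypothesis pull_char : forall chi : 'CF(H), chi \is a character ->
  exists2 psi : 'CF(K), psi \is a character & {in K, forall g, psi g = chi (pi g)}.
Local Open Scope group_scope.

(** The set [A] lies in the target of [pi]: in the application, classes and sections are those of
    S_n even when [K] covers only the alternating group. *)
Definition dot_on (A : {pred rT}) (phi psi : 'CF(K)) : algC :=
  (#|K|%:R^-1 * \sum_(g in K | pi g \in A) phi g * (psi g)^*)%R.

(** Multiplying [phi] by a pulled-back character leaves it a virtual character. Expanding the power
    of [F] thus yields inner products of virtual characters with algebraic integer coefficients. *)
Lemma Aint_section_pow (F : 'CF(H)) (I : finType) (a : I -> algC) (chi : I -> 'CF(H)) e
    (phi psi : 'CF(K)) :
    (forall i, a i \in Aint) -> (forall i, chi i \is a character) ->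
    F = (\sum_i a i *: chi i)%R -> phi \in 'Z[irr K] -> psi \in 'Z[irr K] ->
  (#|K|%:R^-1 * \sum_(g in K) phi g * (F (pi g) ^+ e)%R * (psi g)^*)%R \in Aint.
Proof.
move=> aA chiC ->; elim: e phi => [|e IH] phi phiZ psiZ.
  rewrite (eq_bigr (fun g => phi g * (psi g)^*)%R) => [|g _]; last by rewrite expr0 mulr1.
  by rewrite -cfdotE Aint_Cint // Cint_cfdot_vchar.
have /fin_all_exists2[theta thC thE] i := pull_char (chiC i).
rewrite (_ : _ * _ = \sum_i a i * (#|K|%:R^-1 *
   \sum_(g in K) (phi * theta i) g * ((\sum_i0 a i0 *: chi i0) (pi g) ^+ e) * (psi g)^*))%R.
  apply: rpred_sum => i _; apply: rpredM => //; apply: IH => //.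
  by rewrite rpredM // char_vchar.
under [RHS]eq_bigr do rewrite mulrCA.
rewrite -mulr_sumr; congr (_ * _)%R.
under [RHS]eq_bigr do rewrite mulr_sumr.
rewrite exchange_big /=; apply: eq_bigr => g gK.
rewrite exprS {1}sum_cfunE mulr_suml mulr_sumr mulr_suml; apply: eq_bigr => i _.
by move: (_ ^+ e)%R => X; rewrite !cfunE thE // -!mulrA mulrCA.
Qed.

(* A high power of the induced class function is congruent, modulo p times the p-part
   of #|K|, to the indicator function of the section. *)
Lemma Aint_dot_on_section p y phi psi : prime p -> y \in H -> p^'.-elt y ->
    phi \in 'Z[irr K] -> psi \in 'Z[irr K] ->
  ((#|K|`_p^')%N%:R * dot_on [pred h | h.`_p^' \in y ^: H] phi psi)%R \in Aint.
Proof.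
move=> p_pr yH p'y phiZ psiZ.
have [P sylP] := Sylow_exists p 'C_H[y].
set F := section_fun H y P.
have FE : exists (I : finType) (a : I -> algC) (chi : I -> 'CF(H)),
    [/\ forall i, a i \in Aint, forall i, chi i \is a character
       & F = (\sum_i a i *: chi i)%R].
  pose E := (<[y]> <*> P)%G.
  exists (Iirr (E / P)), (fun j => ('chi[E / P]_j (coset P y))^*)%R,
    (fun j => 'Ind[H] ('chi[E / P]_j %% P)%CF)%R; split.
  - by move=> j; rewrite Aint_conj Aint_irr.
  - by move=> j; rewrite cfInd_char // cfMod_char // irr_char.
  - by rewrite /F /section_fun /coset_class_fun linear_sum; apply: eq_bigr => j _; rewrite linearZ.
have [I [a [chi [aA chiC FE']]]] := FE.
(* Euler's theorem makes values prime to [p] congruent to 1 modulo p^(k + 1). Division by the p-part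
   p^k of [#|K|] then leaves an error of [p] times an algebraic integer. *)
pose k := logn p #|K|; pose e := totient (p ^ k.+1).
have e0 : (0 < e)%N by rewrite totient_gt0 expn_gt0 prime_gt0.
have int := Aint_section_pow e aA chiC FE' phiZ psiZ.
have /fin_all_exists [c cE] g : exists c : nat, g \in K ->
    (F (pi g) ^+ e = (if (pi g).`_p^' \in y ^: H then 1 + (p ^ k.+1 * c)%:R else 0) :> algC)%R.
  have [gK|_] := boolP (g \in K); last by exists 0%N.
  have [s|s] := boolP ((pi g).`_p^' \in y ^: H); last by exists 0%N => _; rewrite (section_fun_out yH p'y sylP) // expr0n gtn_eqF.
  have [m -> co] := section_fun_in p_pr yH p'y sylP (piH gK) s.
  exists (m ^ e %/ p ^ k.+1)%N => _; rewrite -natrX -(natrD _ 1%N) addnC; congr (_%:R)%R.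
  have := Euler_exp_totient (coprimeXr k.+1 co); rewrite -/e => E1.
  rewrite {1}(divn_eq (m ^ e) (p ^ k.+1)) E1 modn_small 1?mulnC //.
  by rewrite -(exp1n k.+1) ltn_exp2r // prime_gt1.
pose S := (\sum_(g in K | (pi g).`_p^' \in y ^: H) (c g)%:R * (phi g * (psi g)^*))%R.
have SA : S \in Aint.
  apply: rpred_sum => g _; rewrite !rpredM ?Aint_conj ?(Aint_vchar _ phiZ) ?(Aint_vchar _ psiZ) //.
  by rewrite rpred_nat.
have pK : (#|K|%:R = (p ^ k)%:R * (#|K|`_p^')%N%:R :> algC)%R.
  by rewrite -natrM -p_part partnC.
have K0 : (#|K|%:R != 0 :> algC)%R by rewrite pnatr_eq0 -lt0n cardG_gt0.
set D := dot_on _ _ _.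
have -> : ((#|K|`_p^')%N%:R * D =
   (#|K|`_p^')%N%:R * (#|K|%:R^-1 * \sum_(g in K) phi g * F (pi g) ^+ e * (psi g)^*) - p%:R * S)%R.
  rewrite (_ : \sum_(g in K) _ = \sum_(g in K | (pi g).`_p^' \in y ^: H) phi g * (psi g)^* + (p ^ k.+1)%:R * S)%R.
    have m0 : ((#|K|`_p^')%N%:R != 0 :> algC)%R by rewrite pnatr_eq0 -lt0n part_gt0.
    have pk0 : ((p ^ k)%:R != 0 :> algC)%R by rewrite pnatr_eq0 -lt0n expn_gt0 prime_gt0.
    rewrite /D /dot_on pK expnS natrM /=; set X := (\sum_(_ in _ | _) _)%R; field.
    by rewrite m0 pk0.
  rewrite mulr_sumr -big_split /= [RHS]big_mkcondr /=; apply: eq_bigr => g gK.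
  by rewrite cE //; case: ifP => _; rewrite ?mulr0 ?mul0r // natrM; ring.
by apply: rpredB; apply: rpredM => //; apply: rpred_nat.
Qed.

Lemma cfInd1E (w g : rT) : w \in H ->
  (('Ind[H] (1 : 'CF(<[w]>))) g * #[w]%:R = #|[set x in H | (g ^ x)%g \in <[w]>%g]|%:R)%R.
Proof.
move=> wH; rewrite cfIndE ?cycle_subG // mulrAC mulVf ?mul1r; last first.
  by rewrite pnatr_eq0 -lt0n order_gt0.
rewrite (eq_bigr (fun x => ((g ^ x)%g \in <[w]>%g)%:R)%R) => [|x _]; last by rewrite cfun1E.
rewrite -natr_sum; congr (_%:R)%R; rewrite -sum1_card big_mkcond [RHS]big_mkcond /=.
by apply: eq_bigr => x _; rewrite inE; case: (x \in H) => //=; case: (_ \in _).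
Qed.

(* Artin's argument: permutation characters induced from cyclic groups separate
   rational classes by a triangular system. *)
Lemma Crat_dot_on_class w phi psi : w \in H ->
    (forall x, x \in H -> forall y, y \in <[x]> -> #[y] = #[x] -> y \in x ^: H) ->
    phi \in 'Z[irr K] -> psi \in 'Z[irr K] ->
  dot_on (w ^: H) phi psi \in Crat.
Proof.
move=> wH gen phiZ psiZ; have [m] := ubnP #[w]; elim: m w wH => // m IH w wH lt_w.
pose F := 'Ind[H] (1 : 'CF(<[w]>)).
have [Fp FpC FpE] := pull_char (cfInd_char H (cfun1_char <[w]>)).
have int : ('[phi * Fp, psi])%R \in Crat.
  by rewrite rpred_int_num // Cint_cfdot_vchar ?rpredM // char_vchar.
have FN g : (F g = (#|[set x in H | (g ^ x)%g \in <[w]>%g]|%:R / #[w]%:R))%R.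
  by rewrite -cfInd1E // mulfK // pnatr_eq0 -lt0n order_gt0.
have FQ g : F g \in Crat by rewrite FN rpred_div ?rpred_nat.
have Fw0 : (F w != 0)%R.
  rewrite FN mulf_eq0 invr_eq0 !pnatr_eq0 negb_or -!lt0n order_gt0 andbT.
  by apply/card_gt0P; exists 1; rewrite inE group1 conjg1 cycle_id.
pose cl := classes H.
have E : ('[phi * Fp, psi] = \sum_(X in cl) F (repr X) * dot_on X phi psi)%R.
  rewrite cfdotE (partition_big (fun g => pi g ^: H) (mem cl)) /=; last first.
    by move=> g gK; apply: mem_classes; apply: piH.
  rewrite mulr_sumr; apply: eq_bigr => X /imsetP[x xH ->].
  rewrite /dot_on mulrCA; congr (_ * _)%R; rewrite mulr_sumr.
  apply: eq_big => [g|g /andP[gK /eqP gx]].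
    have [gK|//] /= := boolP (g \in K); apply/eqP/idP => [<-|/class_eqP//]; exact: class_refl.
  rewrite cfunE FpE // -mulrA mulrCA -/F; congr (_ * _)%R.
  by rewrite -gx; have /imsetP[y yH ->] := mem_repr _ (class_refl H (pi g)); rewrite cfunJ.
have wcl : w ^: H \in cl by apply: mem_classes.
rewrite (bigD1 _ wcl) /= in E.
have Fr : (F (repr (w ^: H)) = F w)%R.
  by have /imsetP[y yH ->] := mem_repr _ (class_refl H w); rewrite cfunJ.
have -> : (dot_on (w ^: H) phi psi = ('[phi * Fp, psi] -
   \sum_(X in cl | X != w ^: H) F (repr X) * dot_on X phi psi) / F w)%R.
  by rewrite E Fr addrK mulrC mulKf.
rewrite rpred_div // rpredB // rpred_sum // => X /andP[/imsetP[x xH ->] neq].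
have {xH neq} [y [yH -> neq]] : exists y, [/\ y \in H, x ^: H = y ^: H & y ^: H != w ^: H].
  by exists x.
have Fry : (F (repr (y ^: H)) = F y)%R.
  by have /imsetP[v vH ->] := mem_repr _ (class_refl H y); rewrite cfunJ.
have [->|Fy] := eqVneq (F (repr (y ^: H))) 0%R; first by rewrite mul0r rpred0.
rewrite rpredM //.
(* A class on which the permutation character is nonzero meets [<[w]>]. Its representative there has
   order smaller than [w], since by [gen] one of equal order would lie in the class of [w]; so the
   induction applies. *)
have [v vH yv] : exists2 v, v \in H & y ^ v \in <[w]>.
  move: Fy; rewrite Fry FN mulf_eq0 negb_or pnatr_eq0 -lt0n => /andP[/card_gt0P[v]].
  by rewrite inE => /andP[vH yv] _; exists v.
rewrite -(classGidl y vH) in neq *.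
apply: IH; first by rewrite groupJ.
rewrite ltnS in lt_w; apply: leq_trans lt_w; rewrite ltn_neqAle.
rewrite (dvdn_leq (order_gt0 w) (order_dvdG yv)) andbT.
by apply: contraNneq neq => eq_ord; apply/eqP/class_eqP/gen.
Qed.

End Pullback.

(** * Parity in Schur Q-functions *)

Section PowerSums.
Variables (R : comNzRingType) (N : nat).
Implicit Types (f : {mpoly R[N]}) (m : 'X_{1..N}).

Definition psum k : {mpoly R[N]} := \sum_(i < N) 'X_i ^+ k.

Lemma U_le j i m : (i <= m j)%N -> (U_(j) *+ i <= m)%MM.
Proof.
move=> im; apply/mnm_lepP => l; rewrite mulmnE mnm1E.
by case: eqP => [<-|_]; rewrite ?mul1n.
Qed.

Lemma mcoeffXnM j i f m :
  ('X_j ^+ i * f)@_m = if (i <= m j)%N then f@_(m - U_(j) *+ i)%MM else 0.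
Proof.
rewrite mpolyXn mulrC; case: ifP => im; first by rewrite -{1}(submK (U_le im)) addmC mcoeffMX.
apply/eqP; rewrite mcoeff_eq0 (perm_mem (msuppMX _ _)); apply/mapP => -[m' _ E].
by move: im; rewrite E mnmDE mulmnE mnm1E eqxx mul1n leq_addr.
Qed.

Lemma mcoeff_psum_prod (s : seq nat) m :
  (\prod_(k <- s) psum k)@_m =
  #|[set f : {ffun 'I_(size s) -> 'I_N} |
      [forall i, m i == (\sum_(j | f j == i) nth 0 s j)%N]]|%:R.
Proof.
rewrite (big_nth 0%N) big_mkord bigA_distr_bigA raddf_sum /=.
rewrite -sum1_card natr_sum [RHS]big_mkcond /=; apply: eq_bigr => f _.
have -> : \prod_(j < size s) 'X_(f j) ^+ nth 0%N s j =
    'X_[\sum_(j < size s) (U_(f j) *+ nth 0%N s j)] :> {mpoly R[N]}.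
  rewrite (big_morph (@mpolyX N R) (@mpolyXD N R) (@mpolyX0 N R)).
  by apply: eq_bigr => j _; rewrite mpolyXn.
rewrite mcoeffX inE; set T := (\sum_(_ < _) _)%MM.
have -> : (T == m) = [forall i, m i == (\sum_(j | f j == i) nth 0 s j)%N].
  have TE i : T i = (\sum_(j | f j == i) nth 0 s j)%N.
    rewrite mnm_sumE [RHS]big_mkcond /=; apply: eq_bigr => j _.
    by rewrite mulmnE mnm1E; case: (f j == i); rewrite ?mul1n ?mul0n.
  apply/eqP/forallP => [<- i|H]; first by rewrite TE.
  by apply/mnmP => i; rewrite TE; apply/esym/eqP/H.
by case: ifP.
Qed.

End PowerSums.

(** * Newton's identities and the recurrence for Schur's q_r *)

Section Newton.
Variable N : nat.
Implicit Types (f : {mpoly algC[N]}) (m : 'X_{1..N}).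
Local Notation psum := (psum algC N).

Lemma mcoeff_complete_sym k m : (complete_sym N k)@_m = (mdeg m == k)%:R.
Proof.
rewrite /complete_sym raddf_sum /=; under eq_bigr do rewrite mcoeffX.
case: eqP => [mk|mk]; last first.
  by rewrite big1 // => h /eqP hk; case: eqP => // hm; case: mk; rewrite -hm.
have lt : (mdeg m < k.+1)%N by rewrite mk.
rewrite (bigD1 (BMultinom lt)) /= ?mk // eqxx big1 ?addr0 // => h /andP[_ hm].
by case: eqP => // E; case/eqP: hm; apply: val_inj.
Qed.

Lemma mdegB1 m j i : (i <= m j)%N -> (mdeg (m - U_(j) *+ i)%MM + i)%N = mdeg m.
Proof.
by move=> im; rewrite -[in RHS](submK (U_le im)) mdegD mdegMn mdeg1 mul1n.
Qed.

Lemma sumr_mdeg m : (mdeg m)%:R = \sum_j (m j)%:R :> algC.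
Proof. by rewrite mdegE natr_sum. Qed.

Lemma newton_complete k :
  k%:R * complete_sym N k = \sum_(1 <= i < k.+1) psum i * complete_sym N (k - i).
Proof.
apply/mpolyP => m; rewrite mulr_natl mcoeffMn mcoeff_complete_sym raddf_sum /=.
under eq_bigr do rewrite /psum mulr_suml raddf_sum /=.
rewrite exchange_big /=.
have E (j : 'I_N) : \sum_(1 <= i < k.+1) ('X_j ^+ i * complete_sym N (k - i))@_m =
    (mdeg m == k)%:R * (m j)%:R.
  under eq_big_nat => i /andP[i1 ik].
    rewrite mcoeffXnM mcoeff_complete_sym.
    over.
  case: eqP => [mk|mk] /=; last first.
    rewrite mul0r big_nat big1 // => i /andP[i1 ik]; case: ifP => // im.
    case: eqP => // E; case: mk; rewrite -(mdegB1 im) E subnK //.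
  rewrite mul1r.
  have mjk : (m j < k.+1)%N by rewrite ltnS -mk mdegE (bigD1 j) //= leq_addr.
  rewrite (big_cat_nat _ (n := (m j).+1)) //= [X in _ + X]big_nat [X in _ + X]big1 ?addr0; last first.
    by move=> i /andP[mi _]; rewrite leqNgt mi.
  rewrite big_nat (eq_bigr (fun=> 1)) -?big_nat; last first.
    move=> i /andP[i1 im]; rewrite ltnS in im; rewrite im.
    by have := mdegB1 im; rewrite mk => <-; rewrite addnK eqxx.
  by rewrite sumr_const_nat subn1.
under eq_bigr do rewrite E.
rewrite -mulr_sumr -sumr_mdeg; case: eqP => [->|_]; rewrite ?mul1r // mul0r mul0rn //.
Qed.

(** Only [i = a] and [i = a - 1] contribute, with opposite signs; for [a = 1] the second index falls
    outside the range. Here [a] is the exponent of one variable, and the terms count how removing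
    its i-th power can leave a squarefree monomial. *)
Lemma alt_sum_near a k : (a <= k)%N ->
  \sum_(1 <= i < k.+1) (-1) ^+ i.+1 * ((i <= a) && (a - i <= 1))%N%:R =
  ((a <= 1) * a)%N%:R :> algC.
Proof.
case: a => [|[|a]] ak.
- by rewrite muln0 big_nat big1 // => i /andP[i1 _]; rewrite leqNgt i1 mulr0.
- rewrite big_ltn // big_nat big1 ?addr0 => [|i /andP[i1 _]].
    by rewrite expr2 mulrNN !mulr1.
  by rewrite leqNgt i1 mulr0.
rewrite mul0n (@big_cat_nat _ _ _ a.+1) //=; last by lia.
rewrite big_nat big1 ?add0r => [|i /andP[i1 ia]]; last first.
  by rewrite [(_ - _ <= _)%N]leqNgt (_ : (1 < a.+2 - i)%N) ?andbF ?mulr0 //; lia.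
rewrite big_ltn; last by lia.
rewrite big_ltn; last by lia.
rewrite big_nat big1 ?addr0 => [|i /andP[i1 ia]]; last first.
  by rewrite leqNgt (_ : (a.+2 < i)%N) ?mulr0.
rewrite leqnSn leqnn subnn subSnn /= !mulr1 [X in _ + X]exprS mulN1r.
exact: subrr.
Qed.

Lemma newton_mesym k :
  k%:R * mesym N algC k = \sum_(1 <= i < k.+1) (-1) ^+ i.+1 * (psum i * mesym N algC (k - i)).
Proof.
apply/mpolyP => m; rewrite mulr_natl mcoeffMn mcoeff_mesym raddf_sum /=.
have sgn i f : ((-1) ^+ i * f)@_m = (-1) ^+ i * f@_m.
  elim: i => [|i IH]; first by rewrite !expr0 !mul1r.
  by rewrite !exprS -!mulrA !mulN1r mcoeffN IH.
under eq_bigr do rewrite /psum mulr_suml sgn raddf_sum mulr_sumr /=.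
rewrite exchange_big /=.
have charE (j : 'I_N) i : (i <= k)%N ->
   ((i <= m j) && mechar (k - i) (m - U_(j) *+ i)%MM)%N =
   [&& (mdeg m == k)%N, [forall l, (l != j) ==> (m l <= 1)%N] & (i <= m j) && (m j - i <= 1)]%N.
  move=> ik; have [im|] := boolP (i <= m j)%N; last by rewrite !andbF.
  rewrite /mechar -(mdegB1 im) /= -{2}(subnK ik) eqn_add2r; congr andb.
  apply/forallP/andP => [H|[/forallP H1 H2] l].
    split; last by have := H j; rewrite mnmBE mulmnE mnm1E eqxx mul1n.
    apply/forallP => l; apply/implyP => lj; have := H l.
    by rewrite mnmBE mulmnE mnm1E eq_sym (negbTE lj) subn0.
  rewrite mnmBE mulmnE mnm1E; have [<-|] := eqVneq j l; first by rewrite mul1n.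
  by move=> jl; have := H1 l; rewrite eq_sym jl subn0.
have E (j : 'I_N) : \sum_(1 <= i < k.+1) (-1) ^+ i.+1 * ('X_j ^+ i * mesym N algC (k - i))@_m =
    (mechar k m)%:R * (m j)%:R.
  transitivity (((mdeg m == k) && [forall l, (l != j) ==> (m l <= 1)%N])%:R *
    (\sum_(1 <= i < k.+1) (-1) ^+ i.+1 * ((i <= m j) && (m j - i <= 1))%N%:R) : algC).
    rewrite mulr_sumr big_nat [RHS]big_nat; apply: eq_bigr => i /andP[_ ik].
    rewrite mcoeffXnM mcoeff_mesym mulrCA; congr (_ * _).
    rewrite -natrM mulnb -andbA -(charE _ _ ik).
    by case: (i <= m j)%N.
  have [mk|mk] := eqVneq (mdeg m) k; last by rewrite /mechar (negbTE mk) !mul0r.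
  rewrite alt_sum_near; last by rewrite -mk mdegE (bigD1 j) //= leq_addr.
  rewrite /mechar mk eqxx /= natrM mulrA; congr (_ * _); rewrite -natrM mulnb; congr (_%:R).
  congr nat_of_bool; apply/andP/forallP => [[/forallP H H1] l|H].
    by have [->//|lj] := eqVneq l j; have := H l; rewrite lj.
  by split; [apply/forallP => l; rewrite H implybT | exact: H].
under eq_bigr do rewrite E.
rewrite -mulr_sumr -sumr_mdeg /mechar; case: eqP => [->|_]; rewrite ?mul0r ?mul0rn //.
by rewrite mulr_natr.
Qed.

Lemma sum_conv (V : nmodType) r (F : nat -> nat -> nat -> V) :
  \sum_(a < r.+1) \sum_(1 <= i < a.+1) F i (a - i)%N (r - a)%N =
  \sum_(1 <= i < r.+1) \sum_(a < (r - i).+1) F i a (r - i - a)%N.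
Proof.
rewrite -(big_mkord xpredT (fun a => \sum_(1 <= i < a.+1) F i (a - i)%N (r - a)%N)).
transitivity (\sum_(0 <= a < r.+1) \sum_(1 <= i < r.+1 | (i <= a)%N) F i (a - i)%N (r - a)%N).
  apply: eq_big_nat => a /andP[_ ar].
  rewrite [RHS](big_cat_nat _ (n := a.+1)) //= [X in _ = _ + X]big_nat_cond.
  rewrite [X in _ = _ + X]big1 ?addr0; last by move=> i; lia.
  by rewrite big_nat [RHS]big_nat_cond; apply: eq_bigl => i; lia.
under eq_bigr do rewrite big_mkcond /=.
rewrite exchange_big_nat /=; apply: eq_big_nat => i /andP[i1 ir].
rewrite -(big_mkord xpredT (fun a => F i a (r - i - a)%N)).
rewrite (big_cat_nat _ (n := i)) //=; last by lia.
rewrite big_nat big1 ?add0r; last by move=> a; case: leqP => //; lia.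
rewrite -{1}(add0n i) big_addn subSn // big_nat [RHS]big_nat.
by apply: eq_bigr => a _; rewrite leq_addl addnK subnDA subnAC.
Qed.

(** The logarithmic derivative of the generating product (1 + x t) / (1 - x t). Splitting [r] as
    [a + (r - a)] applies Newton's identity to each factor; their sum doubles the odd power sums and
    cancels the even ones. *)
Lemma newton_schur_q r :
  r%:R * schur_q N r = 2%:R * \sum_(1 <= i < r.+1 | odd i) psum i * schur_q N (r - i).
Proof.
pose e := mesym N algC; pose h := complete_sym N.
have D1 : \sum_(a < r.+1) (a%:R * e a) * h (r - a)%N =
    \sum_(1 <= i < r.+1) (-1) ^+ i.+1 * (psum i * schur_q N (r - i)).
  under eq_bigr do rewrite newton_mesym mulr_suml.
  rewrite (sum_conv _ (fun i a b => (-1) ^+ i.+1 * (psum i * e a) * h b)).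
  by apply: eq_bigr => i _; rewrite /schur_q !mulr_sumr; apply: eq_bigr => a _; rewrite !mulrA.
have D2 : \sum_(a < r.+1) e a * ((r - a)%:R * h (r - a)%N) =
    \sum_(1 <= i < r.+1) psum i * schur_q N (r - i).
  rewrite (reindex_inj rev_ord_inj) /=.
  under eq_bigr => a _.
    rewrite subSS subKn -1?ltnS // newton_complete mulr_sumr; over.
  rewrite (sum_conv _ (fun i a b => e b * (psum i * h a))).
  apply: eq_bigr => i _; rewrite /schur_q mulr_sumr [RHS](reindex_inj rev_ord_inj) /=.
  apply: eq_bigr => a _; rewrite subSS subKn -1?ltnS // mulrCA.
  done.
have -> : r%:R * schur_q N r = \sum_(a < r.+1) (a%:R * e a) * h (r - a)%N +
    \sum_(a < r.+1) e a * ((r - a)%:R * h (r - a)%N).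
  rewrite -big_split mulr_sumr; apply: eq_bigr => a _ /=.
  have {1}-> : r = (a + (r - a))%N by rewrite subnKC // -ltnS.
  by rewrite natrD mulrDl -/e -/h; ring.
rewrite D1 D2 -big_split mulr_sumr [RHS]big_mkcond /=; apply: eq_bigr => i _.
rewrite -signr_odd /= -[X in _ + X]mul1r -mulrDl; case: (odd i) => //=.
by rewrite expr1 addNr mul0r.
Qed.

End Newton.

Section SeqMonomials.
Implicit Types s t : seq nat.

Definition seq_mnm t : 'X_{1..size t} := [multinom nth 0 t i | i < size t].

Let fits s t (f : {ffun 'I_(size s) -> 'I_(size t)}) :=
  [forall i, seq_mnm t i == (\sum_(j | f j == i) nth 0 s j)%N].

Lemma fits_surj s t f : all (leq 1) t -> @fits s t f -> forall i, exists j, f j = i.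
Proof.
move=> t0 /forallP H i; have [/existsP[j /eqP]|] := boolP [exists j, f j == i]; first by exists j.
rewrite negb_exists => /forallP N0; have := H i; rewrite mnmE big1 => [|j /eqP fj].
  by rewrite eqn0Ngt (allP t0) // mem_nth.
by case/eqP: (N0 j).
Qed.

Lemma fits_perm s t f : all (leq 1) t -> size s = size t -> @fits s t f ->
  exists2 g : 'I_(size t) -> 'I_(size s), bijective g &
    forall i, f (g i) = i /\ nth 0%N s (g i) = nth 0%N t i.
Proof.
move=> t0 st H; have surj := fits_surj t0 H.
have [g gK] : exists g : 'I_(size t) -> 'I_(size s), forall i, f (g i) = i.
  exact: (fin_all_exists surj).
have bij_g : bijective g by apply: inj_card_bij (can_inj gK) _; rewrite !card_ord st.
exists g => // i; split=> //.
move/forallP: H => /(_ i); rewrite mnmE => /eqP ->.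
rewrite (big_pred1 (g i)) // => j /=; have [g' g'K gK'] := bij_g.
by rewrite -{1}(gK' j) gK -(inj_eq (can_inj g'K)) gK'.
Qed.

(** Every variable must receive some factor of the product, so the assignment of factors to
    variables is onto, and bijective when the lengths agree. *)
Lemma mcoeff_psum_size (R : comNzRingType) s t : all (leq 1) t ->
  (\prod_(k <- s) psum R (size t) k)@_(seq_mnm t) != 0 ->
  (size t <= size s)%N /\ (size s = size t -> perm_eq s t).
Proof.
move=> t0; rewrite mcoeff_psum_prod; set A := [set _ | _].
have [->|[f]] := set_0Vmem A; first by rewrite cards0 eqxx.
rewrite inE => ft _; split.
  have surj := fits_surj t0 ft.
  have -> : size t = #|codom f|.
    rewrite -[LHS]card_ord; apply: eq_card => i; rewrite !inE; apply/esym/codomP.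
    by have [j <-] := surj i; exists j.
  by rewrite -[X in (_ <= X)%N]card_ord leq_image_card.
move=> st; have [g bij_g gP] := fits_perm t0 st ft.
have -> : t = [seq nth 0%N s (val j) | j <- [seq g i | i <- enum 'I_(size t)]].
  rewrite -map_comp -[LHS](mkseq_nth 0%N) /mkseq -val_enum_ord -map_comp.
  by apply: eq_map => i /=; have [_ ->] := gP i.
rewrite -{1}[s](mkseq_nth 0%N) /mkseq -val_enum_ord -map_comp; apply: (@perm_map _ _ (fun j => nth 0%N s (val j))).
apply: uniq_perm; rewrite ?(map_inj_uniq (bij_inj bij_g)) -?enumT ?enum_uniq // => j.
by have [g' _ gK'] := bij_g; rewrite mem_enum -(gK' j) map_f // mem_enum.
Qed.

(** Since the parts are distinct, the identity is the only assignment of factors to variables. *)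
Lemma mcoeff_psum_uniq (R : comNzRingType) t : all (leq 1) t -> uniq t ->
  (\prod_(k <- t) psum R (size t) k)@_(seq_mnm t) = 1.
Proof.
move=> t0 ut; rewrite mcoeff_psum_prod (_ : [set _ | _] = [set [ffun i => i]]) ?cards1 //.
apply/setP => f; rewrite inE in_set1; apply/idP/eqP => [ft|->].
  have [g _ gP] := fits_perm t0 erefl ft.
  have gid i : g i = i.
    by have [_ /eqP] := gP i; rewrite nth_uniq // => /eqP/val_inj.
  by apply/ffunP => i; rewrite ffunE -{1}(gid i); have [] := gP i.
apply/forallP => i; rewrite mnmE (big_pred1 i) // => j.
by rewrite /= ffunE.
Qed.

Lemma mcoeff_psum_self t : (\prod_(k <- t) psum algC (size t) k)@_(seq_mnm t) != 0.
Proof.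
rewrite mcoeff_psum_prod pnatr_eq0 -lt0n; apply/card_gt0P; exists [ffun i => i].
rewrite inE; apply/forallP => i; rewrite mnmE (big_pred1 i) // => j.
by rewrite /= ffunE.
Qed.

End SeqMonomials.

(** * Schur's q_r as polynomials in formal power sums *)

Section FormalQ.
Variable n : nat.
Local Notation M := n.+1.
Local Notation B := {mpoly algC[M]}.

(* The variable of index i stands for the power sum of degree i + 1; the degree b
   must lie between 1 and n + 1. *)
Definition fpsum b : B := 'X_(inord b.-1).
Definition odd_index b := [&& odd b, 0 < b & b <= M]%N.

(** Solves the recurrence of [newton_schur_q]; [k] is fuel, sufficient when it is at least [r]. *)
Fixpoint fq_rec k r : B :=
  if k is k'.+1 then
    if r is 0 then 1 else
    (2%:R / r%:R) *: \sum_(1 <= i < r.+1 | odd i) fpsum i * fq_rec k' (r - i)%N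
  else 1.
Definition fq r := fq_rec r r.

Lemma fq_rec_stable k r : (r <= k)%N -> fq_rec k r = fq r.
Proof.
rewrite /fq; elim/ltn_ind: r k => -[|r] IH [|k] //= rk; congr (_ *: _).
rewrite big_nat_cond [RHS]big_nat_cond; apply: eq_bigr => i /andP[/andP[i1 ir] _]; congr (_ * _).
by rewrite IH ?[RHS]IH //; lia.
Qed.

Lemma fq0 : fq 0 = 1. Proof. by []. Qed.

Lemma newton_fq r : r%:R *: fq r = 2%:R *: \sum_(1 <= i < r.+1 | odd i) fpsum i * fq (r - i)%N.
Proof.
case: r => [|r]; first by rewrite scale0r big_geq ?scaler0.
rewrite {1}/fq /= scalerA mulrC divfK ?pnatr_eq0 //; congr (_ *: _).
rewrite big_nat_cond [RHS]big_nat_cond; apply: eq_bigr => i /andP[/andP[i1 ir] _]; congr (_ * _).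
by rewrite fq_rec_stable //; lia.
Qed.

Definition at_psums N (F : B) : {mpoly algC[N]} := F \mPo [tuple psum algC N i.+1 | i < M].

Lemma at_psums_fpsum N b : (0 < b <= M)%N -> at_psums N (fpsum b) = psum algC N b.
Proof.
move=> /andP[b0 bM]; rewrite /at_psums comp_mpolyXU -tnth_nth tnth_mktuple inordK ?prednK //.
Qed.

Lemma schur_q0 N : schur_q N 0 = 1.
Proof.
rewrite /schur_q big_ord1 mesym0E mul1r; apply/mpolyP => m.
by rewrite mcoeff_complete_sym mcoeff1 mdeg_eq0.
Qed.

Lemma at_psums_fq N r : (r <= M)%N -> at_psums N (fq r) = schur_q N r.
Proof.
elim/ltn_ind: r => -[|r] IH rM; first by rewrite fq0 schur_q0 /at_psums rmorph1.
apply: (@scalerI _ _ r.+1%:R); first by rewrite pnatr_eq0.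
rewrite -linearZ /= newton_fq [RHS]scaler_nat -[RHS]mulr_natl newton_schur_q.
rewrite linearZ /= [LHS]scaler_nat -[LHS]mulr_natl; congr (_ * _).
rewrite linear_sum [LHS]big_nat_cond [RHS]big_nat_cond; apply: eq_bigr => i /andP[/andP[i1 ir] _] /=.
by rewrite rmorphM; congr (_ * _); [apply: at_psums_fpsum | apply: IH]; lia.
Qed.

Definition mnm_seq (m : 'X_{1..M}) : seq nat := flatten [seq nseq (m i) (val i).+1 | i <- enum 'I_M].

Lemma at_psums_X N m : at_psums N 'X_[m] = \prod_(k <- mnm_seq m) psum algC N k.
Proof.
rewrite /at_psums comp_mpolyX /mnm_seq big_flatten big_map big_enum /=.
by apply: eq_bigr => i _; rewrite tnth_mktuple big_nseq iter_mulr_1.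
Qed.

Lemma size_mnm_seq m : size (mnm_seq m) = mdeg m.
Proof.
rewrite mdegE size_flatten /shape -map_comp sumnE big_map big_enum /=.
by apply: eq_bigr => i _; rewrite size_nseq.
Qed.

Lemma count_mnm_seq m (i : 'I_M) : count_mem i.+1 (mnm_seq m) = m i.
Proof.
rewrite count_flatten -map_comp sumnE big_map big_enum /= (bigD1 i) //= big1 ?addn0.
  by rewrite count_nseq /= eqxx mul1n.
by move=> j ji; rewrite count_nseq /= eqSS (negbTE (ji : j != i :> nat)).
Qed.

(** The monomial order compares degrees first, so the leading monomial of [F] has the most power sum
    factors. In exactly that many variables, the monomial with these degrees as exponents occurs in
    its image and in the image of no other monomial of [F]: fewer factors cannot reach all
    variables, and equally many must agree up to order. *)
Lemma at_psums_inj (F : B) : (forall N, at_psums N F = 0) -> F = 0.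
Proof.
move=> F0; apply/eqP; apply: contraT => nzF.
pose t := mnm_seq (mlead F).
have t0 : all (leq 1) t.
  by apply/allP => k /flattenP[_ /mapP[i _ ->]] /nseqP[-> _].
have specE N : at_psums N F = \sum_(m <- msupp F) F@_m *: \prod_(k <- mnm_seq m) psum algC N k.
  rewrite /at_psums {1}[F]mpolyE linear_sum /=; apply: eq_bigr => m _.
  by rewrite linearZ; congr (_ *: _); exact: at_psums_X.
have := congr1 (mcoeff (seq_mnm t)) (F0 (size t)).
rewrite specE raddf_sum mcoeff0 (big_rem (mlead F)) ?mlead_supp //= [X in _ + X]big_seq_cond [X in _ + X]big1 => [|m /andP[mF _]].
  rewrite addr0 mcoeffZ => /eqP.
  by rewrite mulf_eq0 mcoeff_eq0 mlead_supp // (negbTE (mcoeff_psum_self t)).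
rewrite mcoeffZ.
have [->|nz] := eqVneq ((\prod_(k <- mnm_seq m) psum algC (size t) k)@_(seq_mnm t)) 0.
  by rewrite mulr0.
have [le_sz perm_t] := mcoeff_psum_size t0 nz.
have [mF' ne] : m \in msupp F /\ m != mlead F.
  by move: mF; rewrite (mem_rem_uniq _ (msupp_uniq F)) !inE => /andP[].
case/eqP: ne; apply/mnmP => i; rewrite -!count_mnm_seq; apply/seq.permP/perm_t/anti_leq.
rewrite /t !size_mnm_seq in le_sz *; rewrite le_sz andbT.
exact/lemc_mdeg/msupp_le_mlead.
Qed.

End FormalQ.

(** * Derivations dual to multiplication by power sums *)

Section Derivations.
Variable n : nat.
Local Notation M := n.+1.
Local Notation B := {mpoly algC[M]}.
Local Notation fpsum := (fpsum n).
Local Notation fq := (fq n).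
Local Notation odd_index := (odd_index n).

(* Half the adjoint of the multiplication by the b-th power sum; it maps q_r
   to q_(r - b). *)
Definition fder b (F : B) : B := (b%:R / 2%:R) *: mderiv (inord b.-1) F.

Lemma fderD b F G : fder b (F + G) = fder b F + fder b G.
Proof. by rewrite /fder mderivD scalerDr. Qed.

Lemma fderZ b c F : fder b (c *: F) = c *: fder b F.
Proof. by rewrite /fder mderivZ !scalerA mulrC. Qed.

Lemma fder0 b : fder b 0 = 0.
Proof. by rewrite /fder mderiv0 scaler0. Qed.

Lemma fder1 b : fder b 1 = 0.
Proof. by rewrite /fder -mpolyC1 mderivC scaler0. Qed.

Lemma fder_sum b I (r : seq I) (P : pred I) F :
  fder b (\sum_(i <- r | P i) F i) = \sum_(i <- r | P i) fder b (F i).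
Proof. by apply: (big_morph _ (fderD b) (fder0 b)). Qed.

Lemma fderM b F G : fder b (F * G) = fder b F * G + F * fder b G.
Proof. by rewrite /fder mderivM scalerDr -scalerAl -scalerAr. Qed.

Lemma fder_prod b (I : finType) (F : I -> B) :
  fder b (\prod_i F i) = \sum_i fder b (F i) * \prod_(j | j != i) F j.
Proof.
have H (s : seq I) : uniq s ->
    fder b (\prod_(i <- s) F i) = \sum_(i <- s) fder b (F i) * \prod_(j <- s | j != i) F j.
  elim: s => [|x s IH] /=; first by rewrite !big_nil fder1.
  case/andP => xs us; rewrite big_cons fderM IH // [RHS]big_cons; congr (_ + _).
    rewrite big_cons eqxx /=; congr (_ * _); rewrite big_seq [RHS]big_seq_cond.
    by apply: eq_bigl => j; case: eqP => [->|]; rewrite ?(negbTE xs) // andbT.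
  rewrite mulr_sumr !big_seq; apply: eq_bigr => i si.
  rewrite big_cons; case: eqP => [E|_]; first by rewrite -E (negbTE xs) in si.
  by rewrite mulrCA.
exact: H (index_enum_uniq I).
Qed.

Lemma fder_fpsum b i : (0 < b <= M)%N -> (0 < i <= M)%N ->
  fder b (fpsum i) = (b%:R / 2%:R * (i == b)%:R) *: 1.
Proof.
move=> /andP[b0 bM] /andP[i0 iM]; rewrite /fder /fpsum mderivX mnm1E scalerA.
have E : (inord i.-1 == inord b.-1 :> 'I_M) = (i == b).
  by rewrite -val_eqE /= !inordK; lia.
rewrite E; case: eqP => [->|_]; last by rewrite mulr0 !scale0r.
congr (_ *: _); rewrite -mpolyX0; congr 'X_[_].
by apply/mnmP => l; rewrite mnmBE subnn mnm0E.
Qed.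

(** Differentiate the recurrence for r q_r. The factor p_b yields b q_(r - b), and the remaining
    terms reassemble into the recurrence for (r - b) q_(r - b). *)
Lemma fder_fq b r : odd_index b -> (r <= M)%N ->
  fder b (fq r) = if (b <= r)%N then fq (r - b) else 0.
Proof.
move=> /and3P[ob b0 bM]; elim/ltn_ind: r => -[|r] IH rM.
  by rewrite leqNgt b0 fq0 fder1.
apply: (@scalerI _ _ r.+1%:R); first by rewrite pnatr_eq0.
rewrite -fderZ newton_fq fderZ fder_sum.
pose X i := (b%:R / 2%:R * (i == b)%:R) *: fq (r.+1 - i).
pose Y i := if (b <= r.+1 - i)%N then fpsum i * fq (r.+1 - i - b) else 0.
rewrite (_ : \sum_(1 <= i < r.+2 | odd i) _ =
    \sum_(1 <= i < r.+2 | odd i) X i + \sum_(1 <= i < r.+2 | odd i) Y i); last first.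
  rewrite -big_split /= [LHS]big_nat_cond [RHS]big_nat_cond.
  apply: eq_bigr => i /andP[/andP[i1 ir] oi].
  rewrite fderM fder_fpsum; [|lia|lia].
  rewrite IH; [|lia|lia]; rewrite -scalerAl mul1r /X /Y.
  by case: ifP => // _; rewrite mulr0.
case: leqP => [br|rb]; last first.
  rewrite [X in X + _]big_nat_cond [X in _ + X]big_nat_cond !big1 ?addr0 ?scaler0 //.
    by move=> i /andP[/andP[i1 ir] _]; rewrite /Y ifF //; lia.
  by move=> i /andP[/andP[i1 ir] _]; rewrite /X (_ : (i == b) = false) ?mulr0 ?scale0r //; lia.
have -> : \sum_(1 <= i < r.+2 | odd i) X i = (b%:R / 2%:R) *: fq (r.+1 - b).
  have bin : (b \in index_iota 1 r.+2) by rewrite mem_index_iota; lia.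
  rewrite big_mkcond (bigD1_seq b) ?iota_uniq //= ob {1}/X eqxx mulr1 big1 ?addr0 //.
  by move=> i ib; rewrite /X (negbTE ib) mulr0 scale0r if_same.
have -> : \sum_(1 <= i < r.+2 | odd i) Y i =
    \sum_(1 <= i < (r.+1 - b).+1 | odd i) fpsum i * fq (r.+1 - b - i).
  rewrite (big_cat_nat _ (n := (r.+1 - b).+1)) //=; last by lia.
  rewrite [X in _ + X]big_nat_cond [X in _ + X]big1 ?addr0; last first.
    by move=> i /andP[/andP[i1 ir] _]; rewrite /Y ifF //; lia.
  rewrite [LHS]big_nat_cond [RHS]big_nat_cond; apply: eq_bigr => i /andP[/andP[i1 ir] _].
  by rewrite /Y ifT; [rewrite subnAC | lia].
rewrite scalerDr -newton_fq scalerA mulrC divfK ?pnatr_eq0 // -scalerDl -natrD.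
by rewrite subnKC.
Qed.

Definition fders (be : seq nat) (F : B) := foldl (fun F b => fder b F) F be.
(** The pairing of [F] with the product of the p_b for the inner product natural to Q-functions, in
    which products of power sums are orthogonal and p_al has squared norm z_al / 2^l(al). *)
Definition ell be (F : B) : algC := (fders be F)@_0.

Lemma ellD be F G : ell be (F + G) = ell be F + ell be G.
Proof. by elim: be F G => [|b be IH] F G; rewrite /ell /= ?mcoeffD // -/(ell _ _) fderD IH. Qed.

Lemma ellZ be c F : ell be (c *: F) = c * ell be F.
Proof. by elim: be F => [|b be IH] F; rewrite /ell /= ?mcoeffZ // -/(ell _ _) fderZ IH. Qed.

Lemma ell0 be : ell be 0 = 0.
Proof. by elim: be => [|b be IH]; rewrite /ell /= ?mcoeff0 // -/(ell _ _) fder0. Qed.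

Lemma ell_sum be I (r : seq I) (P : pred I) F :
  ell be (\sum_(i <- r | P i) F i) = \sum_(i <- r | P i) ell be (F i).
Proof. by apply: (big_morph _ (ellD be) (ell0 be)). Qed.

Lemma fq_coef0 r : (r <= M)%N -> (fq r)@_0 = (r == 0%N)%:R.
Proof.
case: r => [|r] rM; first by rewrite fq0 mcoeff1 eqxx.
apply: (@mulfI _ r.+1%:R); first by rewrite pnatr_eq0.
rewrite -mcoeffZ newton_fq mcoeffZ raddf_sum /= big1 ?mulr0 // => i _.
by rewrite rmorphM /= mcoeffX mnm1_eq0 mul0r.
Qed.

(* The derivations fder b are, up to the factor 2, adjoint to power sums, so this
   integrality is stable under products by the Leibniz rule. *)
Definition ints (F : B) := forall be, all odd_index be -> ell be F \is a Num.int.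

Lemma intsD F G : ints F -> ints G -> ints (F + G).
Proof. by move=> iF iG be gb; rewrite ellD rpredD ?iF ?iG. Qed.

Lemma intsN F : ints F -> ints (- F).
Proof. by move=> iF be gb; rewrite -scaleN1r ellZ mulN1r rpredN iF. Qed.

Lemma ints_der b F : odd_index b -> ints F -> ints (fder b F).
Proof. by move=> gb iF be gbe; apply: (iF (b :: be)); rewrite /= gb. Qed.

Lemma intsM F G : ints F -> ints G -> ints (F * G).
Proof.
move=> iF iG be; elim: be F G iF iG => [|b be IH] F G iF iG.
  by move=> _; rewrite /ell /= rmorphM /= rpredM ?(iF [::]) ?(iG [::]).
case/andP=> gb gbe; rewrite /ell /= -/(ell _ _) fderM ellD rpredD //.
  by apply: IH => //; apply: ints_der.
by apply: IH => //; apply: ints_der.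
Qed.

Lemma ints_nat c : ints c%:R.
Proof.
move=> be _; rewrite -[c%:R]scaler_nat ellZ rpredM ?rpred_nat //.
case: be => [|b be]; first by rewrite /ell /= mcoeff1 rpred_nat.
by rewrite /ell /= fder1 -/(ell be 0) ell0.
Qed.

Lemma ints_sum I (r : seq I) (P : pred I) F :
  (forall i, P i -> ints (F i)) -> ints (\sum_(i <- r | P i) F i).
Proof. by move=> H be gb; rewrite ell_sum rpred_sum // => i Pi; apply: H. Qed.

Lemma ints_sign i F : ints F -> ints ((-1) ^+ i * F).
Proof.
by move=> iF; rewrite -signr_odd; case: (odd i); rewrite ?expr1 ?expr0 ?mulN1r ?mul1r //; apply: intsN.
Qed.

Lemma ints_fq r : (r <= M)%N -> ints (fq r).
Proof.
move=> rM be; elim: be r rM => [|b be IH] r rM; first by rewrite /ell /= fq_coef0 // rpred_nat.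
case/andP => gb gbe; rewrite /ell /= -/(ell _ _) fder_fq //.
case: ifP => _; last by rewrite ell0.
by apply: IH => //; lia.
Qed.

End Derivations.

Section Coefficients.
Variable n : nat.
Local Notation M := n.+1.
Local Notation fpsum := (fpsum n).
Local Notation fq := (fq n).
Local Notation odd_index := (odd_index n).

(** The squared norm z_be / 2^l(be) of the power sum product; see [ell_fpsum_prod] and
    [weight_zee]. *)
Fixpoint weight (be : seq nat) : algC :=
  if be is b :: be' then b%:R / 2%:R * (count_mem b be').+1%:R * weight be' else 1.

Lemma fder_fpsum_prod b al : (0 < b <= M)%N -> all (fun a => 0 < a <= M)%N al ->
  fder b (\prod_(a <- al) fpsum a) =
  (b%:R / 2%:R * (count_mem b al)%:R) *: \prod_(a <- rem b al) fpsum a.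
Proof.
move=> gb; elim: al => [|a al IH] /=.
  by rewrite !big_nil fder1 mulr0 scale0r.
case/andP => ga gal; rewrite big_cons fderM fder_fpsum // IH // eq_sym.
have [ba|ab] /= := eqVneq b a; last first.
  by rewrite mulr0 scale0r mul0r add0r add0n big_cons scalerAr.
rewrite ba mulr1 -scalerAl mul1r -scalerAr.
have [aal|naal] := boolP (a \in al); last first.
  by rewrite (count_memPn naal) mulr0 scale0r addr0 addn0 mulr1.
rewrite -(big_cons _ _ _ _ xpredT) -(perm_big _ (perm_to_rem aal)) -scalerDl.
by rewrite natrD mulrDr mulr1.
Qed.

Lemma ell_fpsum_prod be al : all (fun a => 0 < a <= M)%N be -> all (fun a => 0 < a <= M)%N al ->
  ell be (\prod_(a <- al) fpsum a) = if perm_eq al be then weight be else 0.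
Proof.
elim: be al => [|b be IH] al.
  move=> _; case: al => [|a al] /=; first by rewrite big_nil /ell /= mcoeff1 eqxx.
  by rewrite big_cons /ell /= rmorphM /= mcoeffX mnm1_eq0 mul0r; case: ifP => // /perm_size.
case/andP => gb gbe gal; rewrite /ell /= -/(ell _ _) fder_fpsum_prod // ellZ.
have [bal|nbal] := boolP (b \in al); last first.
  rewrite (count_memPn nbal) mulr0 mul0r; case: ifP => // /perm_mem/(_ b).
  by rewrite (negbTE nbal) mem_head.
rewrite IH //; last by apply/allP => x /mem_rem xal; exact: (allP gal).
rewrite [in RHS](permPl (perm_to_rem bal)) perm_cons; case: ifP => [pe|_]; last by rewrite mulr0.
rewrite (seq.permP (perm_to_rem bal)) /= eqxx add1n; congr (_ * _.+1%:R * _).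
exact/seq.permP.
Qed.

(* Cauchy duality between the products of the q_r and the monomials. *)
Lemma ell_fq_prod l be (r : 'X_{1..l}) : all odd_index be -> (forall j, r j <= M)%N ->
  ell be (\prod_j fq (r j)) = ((\prod_(b <- be) psum int l b)@_r)%:~R.
Proof.
elim: be r => [|b be IH] r /=.
  move=> _ rM; rewrite big_nil mcoeff1 /ell /= rmorph_prod /=.
  rewrite (eq_bigr (fun j => (r j == 0%N)%:R)) => [|j _]; last by rewrite fq_coef0.
  have [->|nz] := eqVneq r 0%MM; first by rewrite big1 // => j _; rewrite mnm0E.
  have [j rj] : exists j, r j != 0%N.
    apply/existsP; apply: contraR nz; rewrite negb_exists => /forallP H.
    by apply/eqP/mnmP => j; rewrite mnm0E; apply/eqP; rewrite -[_ == _]negbK H.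
  by rewrite (bigD1 j) //= (negbTE rj) mul0r.
case/andP => gb gbe rM; rewrite /ell /= -/(ell _ _) fder_prod ell_sum.
rewrite big_cons {1}/psum mulr_suml raddf_sum /= rmorph_sum /=; apply: eq_bigr => j _.
rewrite mcoeffXnM fder_fq //; case: ifP => br; last by rewrite mul0r ell0.
have rb i : (r - U_(j) *+ b)%MM i = if i == j then (r j - b)%N else r i.
  by rewrite mnmBE mulmnE mnm1E eq_sym; case: eqP => [->|_]; rewrite ?mul1n ?mul0n ?subn0.
rewrite -IH // => [|i]; last by rewrite rb; case: ifP => // _; apply: leq_trans (leq_subr _ _) _.
congr (ell _ _); rewrite [RHS](bigD1 j) //= rb eqxx; congr (_ * _).
by apply: eq_bigr => i ij; rewrite rb (negbTE ij).
Qed.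

End Coefficients.

Section Parity.
Variables (R : comNzRingType) (l : nat).

Definition even_diff (x y : {mpoly R[l]}) := exists h, x = y + 2%:R * h.

Lemma even_diffM x y x' y' : even_diff x y -> even_diff x' y' -> even_diff (x * x') (y * y').
Proof. by move=> [h ->] [h' ->]; exists (y * h' + h * y' + 2%:R * h * h'); ring. Qed.

Lemma even_diff_trans y x z : even_diff x y -> even_diff y z -> even_diff x z.
Proof. by move=> [h ->] [h' ->]; exists (h + h'); ring. Qed.

Lemma even_diff_sqr_sum (I : Type) (r : seq I) (F : I -> {mpoly R[l]}) :
  even_diff ((\sum_(i <- r) F i) ^+ 2) (\sum_(i <- r) F i ^+ 2).
Proof.
elim: r => [|i r [h IH]]; first by exists 0; rewrite !big_nil; ring.
by rewrite !big_cons sqrrD IH; exists (h + F i * \sum_(j <- r) F j); rewrite -mulr_natl; ring.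
Qed.

Lemma even_diff_psum k m : even_diff (psum R l m ^+ (2 ^ k)) (psum R l (2 ^ k * m)).
Proof.
elim: k => [|k IH]; first by exists 0; rewrite expn0 mul1n expr1; ring.
rewrite expnSr exprM; apply: (@even_diff_trans (psum R l (2 ^ k * m) ^+ 2)).
  by rewrite !expr2; exact: even_diffM.
have := even_diff_sqr_sum (index_enum 'I_l) (fun i => 'X_i ^+ (2 ^ k * m)).
rewrite /psum; under [X in even_diff _ X]eq_bigr do rewrite -exprM.
by rewrite mulnAC.
Qed.

Lemma even_diff_glaisher la : all (leq 1) la ->
  even_diff (\prod_(b <- flatten [seq nseq (a`_2)%N (a`_2^')%N | a <- la]) psum R l b)
            (\prod_(a <- la) psum R l a).
Proof.
elim: la => [|a la IH]; first by exists 0; rewrite !big_nil; ring.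
case/andP=> a0 /IH{}IH /=; rewrite big_cat big_cons; apply: even_diffM IH => /=.
rewrite big_nseq iter_mulr_1 -{3}(partnC 2%N a0) p_part.
exact: even_diff_psum.
Qed.

End Parity.

(** * The Pfaffian modulo 2 and its pairing with power sums *)

Section Pfaffian.
Variables (R : comNzRingType) (q : nat -> R).

(** The sequence [q] is abstract so that the same expansion applies to [schur_q N] and to its formal
    counterpart [fq]. *)
Definition pf_entry a b : R :=
  q a * q b + 2%:R * \sum_(1 <= i < b.+1) (-1) ^+ i * (q (a + i)%N * q (b - i)%N).

Fixpoint pfaffian k (s : seq nat) : R :=
  match k, s with
  | k'.+1, a :: s' =>
      \sum_(j < size s') (-1) ^+ j *
        (pf_entry a (nth 0%N s' j) * pfaffian k' (take j s' ++ drop j.+1 s'))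
  | _, _ => 1
  end.

End Pfaffian.

Lemma Q_pfaffianE N k s : Q_pfaffian N k s = pfaffian (schur_q N) k s.
Proof.
by elim: k s => [|k IH] [|a s].
Qed.

Lemma perm_take_drop (s : seq nat) j : (j < size s)%N ->
  perm_eq s (nth 0%N s j :: (take j s ++ drop j.+1 s)).
Proof.
by move=> js; rewrite -{1}(cat_take_drop j s) (drop_nth 0%N js) -cat1s perm_catCA.
Qed.

Section SchurQ.
Variable n : nat.
Local Notation M := n.+1.
Local Notation fpsum := (fpsum n).
Local Notation fq := (fq n).
Local Notation odd_index := (odd_index n).

Lemma sumn_take_drop (s : seq nat) j : (j < size s)%N ->
  sumn s = (nth 0%N s j + sumn (take j s ++ drop j.+1 s))%N.
Proof. by move=> js; rewrite (perm_sumn (perm_take_drop js)). Qed.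

Lemma at_psums_pf_entry N a b : (a + b <= M)%N ->
  at_psums N (pf_entry fq a b) = pf_entry (schur_q N) a b.
Proof.
move=> abM; rewrite /pf_entry /at_psums rmorphD !rmorphM rmorph_nat rmorph_sum /=.
rewrite -!/(at_psums N _) !at_psums_fq; [|lia|lia].
congr (_ + _ * _); apply: eq_big_nat => i /andP[i1 ib].
by rewrite !rmorphM rmorph_sign /= -!/(at_psums N _) !at_psums_fq //; lia.
Qed.

Lemma at_psums_pfaffian N k s : (sumn s <= M)%N ->
  at_psums N (pfaffian fq k s) = pfaffian (schur_q N) k s.
Proof.
elim: k s => [|k IH] [|a s] /= sM; rewrite ?[LHS]rmorph1 //.
rewrite /at_psums rmorph_sum /=; apply: eq_bigr => j _.
have := sumn_take_drop (ltn_ord j) => E.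
rewrite !rmorphM rmorph_sign /= -!/(at_psums N _) at_psums_pf_entry; last by lia.
by rewrite IH //; lia.
Qed.

Lemma pf_entry_even a b : (a + b <= M)%N ->
  exists2 H, ints H & pf_entry fq a b = fq a * fq b + 2%:R * H.
Proof.
move=> abM; eexists; last reflexivity.
rewrite big_nat; apply: ints_sum => i /andP[i1 ib].
by apply/ints_sign/intsM; apply: ints_fq; lia.
Qed.

Lemma ints_prod_fq s : (sumn s <= M)%N -> ints (\prod_(a <- s) fq a).
Proof.
elim: s => [|a s IH] /= sM; first by rewrite big_nil -(mulr1n 1); exact: ints_nat.
by rewrite big_cons; apply: intsM; [apply: ints_fq | apply: IH]; lia.
Qed.

(** Modulo 2 the signs disappear and, by induction, every term of the first-row expansion is the
    product of all the q's; the number of terms is odd. Congruence modulo 2 means here that the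
    difference is twice a polynomial with integral pairings. *)
Lemma pfaffian_even k s : size s = k.*2 -> (sumn s <= M)%N ->
  exists2 H, ints H & pfaffian fq k s = \prod_(a <- s) fq a + 2%:R * H.
Proof.
elim: k s => [|k IH] [|a s] //=.
  by exists 0; [rewrite -(mulr0n 1); exact: ints_nat | rewrite big_nil mulr0 addr0].
move=> [sz] sM; set P := \prod_(_ <- _) _.
have iP : ints P by apply: ints_prod_fq.
have /fin_all_exists2[H iH HE] (j : 'I_(size s)) : exists2 H, ints H &
    (-1) ^+ j * (pf_entry fq a (nth 0%N s j) * pfaffian fq k (take j s ++ drop j.+1 s)) = P + 2%:R * H.
  have E := sumn_take_drop (ltn_ord j).
  have [|H1 iH1 ->] := @pf_entry_even a (nth 0%N s j); first by lia.
  have [||H2 iH2 ->] := IH (take j s ++ drop j.+1 s); [|lia|].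
    by have /= := perm_size (perm_take_drop (ltn_ord j)); lia.
  set p := \prod_(_ <- _) _.
  have PE : P = fq a * fq (nth 0%N s j) * p.
    by rewrite /P big_cons (perm_big _ (perm_take_drop (ltn_ord j))) big_cons mulrA.
  have ip : ints p by apply: ints_prod_fq; lia.
  have ia : ints (fq a) by apply: ints_fq; lia.
  have ib : ints (fq (nth 0%N s j)) by apply: ints_fq; lia.
  pose X := fq a * fq (nth 0%N s j) * H2 + H1 * p + 2%:R * H1 * H2.
  have iX : ints X.
    exact: (intsD (intsD (intsM (intsM ia ib) iH2) (intsM iH1 ip)) (intsM (intsM (@ints_nat n 2) iH1) iH2)).
  have XE : (fq a * fq (nth 0%N s j) + 2%:R * H1) * (p + 2%:R * H2) = P + 2%:R * X.
    by rewrite PE /X; ring.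
  rewrite XE -signr_odd; case: (odd j); last by exists X; rewrite ?expr0 ?mul1r.
  exists (- P - X); first by apply: intsD; apply: intsN.
  by rewrite expr1; ring.
(* The expansion has [k.*2.+1] terms, so the copies of [P] add up to [P] plus twice [k%:R * P]. *)
exists ((k%:R) * P + \sum_j H j).
  by apply: intsD; [apply: intsM => //; exact: ints_nat | apply: ints_sum => j _].
rewrite (eq_bigr _ (fun j _ => HE j)) big_split /= sumr_const card_ord -mulr_sumr.
move: (\sum_(_ < _) H _) => SH; rewrite sz.
by rewrite mulrS -mul2n mulrnA -[P *+ 2 *+ k]mulr_natl -[P *+ 2]mulr_natl; ring.
Qed.

Lemma ell_fq be r : all odd_index be -> (r <= M)%N -> sumn be = r -> ell be (fq r) = 1.
Proof.
elim: be r => [|b be IH] r /=; first by move=> _ _ <-; rewrite fq0 /ell /= mcoeff1 eqxx.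
case/andP => gb gbe rM E; rewrite /ell /= -/(ell _ _) fder_fq // ifT; last by lia.
by apply: IH => //; lia.
Qed.

Let zero_pad (la : seq nat) := if odd (size la) then rcons la 0%N else la.

Section Coefficient.
Variables (la : seq nat) (coef : seq nat -> algC).
Hypotheses (la_n : sumn la = n).
Hypothesis laE : forall N, schur_Q N la =
  \sum_(al <- parts n | all odd al) coef al *: psum_part N al.

(** As the hypothesis holds in every number of variables, [at_psums_inj] lifts it to formal power
    sums. The padding by 0 is the one in [schur_Q]; it does not change the product of the q's
    because q_0 is 1. *)
Let schur_Q_formal : pfaffian fq (size (zero_pad la))./2 (zero_pad la) =
  \sum_(al <- parts n | all odd al) coef al *: \prod_(a <- al) fpsum a.
Proof.
have pad_n : sumn (zero_pad la) = n.
  by rewrite /zero_pad; case: ifP; rewrite // -cats1 sumn_cat /= !addn0.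
apply/eqP; rewrite -subr_eq0; apply/eqP/at_psums_inj => N.
rewrite /at_psums raddfB /=; apply/eqP; rewrite subr_eq0; apply/eqP.
rewrite -[LHS]/(at_psums N _) at_psums_pfaffian ?pad_n // -Q_pfaffianE.
rewrite -[LHS]/(schur_Q N la) laE raddf_sum /=.
rewrite [LHS]big_seq_cond [RHS]big_seq_cond; apply: eq_bigr => al /andP[alP _].
rewrite linearZ; congr (_ *: _); rewrite /psum_part rmorph_prod /= [LHS]big_seq [RHS]big_seq.
apply: eq_bigr => k kal; apply/esym/at_psums_fpsum.
move: alP; rewrite mem_parts => /and3P[_ al0 /eqP aln].
by rewrite (allP al0) //= -aln leqW // sumnE (big_rem k) //= leq_addr.
Qed.

Variable be : seq nat.
Hypotheses (be_odd : all odd be) (be_n : sumn be = n).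

Let be_good : all odd_index be.
Proof.
apply/allP => b bbe; have ob := allP be_odd b bbe; rewrite /odd_index ob odd_gt0 //=.
by rewrite leqW // -be_n sumnE (big_rem b) //= leq_addr.
Qed.

Lemma schur_Q_weight :
  ell be (pfaffian fq (size (zero_pad la))./2 (zero_pad la)) = coef (sort geq be) * weight be.
Proof.
have sP : sort geq be \in parts n.
  rewrite mem_parts /is_part sort_sorted; last exact: geq_total.
  rewrite (perm_all _ (permEl (perm_sort _ _))) (perm_sumn (permEl (perm_sort _ _))) be_n eqxx andbT /=.
  by apply/allP => b /(allP be_odd); exact: odd_gt0.
have rng al : al \in parts n -> all (fun a => 0 < a <= M)%N al.
  rewrite mem_parts => /and3P[_ al0 /eqP aln]; apply/allP => k kal.
  by rewrite (allP al0) //= -aln leqW // sumnE (big_rem k) //= leq_addr.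
have rngb : all (fun a => 0 < a <= M)%N be.
  by apply/allP => b /(allP be_good)/and3P[_ -> ->].
rewrite schur_Q_formal ell_sum big_mkcond (bigD1_seq _ sP (uniq_parts n)) /=.
rewrite (perm_all _ (permEl (perm_sort _ _))) be_odd ellZ (ell_fpsum_prod rngb (rng _ sP)).
rewrite (permEl (perm_sort _ _)) [X in _ + X]big_seq_cond [X in _ + X]big1 ?addr0 // => al /andP[alP ne].
case: ifP => // _; rewrite ellZ (ell_fpsum_prod rngb (rng _ alP)); case: ifP => [pe|_]; last by rewrite mulr0.
case/eqP: ne; apply: (sorted_eq geq_trans geq_anti).
- by move: alP; rewrite mem_parts => /andP[].
- exact: sort_sorted geq_total _.
- by rewrite (permPl pe) perm_sym (permEl (perm_sort _ _)).
Qed.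

Lemma schur_Q_coef : exists K : int, coef (sort geq be) * weight be = K%:~R /\
  (all (leq 1) la -> uniq la ->
   be = flatten [seq nseq (a`_2)%N (a`_2^')%N | a <- la] -> odd `|K|%N).
Proof.
have pad_n : sumn (zero_pad la) = n.
  by rewrite /zero_pad; case: ifP; rewrite // -cats1 sumn_cat /= !addn0.
have [||H iH E] := @pfaffian_even (size (zero_pad la))./2 (zero_pad la).
- rewrite -[LHS]odd_double_half /zero_pad; case: ifP => o; rewrite ?o //.
  by rewrite size_rcons /= o.
- by rewrite pad_n.
have /intrP[h hE] := iH _ be_good.
have la_le : forall j : 'I_(size la), (seq_mnm la j <= M)%N.
  move=> i; by rewrite mnmE leqW // -la_n sumnE (big_rem (nth 0%N la i)) ?mem_nth //= leq_addr.
have padE : \prod_(a <- zero_pad la) fq a = \prod_(j < size la) fq (seq_mnm la j).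
  rewrite /zero_pad; case: ifP => _; rewrite ?big_rcons /= ?fq0 ?mulr1.
    by rewrite (big_nth 0%N) big_mkord; apply: eq_bigr => j _; rewrite mnmE.
  by rewrite (big_nth 0%N) big_mkord; apply: eq_bigr => j _; rewrite mnmE.
(* By Cauchy duality the product of the q's pairs with p_be to the coefficient of x^la in p_be; the
   rest of the Pfaffian contributes an even integer. *)
exists ((\prod_(b <- be) psum int (size la) b)@_(seq_mnm la) + 2%:Z * h); split.
  rewrite -schur_Q_weight E ellD padE ell_fq_prod //.
  by rewrite mulr_natl -scaler_nat ellZ hE rmorphD rmorphM.
move=> la0 ula ->.
have [g ->] := @even_diff_glaisher int (size la) la la0.
rewrite mcoeffD mcoeff_psum_uniq // mulr_natl mcoeffMn.
set x := g@__; rewrite (_ : 1 + x *+ 2 + 2%:Z * h = 1 + (x + h) * 2).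
  by move: (x + h) => y; lia.
by rewrite -mulr_natl; ring.
Qed.

(** Here Q_la is q_n, which pairs to 1 with every odd p_be. This calibrates centralizer orders in
    [card_cent_label]. *)
Lemma schur_Q_one : la = [:: n] -> coef (sort geq be) * weight be = 1.
Proof.
move=> la1; rewrite -schur_Q_weight la1 /zero_pad /= big_ord1 expr0 mul1r mulr1 /=.
rewrite /pf_entry big_geq // mulr0 addr0 fq0 mulr1.
exact: ell_fq.
Qed.

End Coefficient.
End SchurQ.

(** * The difference character *)

(** The hypothesis at [p] makes the reduced denominator divide the p'-part of [N], hence prime to
    [p]; this excludes every prime. *)
Lemma int_of_p'_parts (s : algC) (N : nat) : (0 < N)%N -> s \in Crat ->
  (forall p, prime p -> (N`_p^')%N%:R * s \in Aint) -> s \is a Num.int.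
Proof.
move=> N0 /CratP[r ->] H.
have : (`|denq r| == 1)%N.
  apply: contraT => d1; have d2 : (1 < `|denq r|)%N.
    by rewrite ltn_neqAle eq_sym d1 absz_gt0 denq_neq0.
  pose p := pdiv `|denq r|; have p_pr : prime p by exact: pdiv_prime.
  have : ((N`_p^')%N%:R * ratr r : algC) \is a Num.int.
    by rewrite Cint_rat_Aint ?H // rpredM ?rpred_nat // Crat_rat.
  case/intrP => y Ey.
  have {}Ey : (N`_p^')%N%:R * r = y%:~R.
    by apply: (fmorph_inj (ratr : rat -> algC)); rewrite rmorphM /= ratr_nat ratr_int.
  have E : ((N`_p^')%N%:Z * numq r = y * denq r)%R.
    by apply: (@intr_inj rat); rewrite !intrM numqE mulrA -Ey.
  have dv : (`|denq r| %| N`_p^')%N.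
    rewrite -(Gauss_dvdl _ (p := `|numq r|%N)); last by rewrite coprime_sym coprime_num_den.
    have := congr1 absz E; rewrite !abszM absz_nat => ->; exact: dvdn_mull.
  have : (p %| N`_p^')%N by apply: dvdn_trans (pdiv_dvd _) dv.
  by rewrite -[(p %| _)%N]negbK -p'natE // part_pnat.
move/eqP => d1; have := denq_gt0 r; case Ed: (denq r) d1 => [d|d] //= d1 _.
by rewrite -(divq_num_den r) Ed [d]d1 divr1 ratr_int rpred_int.
Qed.

Section DifferenceCharacter.
Variables (n : nat) (gT : finGroupType) (K : {group gT}) (pi : gT -> 'S_n).
Hypothesis pull_char : forall chi : 'CF([set: 'S_n]), chi \is a character ->
  exists2 psi : 'CF(K), psi \is a character & {in K, forall g, psi g = chi (pi g)}.
Variables (A B : 'CF(K)) (w : 'S_n).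
Hypotheses (irrA : A \in irr K) (irrB : B \in irr K) (neqAB : A != B).
Hypothesis uniq_w : uniq (cycle_type w).
Let D := A - B.
Local Notation cl v := (v ^: [set: 'S_n])%g.
Hypothesis D_out : forall g, g \in K -> ~~ uniq (cycle_type (pi g)) -> D g = 0.
Hypothesis S_out : forall g, g \in K -> ~~ all odd (cycle_type (pi g)) -> (A + B) g = 0.
Hypothesis dotBB : forall v, dot_on pi (cl v) B B = dot_on pi (cl v) A A.
Hypothesis dotBA : forall v, dot_on pi (cl v) B A = dot_on pi (cl v) A B.
Variables (k0 : int) (z0 : nat).
Hypothesis k0_odd : odd `|k0|%N.
Hypothesis dotSA : z0%:R * dot_on pi (cl (w.`_(2%N)^')%g) (A + B) A = (k0 ^+ 2)%:~R.

Lemma mem_cl (v x : 'S_n) : (x \in cl v) = (cycle_type x == cycle_type v).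
Proof.
apply/imsetP/eqP => [[y _ ->]|/esym/cycle_type_conj[y ->]]; first exact: cycle_typeJ.
by exists y; rewrite ?inE.
Qed.

Lemma dot_onBl P (f g h : 'CF(K)) : dot_on pi P (f - g) h = dot_on pi P f h - dot_on pi P g h.
Proof.
rewrite /dot_on -mulrBr -sumrB; congr (_ * _); apply: eq_bigr => x _.
by rewrite !cfunE mulrBl.
Qed.

Lemma dot_onDl P (f g h : 'CF(K)) : dot_on pi P (f + g) h = dot_on pi P f h + dot_on pi P g h.
Proof.
rewrite /dot_on -mulrDr -big_split; congr (_ * _); apply: eq_bigr => x _.
by rewrite !cfunE mulrDl.
Qed.

Lemma dot_onBr P (f g h : 'CF(K)) : dot_on pi P h (f - g) = dot_on pi P h f - dot_on pi P h g.
Proof.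
rewrite /dot_on -mulrBr -sumrB; congr (_ * _); apply: eq_bigr => x _.
by rewrite !cfunE rmorphB mulrBr.
Qed.

Let zA : A \in 'Z[irr K]%g. Proof. exact/char_vchar/irrWchar. Qed.
Let zB : B \in 'Z[irr K]%g. Proof. exact/char_vchar/irrWchar. Qed.
Let zD : D \in 'Z[irr K]%g. Proof. by rewrite rpredB. Qed.

Let s := dot_on pi (cl w) D A.

Let s_rat : s \in Crat.
Proof.
apply: (Crat_dot_on_class _ pull_char) => //; first by move=> *; exact: in_setT.
(* Two generators of one cyclic subgroup of S_n have the same cycle type, so classes of S_n are
   rational. *)
move=> x _ y /cycleP[j ->] /eqP; rewrite orderXgcd => oj.
rewrite mem_cl; apply/eqP/cycle_typeX; rewrite /coprime.
have o0 := order_gt0 x; have g0 : (0 < gcdn #[x]%g j)%N by rewrite gcdn_gt0 o0.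
by rewrite -(eqn_pmul2l o0) muln1 -{3}(divnK (dvdn_gcdl #[x]%g j)) (eqP oj).
Qed.

Let section_eq (P : {pred 'S_n}) (f : 'CF(K)) (v : 'S_n) :
    (forall g, g \in K -> f g != 0 -> (pi g \in P) = (cycle_type (pi g) == cycle_type v)) ->
  forall h : 'CF(K), dot_on pi P f h = dot_on pi (cl v) f h.
Proof.
move=> H h; rewrite /dot_on; congr (_ * _); rewrite big_mkcondr [RHS]big_mkcondr /=.
apply: eq_bigr => g gK; have [->|nz] := eqVneq (f g) 0; first by rewrite mul0r !if_same.
by rewrite mem_cl H.
Qed.

Let dot_section p (v : 'S_n) (f h : 'CF(K)) : prime p ->
    (forall g, g \in K -> f g != 0 ->
      (cycle_type ((pi g).`_p^')%g == cycle_type (w.`_p^')%g) = (cycle_type (pi g) == cycle_type v)) ->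
  dot_on pi [pred x | (x.`_p^')%g \in cl (w.`_p^')%g] f h = dot_on pi (cl v) f h.
Proof.
by move=> p_pr H; apply: section_eq => g gK fg; rewrite inE mem_cl H.
Qed.

Let aint_section p (f h : 'CF(K)) : prime p -> f \in 'Z[irr K]%g -> h \in 'Z[irr K]%g ->
  (#|K|`_p^')%N%:R * dot_on pi [pred x | (x.`_p^')%g \in cl (w.`_p^')%g] f h \in Aint.
Proof.
move=> p_pr zf zh; apply: (Aint_dot_on_section _ pull_char) => //; first by move=> *; exact: in_setT.
exact: p_elt_constt.
Qed.

Let D_section p h : prime p ->
  dot_on pi [pred x | (x.`_p^')%g \in cl (w.`_p^')%g] D h = dot_on pi (cl w) D h.
Proof.
move=> p_pr; apply: dot_section => // g gK Dg.
have ug : uniq (cycle_type (pi g)) by apply: contraNT Dg => /D_out->.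
apply/eqP/eqP => [|E]; first exact: uniq_cycle_type_part.
by have [y ->] := cycle_type_conj E; rewrite consttJ cycle_typeJ.
Qed.

Let s_int : s \is a Num.int.
Proof.
apply: (@int_of_p'_parts _ #|K|) => // p p_pr.
by rewrite /s -(D_section _ p_pr) aint_section.
Qed.

Let dotDD v : dot_on pi (cl v) D D = 2%:R * dot_on pi (cl v) D A.
Proof. by rewrite dot_onBr !dot_onBl dotBB dotBA; ring. Qed.

Let dotDD_ge0 v : 0 <= dot_on pi (cl v) D D.
Proof.
rewrite mulr_ge0 ?invr_ge0 ?ler0n // sumr_ge0 // => g _; exact: mul_conjC_ge0.
Qed.

Let s_ge0 : 0 <= s.
Proof. by have := dotDD_ge0 w; rewrite dotDD pmulr_rge0 ?ltr0n. Qed.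

Let s_neq0 : s != 0.
Proof.
apply/eqP => s0.
have p2 : prime 2 by [].
have ES : dot_on pi [pred x | (x.`_(2%N)^')%g \in cl (w.`_(2%N)^')%g] (A + B) A =
    dot_on pi (cl (w.`_(2%N)^')%g) (A + B) A.
  apply: section_eq => g gK Sg; rewrite inE mem_cl.
  have og : all odd (cycle_type (pi g)) by apply: contraNT Sg => /S_out->.
  by rewrite all_odd_constt.
(* On the 2-section [D] contributes [s], assumed to be 0, so [A + B] contributes [2 y] with [m * y]
   an algebraic integer and [m] odd. By [dotSA], the odd number [m * k0 ^+ 2] would then be twice an
   integer. *)
have SAB : A + B = D + (B + B) by rewrite /D addrA subrK.
pose m := (#|K|`_2^')%N; pose y := dot_on pi [pred x | (x.`_(2%N)^')%g \in cl (w.`_(2%N)^')%g] B A.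
have my : m%:R * y \in Aint by exact: aint_section.
have SE : dot_on pi [pred x | (x.`_(2%N)^')%g \in cl (w.`_(2%N)^')%g] (A + B) A = 2%:R * y.
  by rewrite SAB (dot_onDl _ D) (D_section _ p2) -/s s0 (dot_onDl _ B) -/y; ring.
have E : (m%:R * (k0 ^+ 2)%:~R = 2%:R * (z0%:R * (m%:R * y)) :> algC).
  by rewrite -dotSA -ES SE; ring.
have zA' : z0%:R * (m%:R * y) \in Aint by rewrite rpredM ?rpred_nat.
have : z0%:R * (m%:R * y) \in Crat.
  have -> : z0%:R * (m%:R * y) = (m%:R * (k0 ^+ 2)%:~R) / 2%:R by rewrite E [RHS]mulrC mulKf ?pnatr_eq0.
  by rewrite rpred_div ?rpredM ?rpred_nat // rpred_int.
move/Cint_rat_Aint => /(_ zA')/intrP[x Ex].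
rewrite Ex in E; have {}E : (m%:Z * k0 ^+ 2 = 2%:Z * x)%R.
  by apply: (@intr_inj algC); rewrite [LHS]intrM [RHS]intrM; exact: E.
have : odd `|(m%:Z * k0 ^+ 2)%R|%N.
  rewrite abszM abszX oddM oddX k0_odd orbT andbT absz_nat /m.
  by rewrite -[odd _]negbK -dvdn2 -p'natE // part_pnat.
by rewrite E abszM oddM.
Qed.

Lemma diff_support : dot_on pi (cl w) D A = 1 /\ forall g, g \in K -> pi g \notin cl w -> D g = 0.
Proof.
have s1 : 1 <= s.
  have /intrP[x Ex] := s_int; move: s_ge0 s_neq0; rewrite Ex ler0z intr_eq0 ler1z.
  by move=> x0 xn0; rewrite -gtz0_ge1 lt_def xn0.
have K0 : (#|K|%:R != 0 :> algC) by rewrite pnatr_eq0 -lt0n cardG_gt0.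
have nD : '[D, D] = 2%:R.
  have /irrP[i Ei] := irrA; have /irrP[j Ej] := irrB.
  move: neqAB; rewrite /D Ei Ej => ne.
  have ij : i != j by apply: contraNneq ne => ->.
  by rewrite cfdotBl !cfdotBr !cfdot_irr !eqxx [j == i]eq_sym (negbTE ij) /= subr0 sub0r opprK -natrD.
pose T := \sum_(g in K | pi g \notin cl w) D g * (D g)^*.
have T0 : 0 <= T by apply: sumr_ge0 => g _; exact: mul_conjC_ge0.
have ED : 2%:R = 2%:R * s + #|K|%:R^-1 * T.
  rewrite -dotDD -nD cfdotE (bigID (fun g => pi g \in cl w)) /= mulrDr; congr (_ + _).
have T0' : T = 0.
  apply/eqP; rewrite eq_le T0 andbT.
  have : #|K|%:R^-1 * T <= 0 by rewrite -(lerD2l (2%:R * s)) -ED addr0 ler_peMr ?ler0n.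
  by rewrite pmulr_rle0 // invr_gt0 ltr0n cardG_gt0.
split.
  move: ED; rewrite T0' mulr0 addr0 -/s => /esym/eqP.
  by rewrite -[X in _ == X]mulr1 (inj_eq (mulfI _)) ?pnatr_eq0 // => /eqP.
move=> g gK gw; move/eqP: T0'; rewrite psumr_eq0 => [/allP/(_ g)|x _]; last exact: mul_conjC_ge0.
by rewrite mem_index_enum gK gw /= mul_conjC_eq0 => /(_ isT)/eqP.
Qed.

Lemma dot_diff_const (f : gT -> algC) (c : algC) :
  (forall g, g \in K -> pi g \in cl w -> f g = c) ->
  #|K|%:R^-1 * \sum_(g in K) D g * f g * (A g)^* = c.
Proof.
have [s1 out] := diff_support => fc.
rewrite -[RHS]mul1r -[X in _ = X * _]s1 /dot_on -mulrA mulr_suml; congr (_ * _).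
rewrite [RHS]big_mkcondr /=; apply: eq_bigr => g gK; case: ifPn => gw.
  by rewrite fc // mulrAC.
by rewrite out // !mul0r.
Qed.

End DifferenceCharacter.

(** * Spin characters *)

(** The number z_be, each part being multiplied by its multiplicity in the list starting there;
    [card_cent_label] identifies it with a centralizer order. *)
Fixpoint zee (be : seq nat) : nat :=
  if be is b :: be' then (b * (count_mem b be').+1 * zee be')%N else 1%N.

Lemma weight_zee be : weight be * 2 ^+ size be = (zee be)%:R.
Proof.
elim: be => [|b be IH] /=; first by rewrite mulr1.
by rewrite exprS !natrM -IH; field.
Qed.

Lemma zee_nseq c m s :
  zee (nseq c m ++ s) = (m ^ c * (c + count_mem m s) ^_ c * zee s)%N.
Proof.
elim: c => [|c IH] /=; first by rewrite expn0 ffactn0 !mul1n.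
rewrite IH count_cat count_nseq /= eqxx mul1n expnS addSn ffactnS /=; ring.
Qed.

(** The case of Legendre's formula giving (2^k)! the 2-adic valuation 2^k - 1; [H] extracts the even
    factors of a factorial and halves the argument. *)
Lemma dvdn_fact_pow2 k : (2 ^ (2 ^ k) %| 2 * (2 ^ k)`!)%N.
Proof.
have H c : (2 ^ c * c`! %| c.*2`!)%N.
  elim: c => // c IH; rewrite doubleS !factS expnS.
  have -> : (2 * 2 ^ c * (c.+1 * c`!) = (c.*2.+2) * (2 ^ c * c`!))%N by rewrite -muln2; ring.
  by rewrite dvdn_mul // dvdn_mull.
elim: k => [|k IH]; first by [].
rewrite expnS mul2n -{1}addnn expnD.
apply: dvdn_trans (dvdn_mul (dvdnn 2) (H (2 ^ k)%N)).
by rewrite mulnCA dvdn_mul.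
Qed.

(** A part 2^k m of [la] becomes 2^k equal parts of [be] and gives z_be a factor (2^k)!, which lacks
    a single 2 to be divisible by 2^(2^k). Equal odd parts arising from different parts of [la] only
    add a binomial coefficient. *)
Lemma zee_glaisher la : all (leq 1) la ->
  let be := flatten [seq nseq (a`_2)%N (a`_(2%N)^')%N | a <- la] in
  (2 ^ size be %| 2 ^ size la * zee be)%N.
Proof.
elim: la => //= a la IH /andP[a0 /IH{}IH].
rewrite size_cat size_nseq expnD zee_nseq expnS -bin_ffact.
rewrite [X in (_ %| X)%N](_ : _ = ((2 * (a`_2)`!) * (2 ^ size la * zee (flatten [seq nseq (a0`_2)%N (a0`_(2%N)^')%N | a0 <- la])) *
  ((a`_(2%N)^') ^ (a`_2) * 'C((a`_2)%N + count_mem (a`_(2%N)^')%N (flatten [seq nseq (a0`_2)%N (a0`_(2%N)^')%N | a0 <- la]), a`_2)))%N); last by ring.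
apply/dvdn_mulr/dvdn_mul => //.
by rewrite p_part; exact: dvdn_fact_pow2.
Qed.

Lemma odd_sumn (be : seq nat) : all odd be -> odd (sumn be) = odd (size be).
Proof. by elim: be => //= b be IH /andP[ob /IH E]; rewrite oddD ob E. Qed.

(** By Schur's lemma [z] acts as a scalar of square 1, and the scalar is not 1. *)
Lemma irr_central_inv (gT : finGroupType) (K : {group gT}) (chi : 'CF(K)) z :
    chi \in irr K -> z \in 'Z(K)%g -> (z ^+ 2 = 1)%g -> z \notin cfker chi ->
  forall x, x \in K -> chi (z * x)%g = - chi x.
Proof.
move=> /irrP[i ->] zZ z2 zker x xK.
have zK := subsetP (center_sub K) z zZ.
have : z \in 'Z('chi_i)%CF by move: z zZ {z2 zker zK}; apply/subsetP; rewrite -cap_cfcenter_irr bigcap_inf.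
rewrite -{1}irrRepr cfcenter_repr inE => /andP[_ /is_scalar_mxP[a az]].
have mulz y : y \in K -> 'chi_i (z * y)%g = a * 'chi_i y.
  move=> yK; rewrite -irrRepr !cfunE groupM // yK !mulr1n repr_mxM // az.
  by rewrite mul_scalar_mx mxtraceZ.
have chi1 := irr1_neq0 i.
have a2 : a ^+ 2 = 1.
  apply: (mulIf chi1); rewrite mul1r expr2 -mulrA -mulz // -mulz ?mulg1 //.
  by rewrite -expg2 z2.
rewrite mulz //; move/eqP: a2; rewrite sqrf_eq1 => /orP[]/eqP a1; last by rewrite a1 mulN1r.
by case/negP: zker; rewrite cfkerEirr inE -[z]mulg1 mulz // a1 mul1r.
Qed.

Lemma sgn_mx_repr n : mx_repr [set: 'S_n] (fun w : 'S_n => ((-1) ^+ odd_perm w)%:M : 'M[algC]_1).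
Proof.
split=> [|x y _ _]; first by rewrite odd_perm1.
by rewrite -scalar_mxM odd_permM signr_addb.
Qed.

Lemma sgn_char_lin n : sgn_char n \is a linear_char.
Proof.
have -> : sgn_char n = cfRepr (MxRepresentation (@sgn_mx_repr n)).
  by apply/cfunP => w; rewrite cfunElock cfunE inE mulr1n mxtrace_scalar.
by rewrite qualifE /= cfRepr_char cfRepr1 eqxx.
Qed.

Section Spin.
Variables (n : nat) (gT : finGroupType) (G : {group gT}).
Variables (z : gT) (t : nat -> gT) (pi : {morphism G >-> 'S_n}).
Variables (c : seq nat -> gT) (S : seq nat -> 'CF(G)).
Hypotheses (n4 : (4 <= n)%N) (dc : double_cover z t pi) (lab : spin_labelling z pi c S).

Let zG := coverz_in dc.

Lemma sgn_charE (w : 'S_n) : sgn_char n w = (-1) ^+ odd_perm w.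
Proof. by rewrite cfunElock. Qed.

Lemma inflateE (phi : 'CF([set: 'S_n])) g : g \in G -> inflate pi phi g = phi (pi g).
Proof.
move=> gG; rewrite /inflate cfMorphE // cfResE ?subsetT //.
by rewrite mem_morphim.
Qed.

Lemma associateE (chi : 'CF(G)) g : g \in G ->
  associate pi chi g = (-1) ^+ odd_perm (pi g) * chi g.
Proof. by move=> gG; rewrite cfunE inflateE // sgn_charE. Qed.

Lemma inflate_char phi : phi \is a character -> inflate pi phi \is a character.
Proof. by move=> ch; apply/cfMorph_char/cfRes_char. Qed.

Lemma associate_irr chi : chi \in irr G -> associate pi chi \in irr G.
Proof. by apply/mul_lin_irr/cfMorph_lin_char/cfRes_lin_char/sgn_char_lin. Qed.

Lemma spin_zM (chi : 'CF(G)) : spin_irr z chi -> forall x, x \in G -> chi (z * x)%g = - chi x.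
Proof.
case/andP => irr_chi zker; apply: irr_central_inv => //; first exact: cover_central dc.
exact: coverz2 dc.
Qed.

Lemma in_D_n : in_D n [:: n].
Proof. by rewrite /in_D /is_part /= addn0 eqxx !andbT; lia. Qed.

Section Value.
Variables (la be : seq nat).
Hypotheses (laD : in_D n la) (be_odd : all odd be) (be_n : sumn be = n).
Let al := sort geq be.

Lemma in_O_sort : in_O n al.
Proof.
rewrite /in_O /is_part sort_sorted; last exact: geq_total.
rewrite !(perm_all _ (permEl (perm_sort _ _))) (perm_sumn (permEl (perm_sort _ _))) be_n eqxx be_odd !andbT.
by apply/allP => b /(allP be_odd); exact: odd_gt0.
Qed.

Let C := #|'C[pi (c al)]%g|.

(** No centralizer is counted: the labelling formula for the partition (n) contains [C] and the
    known basic spin value, while [schur_Q_one] evaluates its coefficient. *)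
Lemma card_cent_label : C = zee be.
Proof.
clear la laD.
have := schur_Q_one (la := [:: n]) (coef := fun al =>
  (2 ^+ (size [:: n] + size al + odd (n - size [:: n]))./2 * (#|'C[pi (c al)]%g|%:R)^-1 * S [:: n] (c al)))
  (addn0 n) (label_Q lab in_D_n) be_odd be_n erefl.
rewrite (label_basic lab in_O_sort) -/al -/C (perm_size (permEl (perm_sort _ _))).
set e := ((_ + _)./2); set h := _./2 => E.
have L0 : (0 < size be)%N by rewrite lt0n size_eq0; apply: contraTneq n4 => be0; rewrite -be_n be0.
(* The exponents from [label_Q] and [label_basic] add up exactly: all parts being odd, [size be] has
   the parity of [n], and the roundings compensate. *)
have eh : (e + h = size be)%N.
  have := odd_sumn be_odd; rewrite be_n /e /h /= => oL.
  have := odd_double_half (size be); rewrite -oL; case: (boolP (odd n)) => on; last by lia.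
  by lia.
have C0 : (C%:R != 0 :> algC) by rewrite pnatr_eq0 -lt0n cardG_gt0.
have w2 := weight_zee be.
apply/eqP; rewrite -(eqr_nat algC) -w2; apply/eqP.
rewrite -eh exprD -[LHS]mulr1 -[X in _ * X = _]E; field.
exact: C0.
Qed.

(** [K] is the coefficient of p_be in Q_la times its weight z_be / 2^l(be). The factor z_be cancels
    the centralizer order in the labelling formula. *)
Lemma spin_value (e := (size la + size be + odd (n - size la))./2) :
  exists K : int, S la (c al) * 2 ^+ e = K%:~R * 2 ^+ size be /\
    (be = flatten [seq nseq (a`_2)%N (a`_(2%N)^')%N | a <- la] -> odd `|K|%N).
Proof.
have [/and3P[_ la0 /eqP la_n] ula] := andP laD.
have [K [E oK]] := schur_Q_coef la_n (label_Q lab laD) be_odd be_n.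
exists K; split; last exact: oK.
rewrite -E (perm_size (permEl (perm_sort _ _))) -/e -/al -/C.
rewrite -[RHS]mulrA weight_zee -card_cent_label [in RHS]mulrAC divfK 1?mulrC //.
by rewrite pnatr_eq0 -lt0n cardG_gt0.
Qed.

Lemma spin_value_real : (S la (c al))^* = S la (c al).
Proof.
have [K [E _]] := spin_value; set e := _./2 in E.
have p0 : 2 ^+ e != 0 :> algC by rewrite expf_neq0 // pnatr_eq0.
have cp m : (2 ^+ m)^* = 2 ^+ m :> algC by rewrite rmorphXn rmorph_nat.
apply: (mulIf p0); rewrite -[X in _ * X = _]cp -rmorphM E rmorphM /= cp.
by rewrite rmorph_int.
Qed.

End Value.
End Spin.

(** * The hypotheses on the difference character, for both kinds of partitions *)

Section SpinDifference.
Variables (n : nat) (gT : finGroupType) (G : {group gT}).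
Variables (z : gT) (t : nat -> gT) (pi : {morphism G >-> 'S_n}).
Variables (c : seq nat -> gT) (S : seq nat -> 'CF(G)).
Hypotheses (n4 : (4 <= n)%N) (dc : double_cover z t pi) (lab : spin_labelling z pi c S).
Variables (la : seq nat) (w : 'S_n).
Hypotheses (laD : in_D n la) (w_la : cycle_type w = la).
Local Notation cl v := (v ^: [set: 'S_n])%g.

Let zG := coverz_in dc.
Let chi := S la.
Let chi_spin := label_spin lab laD.
Let be := flatten [seq nseq (a`_2)%N (a`_(2%N)^')%N | a <- la].
Let w2 := (w.`_(2%N)^')%g.
Let x := c (sort geq be).
Let C := #|'C[pi x]%g|.
Let eps := nat_of_bool (odd (n - size la)).

Let la0 : all (leq 1) la. Proof. by have [/and3P[]] := andP laD. Qed.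
Let la_n : sumn la = n. Proof. by have [/and3P[_ _ /eqP]] := andP laD. Qed.

Let be_w2 : perm_eq (cycle_type w2) be.
Proof. by rewrite /be -w_la cycle_type_part2. Qed.

Let be_odd : all odd be.
Proof.
apply/allP => b /flattenP[_ /mapP[a ala ->]] /nseqP[-> _].
have a0 := allP la0 a ala.
by rewrite -[odd _]negbK -dvdn2 -p'natE // part_pnat.
Qed.

Let be_n : sumn be = n.
Proof. by rewrite -(perm_sumn be_w2) sumn_cycle_type. Qed.

Let ct_w2 : cycle_type w2 = sort geq be.
Proof.
apply: (sorted_eq geq_trans geq_anti); rewrite ?sorted_cycle_type //.
  exact: sort_sorted geq_total _.
by rewrite (permPl be_w2) perm_sym (permEl (perm_sort _ _)).
Qed.

Let xG : x \in G. Proof. by have [] := label_class lab (in_O_sort be_odd be_n). Qed.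

Let ct_x : cycle_type (pi x) = cycle_type w2.
Proof. by have [_ ->] := label_class lab (in_O_sort be_odd be_n); rewrite ct_w2. Qed.

(** An element above the class is conjugate to [x] or to [z * x], so [chi] takes there only the real
    values [chi x] and [- chi x]. *)
Lemma chi_section g : g \in G -> pi g \in cl w2 -> chi g * (chi g)^* = chi x ^+ 2.
Proof.
move=> gG; rewrite mem_cl -ct_x eq_sym => /eqP/cycle_type_conj[h Eg].
have [H HG EH] := cover_lift dc h.
have ch : chi g = chi x \/ chi g = - chi x.
  have [||->|->] := cover_eq_pi dc (h := (x ^ H)%g) gG; rewrite ?groupJ ?morphJ ?EH //.
    by left; rewrite cfunJ.
  by right; rewrite (spin_zM dc chi_spin) ?groupJ // cfunJ.
have re : (chi x)^* = chi x := spin_value_real n4 dc lab laD be_odd be_n.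
by case: ch => ->; rewrite ?rmorphN /= re ?mulrNN expr2.
Qed.

Lemma card_section : (#|[set g in G | pi g \in cl w2]| * C = 2 * n`!)%N.
Proof.
have -> : #|[set g in G | pi g \in cl w2]| = (2 * #|cl (pi x)|)%N.
  rewrite -sum1_card (partition_big pi (mem (cl (pi x)))) /=; last first.
    by move=> g; rewrite inE !mem_cl ct_x => /andP[].
  rewrite mulnC -sum_nat_const; apply: eq_bigr => v vx.
  have [g0 g0G Eg0] := cover_lift dc v.
  have c2 : #|[set g0; (z * g0)%g]| = 2%N.
    by rewrite cards2 -{1}[g0]mul1g (inj_eq (mulIg _)) eq_sym (coverz_neq1 dc).
  rewrite sum1_card -c2; apply: eq_card => g; rewrite unfold_in /= !inE.
  apply/andP/orP => [[/andP[gG _] /eqP Eg]|].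
    by have [->|->] := cover_eq_pi dc gG g0G (etrans Eg (esym Eg0)); rewrite eqxx; [left | right].
  move: vx; rewrite !mem_cl ct_x => vx.
  by case=> /eqP ->; split; rewrite ?(cover_pi_zM dc) ?Eg0 ?mem_cl ?vx ?andbT ?groupM.
have := index_cent1 [set: 'S_n] (pi x); rewrite setTI => <-.
rewrite -mulnA [(_ * C)%N]mulnC; congr (2 * _)%N.
have -> : C = #|'C_([set: 'S_n])[pi x]%g| by rewrite setTI.
by rewrite LagrangeI cardsT card_Sn.
Qed.

Lemma dot_on_const (K : {group gT}) (f h : 'CF(K)) v : K \subset G ->
    (forall g, g \in G -> pi g \in cl w2 -> g \in K) ->
    (forall g, g \in K -> pi g \in cl w2 -> f g * (h g)^* = v) ->
  dot_on pi (cl w2) f h = v * (2 * n`!)%N%:R / (#|K| * C)%N%:R.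
Proof.
move=> sKG secK fh; rewrite -card_section /dot_on.
rewrite (eq_bigr (fun=> v)) => [|g /andP[gK gw]]; last exact: fh.
have C0 : (C%:R != 0 :> algC) by rewrite pnatr_eq0 -lt0n cardG_gt0.
have K0 : (#|K|%:R != 0 :> algC) by rewrite pnatr_eq0 -lt0n cardG_gt0.
rewrite big_const iter_addr_0 [X in v *+ X](_ : _ = #|[set g in G | pi g \in cl w2]|).
  by rewrite -[v *+ _]mulr_natr !natrM; field; rewrite K0 C0.
apply: eq_card => g; rewrite unfold_in inE; apply/andP/andP => -[gK gw]; split=> //.
  exact: (subsetP sKG).
exact: secK.
Qed.

Lemma section_even g : g \in G -> pi g \in cl w2 -> ~~ odd_perm (pi g).
Proof.
move=> gG; rewrite mem_cl => /eqP E; rewrite odd_perm_cycle_type E.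
rewrite (perm_size be_w2) oddB -?(odd_sumn be_odd) ?be_n ?addbb //.
rewrite -be_n; elim: be be_odd => //= b s IH /andP[/odd_gt0 b0 /IH].
by rewrite -addn1 addnC; apply: leq_add.
Qed.

(** The bracket is the contribution of the class of [w2] to the inner product of A + B with A in
    both cases, [eps] telling them apart. Squaring [spin_value] turns it into K^2 2^l(be) / (2^l(la)
    C), and [zee_glaisher] provides the integer [z0] equal to 2^l(la) C / 2^l(be). *)
Lemma value_norm : exists (k0 : int) (z0 : nat), odd `|k0|%N /\
  z0%:R * (2%:R ^+ eps * chi x ^+ 2 / C%:R) = (k0 ^+ 2)%:~R.
Proof.
have [K [E oK]] := spin_value n4 dc lab laD be_odd be_n.
have CE : C = zee be := card_cent_label n4 dc lab be_odd be_n.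
have /dvdnP[z0 Ez0] := zee_glaisher la0.
exists K, z0; split; first exact: oK.
rewrite -/be -CE -/eps -/chi -/x in E Ez0.
have par : (((size la + size be + eps)./2).*2 = size la + size be + eps)%N.
  have := odd_double_half (size la + size be + eps).
  have le_la : (size la <= n)%N.
    rewrite -la_n; elim: la la0 => //= b s IH /andP[b0 /IH].
    by rewrite -addn1 addnC; apply: leq_add.
  have : odd (size la + size be + eps) = false.
    rewrite !oddD -(odd_sumn be_odd) be_n /eps oddb oddB //.
    by case: (odd n); case: (odd (size la)).
  by move=> ->; rewrite add0n.
set e := _./2 in E par.
have C0 : (C%:R != 0 :> algC) by rewrite pnatr_eq0 -lt0n cardG_gt0.
have p0 m : (2%:R ^+ m != 0 :> algC) by rewrite expf_neq0 // pnatr_eq0.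
have Ez : 2%:R ^+ size la * C%:R = z0%:R * 2%:R ^+ size be :> algC.
  by have := congr1 (fun m => m%:R : algC) Ez0; rewrite !natrM !natrX.
have E2 : chi x ^+ 2 * (2%:R ^+ size la * 2%:R ^+ size be * 2%:R ^+ eps) =
    K%:~R ^+ 2 * 2%:R ^+ size be * 2%:R ^+ size be.
  rewrite -!exprD -par -muln2 exprM -exprMn E exprMn -!mulrA; congr (_ * _).
have -> : (K ^+ 2)%:~R = K%:~R ^+ 2 :> algC by rewrite [K ^+ 2]expr2 intrM -expr2.
apply: (mulIf (p0 (size be))); apply: (mulIf (p0 (size be))); rewrite -E2.
have -> : z0%:R = 2%:R ^+ size la * C%:R / 2%:R ^+ size be :> algC by rewrite Ez mulfK.
by field; rewrite C0 p0.
Qed.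

Let opp0 (a : algC) : a = - a -> a = 0.
Proof. by move/eqP; rewrite -addr_eq0 -mulr2n mulrn_eq0 => /eqP. Qed.

Let chi_even_part g : g \in G -> ~~ odd_perm (pi g) -> ~~ all odd (cycle_type (pi g)) -> chi g = 0.
Proof.
move=> gG ev ne; have [h hG [_ gh]] := cover_even_part n4 dc gG ev ne.
by apply: opp0; rewrite -(spin_zM dc chi_spin) // -gh cfunJ.
Qed.

(** On an even element, either some cycle length is even and the value is 0, or the value is, up to
    sign, one given by Q_la. This makes the character [spin_hat] real. *)
Lemma chi_even_real g : g \in G -> ~~ odd_perm (pi g) -> (chi g)^* = chi g.
Proof.
move=> gG ev; have [og|] := boolP (all odd (cycle_type (pi g))); last first.
  by move/(chi_even_part gG ev) ->; rewrite rmorph0.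
have srt : sort geq (cycle_type (pi g)) = cycle_type (pi g).
  exact/(sorted_sort geq_trans)/sorted_cycle_type.
have inO := in_O_sort og (sumn_cycle_type (pi g)).
have re := spin_value_real n4 dc lab laD og (sumn_cycle_type (pi g)).
have [yG cy] := label_class lab inO; rewrite srt in re yG cy.
move: (c _) re yG cy => y re yG /cycle_type_conj[h Eg].
have [H HG EH] := cover_lift dc h.
have Egh : pi g = pi (y ^ H)%g by rewrite morphJ // EH.
have [->|->] := cover_eq_pi dc gG (groupJ yG HG) Egh.
- by rewrite cfunJ.
- by rewrite (spin_zM dc chi_spin) ?groupJ // cfunJ // rmorphN /= re.
Qed.

(** [D] lives on odd elements and A + B on even ones. For an odd element with a repeated cycle
    length, either alternative of [cover_repeated_part] conjugates it to its product with [z], so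
    [chi] vanishes. *)
Lemma diff_minus (f : gT -> algC) (a : algC) : in_Dminus n la ->
  (forall g, g \in G -> pi g \in cl w -> f g = a) ->
  #|G|%:R^-1 * \sum_(g in G) (chi - associate pi chi) g * f g * (chi g)^* = a.
Proof.
move=> laM fa; have [_ oddla] := andP laM.
have [k0 [z0 [ok0 val]]] := value_norm.
have assocE := associateE pi chi.
have sgn2 g : ((-1) ^+ odd_perm (pi g) : algC) * ((-1) ^+ odd_perm (pi g))^* = 1.
  by case: (odd_perm _); rewrite ?expr0 ?expr1 ?rmorphN ?rmorph1 ?mulrNN mulr1.
have pc (phi : 'CF([set: 'S_n])) : phi \is a character ->
    exists2 psi : 'CF(G), psi \is a character & {in G, forall g, psi g = phi (pi g)}.
  by move=> ch; exists (inflate pi phi); [exact: inflate_char | exact: inflateE].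
have irrA : chi \in irr G by case/andP: chi_spin.
have irrB : associate pi chi \in irr G by exact: associate_irr.
have neq : chi != associate pi chi by rewrite eq_sym; apply/eqP/(label_minus lab laM).
have uw : uniq (cycle_type w) by rewrite w_la; case/andP: laD.
apply: (dot_diff_const pc irrA irrB neq uw _ _ _ _ ok0 (z0 := z0) _ fa).
- move=> g gG nu; rewrite cfunE [X in _ + X]cfunE assocE //.
  have [og|eg] := boolP (odd_perm (pi g)); last by rewrite expr0 mul1r subrr.
  have [h hG gh] := cover_repeated_part n4 dc gG nu.
  have {}gh : (g ^ h = z * g)%g by case: gh => [[_ ->//]|[_ ->]]; rewrite og expg1.
  have -> : chi g = 0 by apply: opp0; rewrite -(spin_zM dc chi_spin) // -gh cfunJ.
  by rewrite mulr0 subrr.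
- move=> g gG no; rewrite cfunE assocE //.
  have [og|eg] := boolP (odd_perm (pi g)); first by rewrite expr1 mulN1r subrr.
  by rewrite chi_even_part // mulr0 addr0.
- move=> v; congr (_ * _); apply: eq_bigr => g /andP[gG _].
  by rewrite assocE // rmorphM mulrACA sgn2 mul1r.
- move=> v; congr (_ * _); apply: eq_bigr => g /andP[gG _].
  rewrite assocE //; case: (odd_perm _); last by rewrite expr0 mul1r.
  by rewrite expr1 mulN1r rmorphN /= mulNr mulrN.
- rewrite -val -/w2; congr (_ * _).
  rewrite (@dot_on_const G _ _ (2%:R * chi x ^+ 2)) // => [|g gG gw].
    have C0 : (C%:R != 0 :> algC) by rewrite pnatr_eq0 -lt0n cardG_gt0.
    rewrite (card_cover dc) /eps oddla expr1 !natrM; field.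
    by rewrite C0 pnatr_eq0 -lt0n fact_gt0.
  by rewrite -(chi_section gG gw) cfunE assocE // (negbTE (section_even gG gw)) expr0; ring.
Qed.

Section Alternating.
Variables psip psim : 'CF(alt_cover pi).
Hypotheses (laP : in_Dplus n la) (irrp : psip \in irr (alt_cover pi))
  (irrm : psim \in irr (alt_cover pi)) (neq_psi : psip != psim)
  (resE : 'Res[alt_cover pi] chi = psip + psim).
Let K := alt_cover pi.

Let nKG : (K <| G)%g. Proof. exact: alt_cover_normal. Qed.
Let sKG : K \subset G. Proof. exact: normal_sub. Qed.

(** By Clifford's theorem the two constituents are conjugate under some [y], which is odd because
    they differ. Any odd [h] acts in the same way, as [y * h] lies in [K]. *)
Lemma alt_swap h g : h \in G -> odd_perm (pi h) -> g \in K -> psim g = psip (g ^ h)%g.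
Proof.
move=> hG oh gK.
have /irrP[i Ei] : chi \in irr G by case/andP: chi_spin.
have /irrP[j Ej] := irrp; have /irrP[k Ek] := irrm.
have jk : j != k by apply: contraNneq neq_psi => E; rewrite Ej Ek E.
have jc : j \in irr_constt ('Res[K] 'chi_i).
  rewrite irr_consttE -Ei resE Ej Ek cfdotDl !cfdot_irr eqxx [k == j]eq_sym (negbTE jk) addr0.
  exact: oner_neq0.
have kc : k \in irr_constt ('Res[K] 'chi_i).
  rewrite irr_consttE -Ei resE Ej Ek cfdotDl !cfdot_irr eqxx (negbTE jk) add0r.
  exact: oner_neq0.
have /cfclassP[y yG Ey] : 'chi_k \in ('chi_j ^: G)%CF.
  have E := Clifford_Res_sum_cfclass nKG jc.
  move: kc; rewrite irr_consttE E cfdotZl mulf_eq0 negb_or => /andP[_].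
  rewrite cfdot_suml; apply: contraR => kn; rewrite big_seq big1 // => xi.
  case/cfclassP => y yG ->; rewrite -conjg_IirrE cfdot_irr; case: eqP => // E1.
  by case/negP: kn; apply/cfclassP; exists y => //; rewrite -E1 conjg_IirrE.
have yN : y \in 'N(K)%g by apply: (subsetP (normal_norm nKG)).
have oy : odd_perm (pi y).
  apply: contraNT neq_psi => ey; rewrite Ej Ek Ey cfConjg_id //.
  by rewrite mem_alt_cover yG.
rewrite Ek Ey cfConjgE // -Ej.
have yhK : (y * h)%g \in K by rewrite mem_alt_cover groupM // morphM // odd_permM oy oh.
by rewrite -(cfunJ psip (g ^ y^-1)%g yhK) -conjgM mulKg.
Qed.

Let zK : z \in 'Z(K)%g.
Proof.
apply/centerP; split; first by rewrite mem_alt_cover zG (cover_pi_z dc) odd_perm1.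
by move=> y yK; apply: (coverz_cent dc); apply: (subsetP sKG).
Qed.

Lemma odd_lift : exists2 h, h \in G & odd_perm (pi h).
Proof.
have lt1 : (1 < n)%N by apply: leq_trans n4.
have [h hG Eh] := cover_lift dc (tperm (Ordinal (ltnW lt1)) (Ordinal lt1)).
by exists h; rewrite // Eh odd_tperm.
Qed.

Let zxK g : g \in K -> (z * g)%g \in K.
Proof. by move=> gK; rewrite groupM // (subsetP (center_sub K)). Qed.

Let resKE g : g \in K -> chi g = psip g + psim g.
Proof. by move=> gK; rewrite -(cfResE _ sKG gK) resE cfunE. Qed.

Let psip_spin g : g \in K -> psip (z * g)%g = - psip g.
Proof.
apply: irr_central_inv => //; first exact: coverz2 dc.
(* If [z] were in the kernel of [psip], it would by swapping be in that of [psim], and [chi] would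
   take equal values at 1 and [z]. *)
have [h hG oh] := odd_lift; apply/negP => zker.
have pz : psip z = psip 1%g.
  by move: zker; have /irrP[i ->] := irrp; rewrite cfkerEirr inE => /eqP.
have mz : psim z = psim 1%g by rewrite !(alt_swap hG oh) ?group1 // ?conj1g ?(coverzJ dc) // -[z]mulg1 zxK.
have zK1 : z \in K by rewrite -[z]mulg1 zxK.
have : chi 1%g = - chi 1%g.
  by rewrite -(spin_zM dc chi_spin) ?group1 // mulg1 !resKE ?group1 // pz mz.
move/opp0; have /irrP[i ->] : chi \in irr G by case/andP: chi_spin.
by move/eqP; rewrite (negbTE (irr1_neq0 i)).
Qed.

Let psim_spin g : g \in K -> psim (z * g)%g = - psim g.
Proof.
move=> gK; have [h hG oh] := odd_lift.
rewrite !(alt_swap hG oh) ?zxK // conjMg (coverzJ dc) // psip_spin //.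
by rewrite memJ_norm // (subsetP (normal_norm nKG)).
Qed.

Lemma alt_swapV h g : h \in G -> odd_perm (pi h) -> g \in K -> psim (g ^ h)%g = psip g.
Proof.
move=> hG oh gK; have hN := subsetP (normal_norm nKG) h hG.
rewrite (alt_swap hG oh) ?memJ_norm // -conjgM cfunJ // mem_alt_cover groupM //.
by rewrite morphM // odd_permM oh.
Qed.

Let sum_swap v h (F : gT -> algC) : h \in G ->
  \sum_(g in K | pi g \in cl v) F g = \sum_(g in K | pi g \in cl v) F (g ^ h)%g.
Proof.
move=> hG; have hN := subsetP (normal_norm nKG) h hG.
rewrite (reindex_inj (conjg_inj h)) /=; apply: eq_bigl => g.
rewrite memJ_norm //; case gK : (g \in K) => //=.
by rewrite morphJ // ?(subsetP sKG) // !mem_cl cycle_typeJ.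
Qed.

Lemma diff_plus (f : gT -> algC) (a : algC) :
  (forall g, g \in K -> pi g \in cl w -> f g = a) ->
  #|K|%:R^-1 * \sum_(g in K) (psip - psim) g * f g * (psip g)^* = a.
Proof.
move=> fa; have [_ evla] := andP laP.
have [k0 [z0 [ok0 val]]] := value_norm.
have [h hG oh] := odd_lift.
have hN := subsetP (normal_norm nKG) h hG.
have pc (phi : 'CF([set: 'S_n])) : phi \is a character ->
    exists2 psi : 'CF(K), psi \is a character & {in K, forall g, psi g = phi (pi g)}.
  move=> ch; exists ('Res[K] (inflate pi phi)); first exact/cfRes_char/inflate_char.
  by move=> g gK; rewrite cfResE // inflateE // (subsetP sKG).
have uw : uniq (cycle_type w) by rewrite w_la; case/andP: laD.
have dBB v : dot_on pi (cl v) psim psim = dot_on pi (cl v) psip psip.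
  rewrite /dot_on; congr (_ * _); rewrite (sum_swap v _ hG); apply: eq_bigr => g /andP[gK _].
  by rewrite alt_swapV.
have dBA v : dot_on pi (cl v) psim psip = dot_on pi (cl v) psip psim.
  rewrite /dot_on; congr (_ * _); rewrite (sum_swap v _ hG); apply: eq_bigr => g /andP[gK _].
  by rewrite alt_swapV // (alt_swap hG oh).
apply: (dot_diff_const pc irrp irrm neq_psi uw _ _ dBB dBA ok0 (z0 := z0) _ fa).
- move=> g gK nu; have [gG eg] : g \in G /\ ~~ odd_perm (pi g).
    by apply/andP; rewrite -mem_alt_cover.
  (* An even [y] conjugates [g] to [z * g], so both characters vanish at [g]. An odd [y] commutes
     with the even element [g], so the swap gives them equal values. *)
  have [y yG [[ey gy]|[oy gy]]] := cover_repeated_part n4 dc gG nu.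
    have yK : y \in K by rewrite mem_alt_cover yG.
    have p0 : psip g = 0 by apply: opp0; rewrite -psip_spin // -gy cfunJ.
    have m0 : psim g = 0 by apply: opp0; rewrite -psim_spin // -gy cfunJ.
    by rewrite !cfunE p0 m0 subrr.
  by rewrite !cfunE (alt_swap yG oy gK) gy (negbTE eg) expg0 mul1g subrr.
- move=> g gK no; have [gG eg] : g \in G /\ ~~ odd_perm (pi g).
    by apply/andP; rewrite -mem_alt_cover.
  by rewrite cfunE -resKE // chi_even_part.
(* Only the sum of the two constituents is a restriction of [chi] with known values; by the swap
   symmetry each accounts for half of the pairing. *)
- have dS : dot_on pi (cl w2) (psip + psim) psip =
      dot_on pi (cl w2) (psip + psim) (psip + psim) / 2%:R.
    have dDr (f1 f2 f3 : 'CF(K)) : dot_on pi (cl w2) f1 (f2 + f3) =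
        dot_on pi (cl w2) f1 f2 + dot_on pi (cl w2) f1 f3.
      rewrite /dot_on -mulrDr -big_split; congr (_ * _); apply: eq_bigr => g _.
      by rewrite cfunE rmorphD mulrDr.
    by rewrite dDr !dot_onDl dBB dBA; field.
  rewrite -val -/w2 dS; congr (_ * _).
  rewrite (@dot_on_const K _ _ (chi x ^+ 2)) //.
  + have C0 : (C%:R != 0 :> algC) by rewrite pnatr_eq0 -lt0n cardG_gt0.
    rewrite /K (card_alt_cover n4 dc) /eps (negbTE evla) expr0 !natrM; field.
    by rewrite C0 pnatr_eq0 -lt0n fact_gt0.
  + by move=> g gG gw; rewrite mem_alt_cover gG section_even.
  + move=> g gK gw; rewrite -(chi_section (subsetP sKG g gK) gw).
    by rewrite cfunE -resKE.
Qed.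

End Alternating.

End SpinDifference.

(** * Reality of the characters of S_n, and the multiplicities *)

Lemma sym_char_char n mu : sym_char n mu \is a character.
Proof. by rewrite /sym_char; case: pickP => [i _|_]; rewrite ?irr_char ?cfun0_char ?rpred0. Qed.

Lemma cycle_typeV n (w : 'S_n) : cycle_type w^-1%g = cycle_type w.
Proof. by apply: eq_cycle_type => k; apply: eq_card => i; rewrite !inE porbitV. Qed.

Lemma sym_cfun_conj n (phi : 'CF([set: 'S_n])) (v w : 'S_n) :
  cycle_type v = cycle_type w -> phi v = phi w.
Proof. by move/cycle_type_conj => [h ->]; rewrite cfunJ ?inE. Qed.

Lemma sym_char_real n mu (w : 'S_n) : (sym_char n mu w)^* = sym_char n mu w.
Proof.
rewrite -char_inv ?sym_char_char //; apply: sym_cfun_conj; exact: cycle_typeV.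
Qed.

Theorem theorem4p11 (n : nat) (gT : finGroupType) (G : {group gT})
    (z : gT) (t : nat -> gT) (pi : {morphism G >-> 'S_n})
    (c : seq nat -> gT) (S : seq nat -> 'CF(G))
    (la mu : seq nat) (w : 'S_n) :
  (4 <= n)%N ->
  double_cover z t pi ->
  spin_labelling z pi c S ->
  in_D n la ->
  is_part n mu ->
  cycle_type w = la ->
  sym_char n mu w != 0 ->
  let M := inflate pi (sym_char n mu) in
  (in_Dminus n la ->
     let Xp := S la in
     let Xm := associate pi (S la) in
     let mp := '[Xp, M * Xp] in
     let mm := '[Xm, M * Xp] in
     [/\ mp - mm = sym_char n mu w,
         0 < `|sym_char n mu w|,
         `|sym_char n mu w| <= Num.max mp mm,
         Num.max mp mm <= '[M, Xp * spin_hat pi S la]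
       & Num.max mp mm <= '[M, Xm * spin_hat pi S la]])
  /\
  (in_Dplus n la ->
     forall psip psim : 'CF(alt_cover pi),
     psip \in irr (alt_cover pi) ->
     psim \in irr (alt_cover pi) ->
     psip != psim ->
     'Res[alt_cover pi] (S la) = psip + psim ->
     let MA := 'Res[alt_cover pi] M in
     let mp := '[psip, MA * psip] in
     let mm := '[psim, MA * psip] in
     [/\ mp - mm = sym_char n mu w,
         mp + mm = 2 * mm + sym_char n mu w /\
         mp + mm = '[M * S la, S la],
         0 < `|sym_char n mu w|,
         `|sym_char n mu w| <= Num.max mp mm /\
         Num.max mp mm <= '[M * S la, S la]
       & ('[M * S la, S la] == sym_char n mu w %[mod 2])%C]).
Proof.
move=> n4 dc lab laD mu_n w_la nz M.
have M_char : M \is a character by exact/inflate_char/sym_char_char.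
have ME g : g \in G -> M g = sym_char n mu (pi g) by exact: inflateE.
have M_real g : g \in G -> (M g)^* = M g by move=> gG; rewrite ME // sym_char_real.
have M_cl g : g \in G -> pi g \in (w ^: [set: 'S_n])%g -> M g = sym_char n mu w.
  by move=> gG; rewrite ME // mem_cl => /eqP/sym_cfun_conj.
have v_gt0 : 0 < `|sym_char n mu w| by rewrite normr_gt0.
(* The order on complex numbers is partial; the maximum is meaningful because multiplicities are
   natural numbers. *)
have le_max (a b v : algC) : a \is a Num.nat -> b \is a Num.nat -> a - b = v ->
    `|v| <= Num.max a b /\ Num.max a b <= a + b.
  move=> aN bN <-; have [a0 b0] := (natr_ge0 aN, natr_ge0 bN).
  have /orP[ab|ba] : (a <= b) || (b <= a) by apply: real_leVge; rewrite ger0_real.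
    by rewrite (max_r ab) ler0_norm ?subr_le0 // opprB gerBl lerDr.
  by rewrite (max_l ba) ger0_norm ?subr_ge0 // gerBl lerDl.
have irrX : S la \in irr G by case/andP: (label_spin lab laD).
have X_char := irrWchar irrX.
split=> [laM Xp Xm mp mm | laP psip psim irrp irrm neq resE MA mp mm].
  have Xm_char : Xm \is a character by apply/irrWchar/associate_irr.
  have MX_char : M * Xp \is a character by rewrite rpredM.
  have mpN : mp \is a Num.nat by exact: Cnat_cfdot_char.
  have mmN : mm \is a Num.nat by exact: Cnat_cfdot_char.
  have diff : mp - mm = sym_char n mu w.
    rewrite -cfdotBl cfdotE -(diff_minus n4 dc lab laD w_la laM M_cl).
    congr (_ * _); apply: eq_bigr => g gG.
    by rewrite [in X in _ * X = _]cfunE rmorphM /= M_real // mulrA.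
  have XhE : spin_hat pi S la = Xp + Xm by rewrite /spin_hat; case/andP: laM => _ ->.
  have Xh_real g : g \in G -> (spin_hat pi S la g)^* = spin_hat pi S la g.
    move=> gG; rewrite XhE cfunE /Xm associateE //.
    have [og|eg] := boolP (odd_perm (pi g)); first by rewrite expr1 mulN1r subrr rmorph0.
    by rewrite expr0 mul1r rmorphD /= (chi_even_real n4 dc lab laD).
  have dotp : '[M, Xp * spin_hat pi S la] = mp + mm.
    rewrite -cfdotDl -XhE !cfdotE; congr (_ * _); apply: eq_bigr => g gG.
    rewrite [in X in _ * X = _]cfunE [in X in _ = _ * X]cfunE !rmorphM /= M_real // Xh_real //.
    by rewrite mulrA mulrC [RHS]mulrA [in RHS]mulrC; ring.
  (* [spin_hat] vanishes on odd elements, and on even ones the two associates agree, so both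
     products are the same character. *)
  have dotm : '[M, Xm * spin_hat pi S la] = mp + mm.
    rewrite -dotp; congr '[_, _]; apply/cfun_inP => g gG.
    have mulE (f h : 'CF(G)) : (f * h) g = f g * h g by rewrite cfunE.
    have addE (f h : 'CF(G)) : (f + h) g = f g + h g by rewrite cfunE.
    rewrite (mulE Xm) (mulE Xp) XhE addE /Xm associateE //.
    by case: (odd_perm _); rewrite ?expr0 ?expr1; ring.
  have [le1 le2] := le_max _ _ _ mpN mmN diff.
  by rewrite dotp dotm.
pose K := alt_cover pi.
have sKG : K \subset G by exact/normal_sub/alt_cover_normal.
have MA_char : MA \is a character by exact: cfRes_char.
have MX_char : MA * psip \is a character by rewrite rpredM // irrWchar.
have mpN : mp \is a Num.nat by apply: Cnat_cfdot_char => //; exact: irrWchar.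
have mmN : mm \is a Num.nat by apply: Cnat_cfdot_char => //; exact: irrWchar.
have diff : mp - mm = sym_char n mu w.
  rewrite -cfdotBl cfdotE -(diff_plus n4 dc lab laD w_la laP irrp irrm neq resE (f := M) (a := sym_char n mu w)); last first.
    by move=> g /(subsetP sKG); exact: M_cl.
  congr (_ * _); apply: eq_bigr => g gK; have gG := subsetP sKG g gK.
  by rewrite [in X in _ * X = _]cfunE rmorphM /= cfResE // M_real // mulrA.
(* [S la] vanishes outside the alternating cover, of index 2, and conjugation by an odd element
   equates the contributions of [psip] and [psim]; the two factors 2 cancel. *)
have total : mp + mm = '[M * S la, S la].
  have [h hG oh] := odd_lift n4 dc.
  have hN : h \in 'N(K)%g :=  subsetP (normal_norm (alt_cover_normal pi)) h hG.
  have chi_odd g : g \in G :\: K -> S la g = 0.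
    case/setDP => gG; rewrite mem_alt_cover gG /= negbK => og; apply/eqP.
    have := congr1 (fun phi : 'CF(G) => phi g) (label_plus lab laP).
    rewrite associateE // og expr1 mulN1r => /esym/eqP.
    by rewrite -addr_eq0 -mulr2n mulrn_eq0.
  have chi_KE g : g \in K -> S la g = psip g + psim g.
    by move=> gK; rewrite -(cfResE _ sKG gK) resE cfunE.
  have swap : \sum_(g in K) M g * S la g * (psim g)^* =
      \sum_(g in K) M g * S la g * (psip g)^*.
    rewrite (reindex_inj (conjg_inj h)) /=.
    rewrite (eq_bigl (fun g => g \in K)) => [|g]; last exact: memJ_norm.
    by apply: eq_bigr => g gK; rewrite (cfunJ M g hG) (cfunJ (S la) g hG) (alt_swapV lab laD irrp irrm neq resE hG oh).
  have GK : #|G|%:R = 2 * #|K|%:R :> algC.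
    by rewrite (card_cover dc) (card_alt_cover n4 dc) natrM.
  rewrite -cfdotDl -resE cfdotE cfdotE GK [in RHS](big_setID K) /= (setIidPr sKG).
  rewrite [X in _ = _ * (_ + X)]big1 => [|g /chi_odd ->]; last by rewrite rmorph0 mulr0.
  have -> : \sum_(g in K) (M * S la) g * (S la g)^* =
      2 * \sum_(g in K) M g * S la g * (psip g)^*.
    rewrite mulr_natl mulr2n -[in X in _ = _ + X]swap -big_split /=; apply: eq_bigr => g gK.
    by rewrite cfunE [in X in _ * X^* = _]chi_KE // rmorphD mulrDr.
  rewrite addr0 invfM mulrACA mulVf ?pnatr_eq0 // mul1r; congr (_ * _).
  apply: eq_bigr => g gK; have gG := subsetP sKG g gK.
  by rewrite cfunE !cfResE // rmorphM /= M_real //; ring.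
have [le1 le2] := le_max _ _ _ mpN mmN diff.
rewrite -total; split=> //; first by split=> //; rewrite -diff; ring.
(* The difference of the two sides is twice the natural number [mm]. *)
rewrite /eqCmod -diff.
have -> : mp + mm - (mp - mm) = 2 * mm by ring.
by apply: dvdC_mulr; [exact: intr_nat | exact: dvdC_refl].
Qed.
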